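(* Let $D_\circ$ be a hollow dissection. The polytope \[ \operatorname{conv}\bigl\{\mathbf{p}(D_\circ\mid D_\bullet) : D_\bullet \text{ a maximal } D_\circ\text{-accordion dissection}\bigr\} \] coincides with the polytope \[ \bigcap_{\gamma_\bullet} \bigl\{\mathbf{x}\in\mathbb{R}^{D_\circ} : \langle \mathbf{g}(D_\circ\mid\gamma_\bullet),\mathbf{x}\rangle \le \omega(D_\circ\mid\gamma_\bullet)\bigr\}, \] the intersection being over all internal $D_\circ$-accordion diagonals $\gamma_\bullet$. This polytope (the $D_\circ$-accordiohedron $\mathrm{Acco}(D_\circ)$) has as normal fan the $\mathbf{g}$-vector fan $\{\mathbb{R}_{\ge0}\{\mathbf{g}(D_\circ\mid\delta_\bullet):\delta_\bullet\in D_\bullet\} : D_\bullet \text{ a } D_\circ\text{-accordion dissection}\}$.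
   Context: Fix $n\ge 2$ and $2n$ points on the unit circle of the (standardly oriented) Euclidean plane, labeled $1,\dots,2n$ in clockwise order (labels modulo $2n$). Odd-labeled points are hollow, even-labeled points are solid. The hollow polygon (resp. solid polygon) is the convex hull of the hollow (resp. solid) points. A hollow (resp. solid) diagonal is a segment joining two hollow (resp. two solid) points; polygon edges (boundary edges) count as diagonals, the others are internal. Two segments cross if they meet at a point interior to both. A hollow (resp. solid) dissection is a set of pairwise non-crossing internal hollow (resp. solid) diagonals; its cells are the closures of connected components of the polygon minus its diagonals; $\overline{D}$ is $D$ together with all boundary edges of its polygon. For a hollow dissection $D_\circ$, a solid diagonal $\delta_\bullet$ is a $D_\circ$-accordion diagonal if the union of the segments of $\overline{D_\circ}$ crossed by $\delta_\bullet$ is connected; symmetrically with colors exchanged. A $D_\circ$-accordion dissection is a solid dissection consisting of $D_\circ$-accordion diagonals; it is maximal if maximal for inclusion. Sign function: let $R$ be a dissection of one of the two polygons, $r\in R$, and $e$ a diagonal of the other polygon. Set $\zeta_R(r,e)=0$ if $e$ does not cross $r$. Otherwise, in each of the two cells of $R$ containing $r$, $e$ crosses exactly one other segment of $\overline{R}$; call them $\mu,\nu$. If $\mu,\nu$ are incident to distinct endpoints of $r$, write $r=uv$, $\mu=au$, $\nu=vb$, and set $\zeta_R(r,e)=1$ if $a$ lies strictly to the right of the directed line from $u$ to $v$ (a ''Z''), and $-1$ if strictly to the left (an ''S''). Otherwise $\zeta_R(r,e)=0$. $\mathbb{R}^{D_\circ}$ has basis $(\mathbf{e}_{\delta_\circ})_{\delta_\circ\in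 D_\circ}$ and standard inner product $\langle\cdot,\cdot\rangle$. The $\mathbf{g}$-vector of a solid diagonal $\delta_\bullet$ is $\mathbf{g}(D_\circ\mid\delta_\bullet)=\sum_{\delta_\circ\in D_\circ}\zeta_{D_\circ}(\delta_\circ,\delta_\bullet)\mathbf{e}_{\delta_\circ}$. For a maximal $D_\circ$-accordion dissection $D_\bullet$ and $\delta_\bullet\in D_\bullet$, the $\mathbf{c}$-vector is $\mathbf{c}(D_\circ\mid D_\bullet\mid\delta_\bullet)=-\sum_{\delta_\circ\in D_\circ}\zeta_{D_\bullet}(\delta_\bullet,\delta_\circ)\mathbf{e}_{\delta_\circ}$. The height $\omega(D_\circ\mid\gamma_\bullet)$ of a solid diagonal $\gamma_\bullet$ is the number of internal $D_\circ$-accordion diagonals crossing $\gamma_\bullet$. For a maximal $D_\circ$-accordion dissection $D_\bullet$, $\mathbf{p}(D_\circ\mid D_\bullet)=\sum_{\delta_\bullet\in D_\bullet}\omega(D_\circ\mid\delta_\bullet)\,\mathbf{c}(D_\circ\mid D_\bullet\mid\delta_\bullet)$. The normal fan of a polytope $P$ is the fan of cones $\{\mathbf{y} : \text{the face of } P \text{ maximizing } \langle\mathbf{y},\cdot\rangle \text{ contains } F\}$ for faces $F$ of $P$. *)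

(* Defs.v *)
From HB Require Import structures.
From mathcomp Require Import all_boot all_order all_algebra.
From mathcomp Require Import all_classical all_reals all_analysis.
Set Implicit Arguments.
Unset Strict Implicit.
Unset Printing Implicit Defensive.
Import Order.TTheory GRing.Theory Num.Theory.
Import numFieldNormedType.Exports.

Local Open Scope classical_set_scope.
Local Open Scope ring_scope.

Definition conv_hull (R : realType) (V : lmodType R) (A : set V) : set V :=
  smallest (@convex_set R V) A.

Section Polyhedra.
Context {R : realType} {I : finType}.
Local Notation V := {ffun I -> R^o}.

Definition dot (x y : V) : R := \sum_i x i * y i.

Definition maximizers (P : set V) (y : V) : set V :=
  [set x | P x /\ forall z, P z -> dot y z <= dot y x].

(* Only nonempty faces: the condition defining the normal cone would hold
   everywhere for the empty face. *)
Definition is_face (P F : set V) : Prop :=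
  F !=set0 /\ exists y, F = maximizers P y.

Definition normal_cone (P F : set V) : set V :=
  [set y | F `<=` maximizers P y].

Definition normal_fan (P : set V) : set (set V) :=
  [set normal_cone P F | F in is_face P].

End Polyhedra.

(* The ordinal [i : 'I_(n.*2)] stands for the label [i] modulo [2n], so that
   [0] is the label [2n]: hollow points are the odd ordinals and solid points
   the even ones. *)
Definition color := bool.
Definition hollow : color := true.
Definition solid : color := false.

(* A segment is represented by the set of the labels of its endpoints. *)
Notation segment n := {set 'I_(n.*2)}.

Section Labels.
Variable n : nat.
Implicit Types (c : color) (d : segment n) (E : {set segment n}).

Definition diagonals c : {set segment n} :=
  [set d : segment n | (#|d| == 2) && [forall i in d, odd i == c]].

(* For [n = 2] each polygon is a single segment, which is its own edge. *)
Definition edges c : {set segment n} :=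
  [set d in diagonals c | [exists i in d, exists j in d,
     (j == i + 2 %[mod n.*2])%N]].

Definition internal_diagonals c : {set segment n} :=
  diagonals c :\: edges c.

Definition with_edges c E : {set segment n} := E :|: edges c.

End Labels.

Section Accordiohedron.
Context {R : realType} {n : nat}.
Local Notation plane := (R^o * R^o)%type.
Variable pt : 'I_(n.*2) -> plane.
Implicit Types (c : color) (d e r : segment n) (u v a b : 'I_(n.*2)).
Implicit Types (D E : {set segment n}) (C : set plane).

Definition clockwise_on_circle : Prop :=
  exists theta : 'I_(n.*2) -> R,
  [/\ forall i, pt i = (cos (theta i), sin (theta i)),
      forall i j : 'I_(n.*2), (i < j)%N -> theta j < theta i &
      forall i j, theta i - theta j < 2 * pi].

Definition polygon c : set plane :=
  conv_hull (pt @` [set i : 'I_(n.*2) | odd i = c]).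

Definition seg d : set plane := conv_hull (pt @` [set` d]).

Definition open_seg d : set plane := seg d `\` pt @` [set` d].

Definition crosses d e : Prop :=
  d != e /\ open_seg d `&` open_seg e !=set0.

Definition dissection c E : Prop :=
  E \subset internal_diagonals n c /\ {in E &, forall d e, ~ crosses d e}.

Definition cut_polygon c E : set plane :=
  polygon c `\` \bigcup_(d in [set` E]) seg d.

Definition is_cell c E C : Prop :=
  exists2 x, cut_polygon c E x &
    C = closure (connected_component (cut_polygon c E) x).

(* [E] is a dissection of the polygon of color [c], and [d] has the other
   color. *)
Definition accordion_diagonal c E d : Prop :=
  d \in diagonals n (~~ c) /\
  connected (\bigcup_(e in [set e | e \in with_edges c E /\ crosses d e]) seg e).

Definition crosses_in_cell c E r e C d : Prop :=
  [/\ d \in with_edges c E, d != r, seg d `<=` C & crosses e d].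

(* The segments [mu = au] and [nu = vb] are incident to distinct endpoints of
   [r = uv]. *)
Definition zigzag c E r e u v a : Prop :=
  exists C1 C2 b,
    [/\ is_cell c E C1, is_cell c E C2, C1 <> C2 & seg r `<=` C1 `&` C2] /\
    [/\ r = [set u; v]%SET,
        crosses_in_cell c E r e C1 [set a; u]%SET &
        crosses_in_cell c E r e C2 [set v; b]%SET].

(* Positive when [z] is strictly to the left of the line directed from [x]
   to [y], negative when it is strictly to the right. *)
Definition orientation (x y z : plane) : R :=
  (y.1 - x.1) * (z.2 - x.2) - (y.2 - x.2) * (z.1 - x.1).

Definition is_Z c E r e : Prop :=
  exists u v a, zigzag c E r e u v a /\ orientation (pt u) (pt v) (pt a) < 0.

Definition is_S c E r e : Prop :=
  exists u v a, zigzag c E r e u v a /\ 0 < orientation (pt u) (pt v) (pt a).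

Definition zeta c E r e : R :=
  if `[< crosses e r /\ is_Z c E r e >] then 1
  else if `[< crosses e r /\ is_S c E r e >] then -1
  else 0.

Definition accordion_dissection D E : Prop :=
  dissection solid E /\ {in E, forall d, accordion_diagonal hollow D d}.

Definition maximal_accordion_dissection D E : Prop :=
  accordion_dissection D E /\
  forall E', accordion_dissection D E' -> E \subset E' -> E' = E.

Definition internal_accordion_diagonals D : {set segment n} :=
  [set d in internal_diagonals n solid | `[< accordion_diagonal hollow D d >]]%SET.

Definition height D d : nat :=
  #|[set e in internal_accordion_diagonals D | `[< crosses e d >]]%SET|.

Definition coordinates D := {ffun {d : segment n | d \in D} -> R^o}.

Definition g_vector D d : coordinates D :=
  [ffun x => zeta hollow D (val x) d].

Definition c_vector D E d : coordinates D :=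
  [ffun x => - zeta solid E d (val x)].

Definition p_point D E : coordinates D :=
  \sum_(d in E) (height D d)%:R *: c_vector D E d.

Definition accordiohedron D : set (coordinates D) :=
  conv_hull [set p_point D E | E in maximal_accordion_dissection D].

Definition halfspace_intersection D : set (coordinates D) :=
  \bigcap_(d in [set` internal_accordion_diagonals D])
    [set x | dot (g_vector D d) x <= (height D d)%:R].

Definition g_cone D E : set (coordinates D) :=
  [set \sum_(d in E) t d *: g_vector D d |
     t in [set t : segment n -> R | forall d, 0 <= t d]].
Arguments g_cone D E : clear implicits.

Definition g_vector_fan D : set (set (coordinates D)) :=
  [set g_cone D E | E in accordion_dissection D].

End Accordiohedron.

Arguments accordiohedron {R n} pt D.
Arguments halfspace_intersection {R n} pt D.
Arguments g_cone {R n} pt D E.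
Arguments g_vector_fan {R n} pt D.

(* Main.v *)
(* Everything is reduced to the cyclic order of the labels. When two accordion
   diagonals [ab] and [cd] cross, they cross a common chord of [D], and this
   yields g(ab) + g(cd) = g(ad) + g(cb), where [ad] and [cb] are again accordion
   diagonals, or edges, whose g-vector vanishes. Every diagonal crosses [ad] and
   [cb] at most as often as [ab] and [cd], and the crossing of [ab] with [cd]
   itself is lost, so that the sum of the heights strictly decreases.
   Together with the duality of the g- and c-vectors of a maximal accordion
   dissection, and with the fact that every vector of the canonical basis and
   its opposite are g-vectors, this exchange relation is all that is used:
   on the vertex of [E] the functional g(d) takes the value of the height of [d]
   if [d] is in [E], and a smaller value otherwise; resolving crossings in a
   nonnegative combination of g-vectors of least weight puts every vector in the
   cone of a dissection. *)

Require Import Defs.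
From mathcomp Require Import all_boot all_order all_algebra.
From mathcomp Require Import all_classical all_reals all_analysis.
From mathcomp Require Import zify ring lra.
Set Implicit Arguments.
Unset Strict Implicit.
Unset Printing Implicit Defensive.

(** * Cyclic order *)

(** An accordion diagonal [ab] crossing an internal chord [ij] continues on each side of [ij] around
    exactly one of its two endpoints. The sign at [ij] is therefore a term depending on [a] alone
    minus a term depending on [b] alone, and exchanging ends across a common chord preserves the sum
    of the signs there; any other chord lies on one side of [ij] and sees only the ends on that
    side. Hence the exchange relation. The same separation of ends reduces the duality to counting
    in fans: among the crossed chords at a common point, as many have a neighbor towards [a] as
    towards [b]. All terms cancel except one at the side cutting off [b], which yields the diagonal
    value. Both dissections play the same part here, so the chords of [D] must in turn be accordion
    diagonals of the maximal dissection. The basis vectors and their opposites come from rotating a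
    diagonal of [D] by one label in either direction. Euclidean geometry only translates crossings,
    connectedness and cells into the cyclic order. *)

Definition cyc (i j k : nat) := [|| i < j < k, j < k < i | k < i < j].

(* A reflexive decision procedure for quantifier-free statements on the cyclic
   order: the truth of a statement depends only on the order type of its
   variables, and [refute] enumerates order types variable by variable, dropping
   those that violate an already decidable hypothesis. *)
Inductive cform :=
  CBool of bool | CCyc of nat & nat & nat | CEq of nat & nat | CNot of cform
| CAnd of cform & cform | COr of cform & cform | CImp of cform & cform.

Fixpoint ceval (s : seq nat) f := match f with
  | CBool b => b
  | CCyc i j k => cyc (nth 0 s i) (nth 0 s j) (nth 0 s k)
  | CEq i j => nth 0 s i == nth 0 s j
  | CNot f => ~~ ceval s f
  | CAnd f g => ceval s f && ceval s g
  | COr f g => ceval s f || ceval s g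
  | CImp f g => ceval s f ==> ceval s g
  end.

Fixpoint cvars f := match f with
  | CBool _ => 0
  | CCyc i j k => (maxn i (maxn j k)).+1
  | CEq i j => (maxn i j).+1
  | CNot f => cvars f
  | CAnd f g | COr f g | CImp f g => maxn (cvars f) (cvars g)
  end.

Fixpoint chyps f := match f with CAnd f g => chyps f ++ chyps g | _ => [:: f] end.
Fixpoint cneg f := match f with
  | CImp f g => chyps f ++ cneg g | _ => chyps (CNot f) end.

Definition shift c w := if w < c then w else w.+1.

(** [n] variables remain to be placed, [s] holds the ranks of the others and [m] bounds these ranks.
    A new variable takes an existing rank or opens a new one, [shift] making room. A hypothesis is
    tested when its last variable has just been placed; reaching [n = 0] means that some order type
    survives. *)
Fixpoint refute (hs : seq cform) (n m : nat) (s : seq nat) : bool := match n with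
  | 0 => false
  | n.+1 =>
    let ok t := all (fun h => if cvars h == (size t) then ceval t h else true) hs in
    all (fun c => let t := rcons s c in if ok t then refute hs n m t else true)
      (iota 0 m)
    && all (fun c => let t := rcons (map (shift c) s) c in
                     if ok t then refute hs n m.+1 t else true) (rcons (iota 0 m) m)
  end.

Definition order_iso (r s : seq nat) := size r = size s /\
  forall i j, i < size r -> j < size r ->
    (nth 0 r i < nth 0 r j) = (nth 0 s i < nth 0 s j).

Lemma ceval_iso r s f : order_iso r s -> cvars f <= size r -> ceval r f = ceval s f.
Proof.
move=> [_ iso]; elim: f => [b|i j k|i j|f IH|f IHf g IHg|f IHf g IHg|f IHf g IHg] /=;
  rewrite ?geq_max ?gtn_max //.
- by move=> /and3P[hi hj hk]; rewrite /cyc !iso.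
- by move=> /andP[hi hj]; rewrite !eqn_leq !(leqNgt (nth _ _ _)) !iso.
- by move=> /IH->.
all: by move=> /andP[/IHf-> /IHg->].
Qed.

Lemma ceval_cat s t f : cvars f <= size s -> ceval (s ++ t) f = ceval s f.
Proof.
elim: f => [b|i j k|i j|f IH|f IHf g IHg|f IHf g IHg|f IHf g IHg] /=;
  rewrite ?geq_max ?gtn_max //.
- by move=> /and3P[hi hj hk]; rewrite !nth_cat hi hj hk.
- by move=> /andP[hi hj]; rewrite !nth_cat hi hj.
- by move=> /IH->.
all: by move=> /andP[/IHf-> /IHg->].
Qed.

Lemma shift_lt c x y : (shift c x < shift c y) = (x < y).
Proof. by rewrite /shift; case: (ltnP x c); case: (ltnP y c); lia. Qed.

Lemma shift_ltl c x : (shift c x < c) = (x < c).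
Proof. by rewrite /shift; case: (ltnP x c); lia. Qed.

Lemma shift_ltr c x : (c < shift c x) = (c <= x).
Proof. by rewrite /shift; case: (ltnP x c); lia. Qed.

Lemma nth_rcons_lt (t : seq nat) n (k i : nat) : size t = n -> i < n.+1 ->
  nth 0 (rcons t k) i = if i < n then nth 0 t i else k.
Proof.
by rewrite nth_rcons ltnS leq_eqVlt => -> /orP[/eqP->|->//]; rewrite ltnn eqxx.
Qed.

Lemma order_iso_rcons r s m v : order_iso r s -> {in s, forall i, i < m} ->
  (exists2 c, c \in s & order_iso (rcons r v) (rcons s c)) \/
  (exists2 c, c < m.+1 & order_iso (rcons r v) (rcons (map (shift c) s) c)).
Proof.
move=> [sz iso] bd.
case: (boolP (v \in r)) => [/(nthP 0)[u hu eu]|vr].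
  left; exists (nth 0 s u); first by rewrite mem_nth // -sz.
  split=> [|i j]; rewrite !size_rcons ?sz // -sz => hi hj.
  rewrite !(nth_rcons_lt _ (erefl (size r))) // !(nth_rcons_lt _ (esym sz)) //.
  by case: (ltnP i) => h1; case: (ltnP j) => h2; rewrite -?eu ?iso.
(* The rank of a new value exceeds by one the largest rank below it; the empty maximum [0] is the
   right rank for a new least value. *)
pose c := \max_(w < size r | nth 0 r w < v) (nth 0 s w).+1.
have below i : i < size r -> nth 0 r i < v -> nth 0 s i < c.
  by move=> hi lt; rewrite /c (bigmax_sup (Ordinal hi)).
have above i : i < size r -> v <= nth 0 r i -> c <= nth 0 s i.
  move=> hi ge; apply/bigmax_leqP => w lt; rewrite -iso ?ltn_ord //.
  by rewrite (leq_trans lt).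
have nv i : i < size r -> nth 0 r i != v.
  by move=> hi; apply: contraNneq vr => <-; apply: mem_nth.
right; exists c.
  by rewrite ltnS; apply/bigmax_leqP => w _; apply: bd; rewrite mem_nth // -sz.
split=> [|i j]; rewrite !size_rcons ?size_map ?sz // -!sz => hi hj.
rewrite !(nth_rcons_lt _ (erefl (size r))) //.
rewrite !(@nth_rcons_lt _ (size r)) ?size_map //.
case: (ltnP i) => h1; case: (ltnP j) => h2.
- by rewrite !(nth_map 0) -?sz // shift_lt iso.
- rewrite (nth_map 0) -?sz // shift_ltl.
  by case: (ltnP (nth 0 r i)) => h; [rewrite below|rewrite ltnNge above].
- rewrite (nth_map 0) -?sz // shift_ltr; move: (nv j h2).
  case: (ltngtP v (nth 0 r j)) => // h _; first by rewrite above // ltnW.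
  by rewrite leqNgt below.
- by rewrite !ltnn.
Qed.

Lemma refute_sound hs n m r s t : refute hs n m s -> order_iso r s ->
  {in s, forall i, i < m} -> size t = n -> ~~ all (ceval (r ++ t)) hs.
Proof.
elim: n m r s t => // n IH m r s [//|v t] /= /andP[r1 r2] iso bd [szt].
apply/negP => sat.
have ok u : order_iso (rcons r v) u ->
    all (fun h => if cvars h == size u then ceval u h else true) hs.
  move=> isou; apply: sub_all sat => h sat; case: eqP => // e.
  have sz : cvars h <= size (rcons r v) by rewrite e isou.1.
  by rewrite -(ceval_iso isou) // -(ceval_cat t) // cat_rcons.
case: (order_iso_rcons v iso bd) => -[c hc iso'].
  move/allP: r1 => /(_ c); rewrite mem_iota add0n bd //= ok // => /(_ isT) ref.
  move: (IH _ (rcons r v) _ t ref iso'); rewrite cat_rcons sat => H.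
  suff: ~~ true by [].
  by apply: H => // i; rewrite mem_rcons in_cons => /predU1P[->|/bd//]; apply: bd.
move/allP: r2 => /(_ c); rewrite mem_rcons in_cons mem_iota add0n -leq_eqVlt -ltnS hc (ok _ iso') => /(_ isT) ref.
move: (IH _ (rcons r v) _ t ref iso'); rewrite cat_rcons sat => H.
suff: ~~ true by [].
apply: H => // i; rewrite mem_rcons in_cons => /predU1P[->//|/mapP[j /bd lt ->]].
by rewrite /shift; case: ifP => _ //; rewrite (leq_trans lt).
Qed.

Lemma all_chyps s f : all (ceval s) (chyps f) = ceval s f.
Proof.
by elim: f => [b|i j k|i j|f _|f IHf g IHg|f _ g _|f _ g _] //=;
  rewrite ?andbT // all_cat IHf IHg.
Qed.

Lemma all_cneg s f : all (ceval s) (cneg f) = ~~ ceval s f.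
Proof.
elim: f => [b|i j k|i j|f _|f _ g _|f _ g _|f _ g IH]; rewrite /= ?andbT //.
by rewrite all_cat all_chyps IH negb_imply.
Qed.

Lemma cyc_decide f t : refute (cneg f) (size t) 0 [::] -> ceval t f.
Proof.
move=> ref; have iso : order_iso [::] [::] by [].
have /= := refute_sound (t := t) ref iso; rewrite all_cneg negbK; exact.
Qed.

Ltac fold_imp := lazymatch goal with
  | |- is_true _ -> _ => let H := fresh in
      (intro H; fold_imp; revert H; apply/implyP)
  | |- False => suff: false by []
  | |- is_true _ => idtac
  | |- @eq _ _ _ => apply/eqP
  | |- _ => idtac end.

Ltac cy_index x l := lazymatch l with
  | x :: _ => constr:(0)
  | _ :: ?l' => let n := cy_index x l' in constr:(S n)
  end.
Ltac cy_add x l := lazymatch l with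
  | context [cons x _] => l
  | _ => let l' := eval cbv [rcons] in (rcons l x) in l' end.
Ltac cy_vars l t := lazymatch t with
  | true => l | false => l
  | cyc ?x ?y ?z => let l := cy_add x l in let l := cy_add y l in cy_add z l
  | ?x == ?y => let l := cy_add x l in cy_add y l
  | ~~ ?f => cy_vars l f
  | ?f && ?g => let l := cy_vars l f in cy_vars l g
  | ?f || ?g => let l := cy_vars l f in cy_vars l g
  | ?f ==> ?g => let l := cy_vars l f in cy_vars l g
  end.
Ltac cy_reify l t := lazymatch t with
  | true => constr:(CBool true) | false => constr:(CBool false)
  | cyc ?x ?y ?z => let i := cy_index x l in let j := cy_index y l in
                    let k := cy_index z l in constr:(CCyc i j k)
  | ?x == ?y => let i := cy_index x l in let j := cy_index y l in constr:(CEq i j)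
  | ~~ ?f => let a := cy_reify l f in constr:(CNot a)
  | ?f && ?g => let a := cy_reify l f in let b := cy_reify l g in constr:(CAnd a b)
  | ?f || ?g => let a := cy_reify l f in let b := cy_reify l g in constr:(COr a b)
  | ?f ==> ?g => let a := cy_reify l f in let b := cy_reify l g in constr:(CImp a b)
  end.

(** Weak order of [j] and [k] seen from [i]. It holds for [j = k] even at [i] itself, so proofs
    supply separately that labels of the other color differ from [i]. *)
Definition cycw (i j k : nat) := (j == k) || cyc i j k.

(* Chord [pq] crosses the line directed from [a] to [b], with [p] on its left. *)
Definition crs (a b p q : nat) := cyc a p b && cyc b q a.

(* Seen from [a], the chord [rs] lies between [pq] and [xy] and differs from both. *)
Definition btw (a p q x y r s : nat) := [&& cycw a p r, cycw a r x, cycw a y s, cycw a s q,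
  (r != p) || (s != q) & (r != x) || (s != y)].

(** Hypotheses count only once they are back in the goal, so a call is usually preceded by a [move:]
    listing the facts that decide the case. *)
Ltac cyco := fold_imp; rewrite ?/btw ?/crs ?/cycw -?val_eqE /=;
  lazymatch goal with |- is_true ?t =>
    let l := cy_vars (@nil nat) t in let f := cy_reify l t in
    change (is_true (ceval l f)); apply: cyc_decide; vm_compute; reflexivity end.

(** * Chords of a dissection *)

Section Chords.
Variable N : nat.
Implicit Types (a b c d i j l p q r s x y z : 'I_N) (C : pred 'I_N) (H : rel 'I_N).

(* The clockwise distance from [a] to [i]. *)
Definition pos a i := if a <= i then i - a else N + i - a.

Lemma pos_cyc a i j : cyc a i j -> pos a i < pos a j.
Proof.
rewrite /pos /cyc; move: (ltn_ord a) (ltn_ord i) (ltn_ord j).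
by case: (leqP a i) => ?; case: (leqP a j) => ?; lia.
Qed.

Lemma pos_cycw a i j : cycw a i j -> pos a i <= pos a j.
Proof. by rewrite /cycw val_eqE => /predU1P[->//|/pos_cyc/ltnW]. Qed.

Lemma pos_max a i : pos a i < N.
Proof. by rewrite /pos; move: (ltn_ord a) (ltn_ord i); case: (leqP a i) => ?; lia. Qed.

(* The chords of a dissection of the polygon with vertices [C], sides included;
   the side cutting off a label [a] outside [C] is the chord [lr] of [diss_ear]. *)
Record diss C H : Prop := Diss {
  diss_sym : forall p q, H p q -> H q p;
  diss_col : forall p q, H p q -> [&& C p, C q & p != q];
  diss_nc : forall p q x y, H p q -> H x y -> ~~ (cyc p x q && cyc q y p);
  diss_ear : forall a, ~~ C a ->
    exists l r, H l r /\ forall i, i != a -> cycw a l i && cycw a i r }.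

(* Seen from [a], the chord [pq] with [p] before [q] is preceded by a chord
   sharing its endpoint [p] (resp. [q]). *)
Definition incl H a p q := [exists z : 'I_N, cyc q z a && H p z].
Definition incr H a p q := [exists z : 'I_N, cyc a z p && H q z].

(* No gap in the sequence of chords crossed by [ab] (resp. by [ab] from [a] up
   to the chord [ij]): as the sequence is a chain, this says that any two
   consecutive chords share an endpoint. *)
Definition acc H a b := forall p q x y, H p q -> H x y ->
  crs a b p q -> crs a b x y -> cyc a p x -> cyc a y q ->
  exists r s, H r s /\ btw a p q x y r s.

Definition half H a i j := forall p q x y, H p q -> H x y ->
  cyc a p x -> cycw a x i -> cycw a j y -> cyc a y q ->
  exists r s, H r s /\ btw a p q x y r s.

Lemma acc_half H a b i j : acc H a b -> crs a b i j -> half H a i j.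
Proof.
move=> A cr p q x y Hpq Hxy h1 h2 h3 h4; apply: A => //.
  by move: cr h1 h2 h3 h4; cyco.
by move: cr h1 h2 h3 h4; cyco.
Qed.

Lemma acc_sym C H a b : diss C H -> acc H a b -> acc H b a.
Proof.
move=> dH A p q x y Hpq Hxy c1 c2 h1 h2.
have [||||r [s [Hrs b1]]] := A y x q p (diss_sym dH Hxy) (diss_sym dH Hpq).
- by move: c2; cyco.
- by move: c1; cyco.
- by move: c1 c2 h1 h2; cyco.
- by move: c1 c2 h1 h2; cyco.
exists s, r; split; first exact: diss_sym dH _ _ Hrs.
by move: c1 c2 h1 h2 b1; rewrite /btw; cyco.
Qed.

(** Non-crossing chords that all cross [ab] are nested when seen from [a]; this total order is what
    gives a meaning to consecutive chords. *)
Lemma chain C H a b p q x y : diss C H -> H p q -> H x y -> crs a b p q ->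
  crs a b x y -> (cycw a p x && cycw a y q) || (cycw a x p && cycw a q y).
Proof.
move=> dH h1 h2 c1 c2.
have := diss_nc dH h1 h2; have := diss_nc dH h1 (diss_sym dH h2).
by move: c1 c2; cyco.
Qed.

(** A gap cannot straddle [ij], which would itself lie in it. It is therefore on one side of [ij],
    where one of the two halves excludes it. *)
Lemma acc_halves C H a b i j : diss C H -> H i j -> crs a b i j ->
  half H a i j -> half H b j i -> acc H a b.
Proof.
move=> dH Hij cr ha hb p q x y Hpq Hxy c1 c2 h1 h2.
have o1 := chain dH Hpq Hij c1 cr; have o2 := chain dH Hxy Hij c2 cr.
case: (boolP (cycw a x i && cycw a j y)) => [/andP[e1 e2]|n1]; first exact: ha.
case: (boolP (cycw a i p && cycw a q j)) => [e1|n2].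
  have [||||r [s [Hrs b1]]] := hb y x q p (diss_sym dH Hxy) (diss_sym dH Hpq).
  - by move: c1 c2 cr e1 h1 h2; cyco.
  - by move: c1 c2 cr e1 h1 h2; cyco.
  - by move: c1 c2 cr e1 h1 h2; cyco.
  - by move: c1 c2 cr e1 h1 h2; cyco.
  exists s, r; split; first exact: diss_sym dH _ _ Hrs.
  by move: c1 c2 h1 h2 b1; rewrite /btw; cyco.
exists i, j; split=> //.
move: n1 n2 o1 o2 h1 h2; rewrite /btw.
by cyco.
Qed.

(** Among the chords that separate [a] from [pq], the one nearest to [pq] shares an endpoint with
    it: otherwise [half] would provide a chord strictly between the two. Nearest means a late first
    and an early second endpoint, whence the measure that is maximized. *)
Lemma half_inc C H a p q i j : diss C H -> ~~ C a -> H p q -> cyc a p q ->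
  half H a p q -> H i j -> cycw a i p -> cycw a q j -> (i != p) || (j != q) ->
  incl H a p q || incr H a p q.
Proof.
move=> dH nCa Hpq apq hf Hij ip qj nij.
pose P (u : 'I_N * 'I_N) := [&& H u.1 u.2, cycw a u.1 p, cycw a q u.2 &
  (u.1 != p) || (u.2 != q)].
have P0 : P (i, j) by apply/and4P.
case: (@arg_maxnP _ (i, j) P (fun u => pos a u.1 + (N - pos a u.2)) P0).
move=> [x y] /and4P /= [Hxy xp qy nxy] mx.
have na z : C z -> z != a by apply: contraTN => /eqP ->.
have [/and3P[Cp Cq _] /and3P[Cx Cy _]] := (diss_col dH Hpq, diss_col dH Hxy).
case: (eqVneq x p) => [exp|nxp].
  apply/orP; left; apply/existsP; exists y; rewrite -exp Hxy andbT.
  by move: (na _ Cx) (na _ Cy) nxy apq qy xp; rewrite exp; cyco.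
case: (eqVneq y q) => [eyq|nyq].
  apply/orP; right; apply/existsP; exists x; rewrite -eyq (diss_sym dH Hxy) andbT.
  by move: (na _ Cx) (na _ Cy) nxp xp; cyco.
have [||||r [s [Hrs b1]]] := hf x y p q Hxy Hpq.
- by move: (na _ Cx) nxp xp; cyco.
- by rewrite /cycw eqxx.
- by rewrite /cycw eqxx.
- by move: (na _ Cq) nyq qy; cyco.
have /and3P[Cr Cs _] := diss_col dH Hrs.
have /mx /= : P (r, s).
  by rewrite /P /= Hrs /=; move: b1; rewrite /btw; cyco.
have /and3P[xr sy o] : [&& cycw a x r, cycw a s y & cyc a x r || cyc a s y].
  by move: b1 (na _ Cr) (na _ Cx) (na _ Cy) (na _ Cs); cyco.
move: (pos_cycw xr) (pos_cycw sy) (pos_max a s) (pos_max a y).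
by case/orP: o => /pos_cyc; clear; lia.
Qed.

(** The two witnesses would be chords [pz] and [qx] crossing each other between [pq] and [a]. *)
Lemma inc_excl C H a p q : diss C H -> cyc a p q -> ~~ (incl H a p q && incr H a p q).
Proof.
move=> dH apq; apply/andP => -[/existsP[z /andP[h1 h2]] /existsP[x /andP[h3 h4]]].
by move: (diss_nc dH (diss_sym dH h4) h2) h1 h3 apq; cyco.
Qed.

(** Here [pq] lies between [a] and [ij]. A witness [qz] beyond [pq] cannot cross [ij], so it does
    not see whether the diagonal goes on to [b] or to [d]; if [q = j], the chord [ji] is itself a
    witness. *)
Lemma incl_far_imp C H a b d p q i j : diss C H -> ~~ C a ->
  H p q -> H i j -> cycw a p i -> cycw a j q -> (p != i) || (q != j) ->
  crs a b i j -> crs a d i j -> incl H b q p -> incl H d q p.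
Proof.
move=> dH nCa Hpq Hij pi jq n c1 c2 /existsP[z /andP[pzb Hqz]].
apply/existsP.
have na x : C x -> x != a by apply: contraTN => /eqP ->.
have [/and3P[Cp Cq _] /and3P[Cx Cy _]] := (diss_col dH Hpq, diss_col dH Hij).
have /and3P[_ Cz _] := diss_col dH Hqz.
case: (eqVneq q j) => [e|nqj].
  exists i; rewrite e (diss_sym dH Hij) andbT.
  by move: (na _ Cp) n c2 pi c1; rewrite e; cyco.
exists z; rewrite Hqz andbT.
move: (diss_nc dH Hij (diss_sym dH Hqz)) (na _ Cp) (na _ Cz) c1 c2 pi jq nqj pzb.
by cyco.
Qed.

Lemma incr_far_imp C H a b d p q i j : diss C H -> ~~ C a ->
  H p q -> H i j -> cycw a p i -> cycw a j q -> (p != i) || (q != j) ->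
  crs a b i j -> crs a d i j -> incr H b q p -> incr H d q p.
Proof.
move=> dH nCa Hpq Hij pi jq n c1 c2 /existsP[z /andP[pzb Hqz]].
apply/existsP.
have na x : C x -> x != a by apply: contraTN => /eqP ->.
have [/and3P[Cp Cq _] /and3P[Cx Cy _]] := (diss_col dH Hpq, diss_col dH Hij).
have /and3P[_ Cz _] := diss_col dH Hqz.
case: (eqVneq p i) => [e|nqj].
  exists j; rewrite e Hij andbT.
  by move: (na _ Cp) (na _ Cq) (na _ Cy) n c2 jq c1; rewrite e; cyco.
exists z; rewrite Hqz andbT.
move: (diss_nc dH Hij (diss_sym dH Hqz)) (na _ Cp) (na _ Cz) c1 c2 pi jq nqj pzb.
by cyco.
Qed.
End Chords.

Import GRing.Theory.
Local Open Scope ring_scope.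

(** * Crossings and signs *)

Section Sets.
Variable N : nat.
Implicit Types (a b c d i j l p q r s u v x y z : 'I_N) (C : pred 'I_N) (H : rel 'I_N).
Implicit Types (e f : {set 'I_N}).

Lemma set2_eq p q x y :
  ([set p; q] == [set x; y]) = (p == x) && (q == y) || (p == y) && (q == x).
Proof.
apply/idP/idP => [/eqP E|/orP[]/andP[/eqP-> /eqP->]//]; last by rewrite finset.setUC.
have := set21 x y; have := set22 x y; rewrite -E.
by have := set21 p q; have := set22 p q; rewrite {1 2}E !inE; cyco.
Qed.

Lemma set2_eqP p q x y :
  reflect (p = x /\ q = y \/ p = y /\ q = x) ([set p; q] == [set x; y]).
Proof.
rewrite set2_eq; apply: (iffP idP) => [|[[-> ->]|[-> ->]]]; rewrite ?eqxx ?orbT //.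
by case/orP => /andP[/eqP-> /eqP->]; [left|right].
Qed.

Definition xc e f := [exists p : 'I_N, exists q : 'I_N, exists a : 'I_N, exists b : 'I_N,
  [&& e == [set p; q], f == [set a; b] & crs a b p q]].

Lemma xcE p q a b : xc [set p; q] [set a; b] = crs a b p q || crs a b q p.
Proof.
apply/idP/idP.
  case/existsP=> p' /existsP[q' /existsP[a' /existsP[b' /and3P[]]]].
  by move=> /set2_eqP[[-> ->]|[-> ->]] /set2_eqP[[-> ->]|[-> ->]]; cyco.
by case/orP => cr; apply/existsP; [exists p|exists q]; apply/existsP;
  [exists q|exists p]; apply/existsP; exists a; apply/existsP; exists b;
  rewrite cr ?[[set q; p]]finset.setUC !eqxx.
Qed.

(* [zig H e f] (resp. [zag H e f]): the chord [f] crosses [e] as a Z (resp. as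
   an S) with respect to the chords [H]. *)
Definition zig H e f := [exists p : 'I_N, exists q : 'I_N, exists a : 'I_N, exists b : 'I_N,
  [&& e == [set p; q], f == [set a; b], crs a b p q, incl H a p q & incl H b q p]].
Definition zag H e f := [exists p : 'I_N, exists q : 'I_N, exists a : 'I_N, exists b : 'I_N,
  [&& e == [set p; q], f == [set a; b], crs a b p q, incr H a p q & incr H b q p]].

Lemma zigE H p q a b : crs a b p q ->
  zig H [set p; q] [set a; b] = incl H a p q && incl H b q p.
Proof.
move=> cr; apply/idP/idP.
  case/existsP=> p' /existsP[q' /existsP[a' /existsP[b' /and5P[]]]].
  move=> /set2_eqP[[<- <-]|[<- <-]] /set2_eqP[[<- <-]|[<- <-]] cr' h1 h2;
    rewrite ?h1 ?h2 //; exfalso; by move: cr cr'; cyco.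
move=> h; apply/existsP; exists p; apply/existsP; exists q; apply/existsP; exists a.
by apply/existsP; exists b; rewrite cr !eqxx.
Qed.

Lemma zagE H p q a b : crs a b p q ->
  zag H [set p; q] [set a; b] = incr H a p q && incr H b q p.
Proof.
move=> cr; apply/idP/idP.
  case/existsP=> p' /existsP[q' /existsP[a' /existsP[b' /and5P[]]]].
  move=> /set2_eqP[[<- <-]|[<- <-]] /set2_eqP[[<- <-]|[<- <-]] cr' h1 h2;
    rewrite ?h1 ?h2 //; exfalso; by move: cr cr'; cyco.
move=> h; apply/existsP; exists p; apply/existsP; exists q; apply/existsP; exists a.
by apply/existsP; exists b; rewrite cr !eqxx.
Qed.

Lemma zig_xc H e f : zig H e f -> xc e f.
Proof.
case/existsP=> p' /existsP[q' /existsP[a' /existsP[b' /and5P[/eqP-> /eqP-> cr _ _]]]].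
by rewrite xcE cr.
Qed.

Lemma zag_xc H e f : zag H e f -> xc e f.
Proof.
case/existsP=> p' /existsP[q' /existsP[a' /existsP[b' /and5P[/eqP-> /eqP-> cr _ _]]]].
by rewrite xcE cr.
Qed.

(** The conditions on [p] and [q] place [pq] on the side of [a]. Its neighbors among the crossed
    chords are then found no farther than [ij], where the diagonals to [b] and to [d] still
    agree. *)
Lemma far_sign C H a b d i j p q : diss C H -> ~~ C a ->
  H p q -> H i j -> [set p; q] != [set i; j] ->
  crs a b i j -> crs a d i j -> ~~ cyc i p j -> ~~ cyc i q j ->
  zig H [set p; q] [set a; b] = zig H [set p; q] [set a; d] /\
  zag H [set p; q] [set a; b] = zag H [set p; q] [set a; d].
Proof.
move=> dH nCa Hpq Hij nE cb cd np nq.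
have na x : C x -> x != a by apply: contraTN => /eqP ->.
have [/and3P[Cp Cq npq] /and3P[Cx Cy _]] := (diss_col dH Hpq, diss_col dH Hij).
wlog cab : p q Hpq nE np nq Cp Cq npq / crs a b p q => [th|].
  case: (boolP (crs a b p q)) => [|n1]; first exact: th.
  case: (boolP (crs a b q p)) => [h|n2].
    rewrite (finset.setUC [set p]); apply: th => //;
      by [apply: (diss_sym dH)|rewrite finset.setUC|rewrite eq_sym].
  have n3 : ~~ xc [set p; q] [set a; b] by rewrite xcE negb_or n1.
  have n4 : ~~ xc [set p; q] [set a; d].
    rewrite xcE; move: (na _ Cp) (na _ Cq) n1 n2 np nq cb cd; cyco.
  split; [apply/idP/idP => /zig_xc|apply/idP/idP => /zag_xc];
    by rewrite ?(negPf n3) ?(negPf n4).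
have n : (p != i) || (q != j).
  by move: nE; rewrite set2_eq; cyco.
have nn : (p != j) || (q != i).
  by move: nE; rewrite set2_eq; cyco.
have pi : cycw a p i by move: (na _ Cp) (na _ Cq) cab np nq cb cd npq n nn; cyco.
have jq : cycw a j q by move: (na _ Cp) (na _ Cq) cab np nq cb cd npq n nn; cyco.
have cad : crs a d p q by move: (na _ Cp) (na _ Cq) cab pi jq cb cd npq n nn; cyco.
rewrite !zigE // !zagE //; split; congr andb; apply/idP/idP.
- exact: incl_far_imp dH nCa Hpq Hij pi jq n cb cd.
- exact: incl_far_imp dH nCa Hpq Hij pi jq n cd cb.
- exact: incr_far_imp dH nCa Hpq Hij pi jq n cb cd.
- exact: incr_far_imp dH nCa Hpq Hij pi jq n cd cb.
Qed.

(* [pq] is the side cutting off the label [a]. *)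
Definition ear a p q := [forall i : 'I_N, (i != a) ==> cycw a p i && cycw a i q].

Lemma earP a p q i : ear a p q -> i != a -> cycw a p i && cycw a i q.
Proof. by move=> /forallP /(_ i) /implyP. Qed.

(** The side cutting off [a] is the first chord met from [a]; if [pq] is another chord, that side
    lies before it and [half_inc] applies. *)
Lemma not_ear_inc C H a p q : diss C H -> ~~ C a -> H p q -> cyc a p q ->
  half H a p q -> ~~ ear a p q -> incl H a p q || incr H a p q.
Proof.
move=> dH nCa Hpq apq hf ne; have [l [r [Hlr lr]]] := diss_ear dH nCa.
have [/andP[lp lq] /andP[pr qr]] : cycw a l p && cycw a l q /\ cycw a p r && cycw a q r.
  have /lr/andP[] : p != a by move: apq; cyco.
  have /lr/andP[] : q != a by move: apq; cyco.
  by move=> -> -> -> ->.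
apply: (half_inc dH nCa Hpq apq hf Hlr lp qr).
apply: contraR ne; rewrite negb_or !negbK => /andP[/eqP <- /eqP <-].
by apply/forallP => i; apply/implyP; apply: lr.
Qed.

Lemma inc_xor C H a b p q : diss C H -> ~~ C a -> H p q -> acc H a b -> crs a b p q ->
  ~~ ear a p q -> incr H a p q = ~~ incl H a p q.
Proof.
move=> dH nCa Hpq A cr ne; have apq : cyc a p q by move: cr; cyco.
have := not_ear_inc dH nCa Hpq apq (acc_half A cr) ne; have := inc_excl dH apq.
by case: incl; case: incr.
Qed.

Lemma ear_incl H a p q : ear a p q -> incl H a p q = false.
Proof.
move=> E; apply/negbTE/negP => /existsP[z /andP[h _]].
have /(earP E) : z != a by move: h; cyco.
by move: h; cyco.
Qed.

Lemma ear_incr H a p q : ear a p q -> incr H a p q = false.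
Proof.
move=> E; apply/negbTE/negP => /existsP[z /andP[h _]].
have /(earP E) : z != a by move: h; cyco.
by move: h; cyco.
Qed.

Section Sign.
Variable R : comNzRingType.

Definition sgn H e f : R := (zig H e f)%:R - (zag H e f)%:R.

Lemma sgnE H a b p q : crs a b p q -> sgn H [set p; q] [set a; b] =
  (incl H a p q && incl H b q p)%:R - (incr H a p q && incr H b q p)%:R.
Proof. by move=> cr; rewrite /sgn zigE // zagE. Qed.

Lemma sgn_xc H e f : ~~ xc e f -> sgn H e f = 0.
Proof.
move=> n; rewrite /sgn; have [|_] := boolP (zig H e f).
  by move/zig_xc; rewrite (negPf n).
by have [|_] := boolP (zag H e f); [move/zag_xc; rewrite (negPf n)|rewrite subrr].
Qed.

(** On each side exactly one of [incl] and [incr] holds. With truth values [x] and [y] of [incl] at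
    [a] and [b], the sign is [x y - (1 - x) (1 - y) = x - (1 - y)]: the two ends separate. *)
Lemma sgn_acc C H a b p q : diss C H -> ~~ C a -> ~~ C b -> H p q -> acc H a b ->
  crs a b p q -> ~~ ear a p q -> ~~ ear b q p ->
  sgn H [set p; q] [set a; b] = (incl H a p q)%:R - (incr H b q p)%:R.
Proof.
move=> dH nCa nCb Hpq A cr na nb; rewrite sgnE //.
have cr' : crs b a q p by move: cr; cyco.
rewrite (inc_xor dH nCa Hpq A cr na).
rewrite (inc_xor dH nCb (diss_sym dH Hpq) (acc_sym dH A) cr' nb).
by case: incl; case: incl; rewrite /= ?subrr ?subr0 ?sub0r.
Qed.

Lemma far_sgn C H a b d i j p q : diss C H -> ~~ C a ->
  H p q -> H i j -> [set p; q] != [set i; j] ->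
  crs a b i j -> crs a d i j -> ~~ cyc i p j -> ~~ cyc i q j ->
  sgn H [set p; q] [set a; b] = sgn H [set p; q] [set a; d].
Proof.
move=> dH nCa Hpq Hij nE cb cd np nq.
by rewrite /sgn; have [-> ->] := far_sign dH nCa Hpq Hij nE cb cd np nq.
Qed.

End Sign.

End Sets.

(** * Resolution of crossings *)

Section Resolution.
Variable N : nat.
Implicit Types (a b c d i j l p q r s u v x y z : 'I_N) (C : pred 'I_N) (H : rel 'I_N).

(** Up to [ij] the chord [ad] meets the same chords as [ab], and beyond [ij] the same as [cd]. *)
Lemma acc_cross C H a b c d i j : diss C H -> H i j ->
  crs a b i j -> crs c d i j -> acc H a b -> acc H c d -> acc H a d.
Proof.
move=> dH Hij cab ccd A B.
have cad : crs a d i j by move: cab ccd; cyco.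
apply: (acc_halves dH Hij cad); first exact: acc_half A cab.
by apply: (acc_half (acc_sym dH B)); move: ccd; cyco.
Qed.

(** A chord satisfying [near_a] separates [a] from the other three ends, one satisfying [near_b]
    separates [b]. Two such chords share no endpoint, so the accordion property puts another
    strictly between them: either it is of one of the two kinds and the interval shrinks, or it
    crosses [cd] as well. The sides cutting off [a] and [b] start the descent. *)
Lemma common_chord C H a b c d : diss C H -> ~~ C a -> ~~ C b -> ~~ C c -> ~~ C d ->
  acc H a b -> crs a b c d ->
  exists i j, [/\ H i j, crs a b i j & crs c d i j \/ crs d c i j].
Proof.
move=> dH nCa nCb nCc nCd A cr.
have nE C' (t x : 'I_N) : ~~ C' t -> C' x -> x != t by move=> ?; apply: contraTN => /eqP ->.
have [l [r [Hlr lr]]] := diss_ear dH nCa; have [l' [r' [Hlr' lr']]] := diss_ear dH nCb.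
have ne x : C x -> [&& x != a, x != b, x != c & x != d].
  by move=> Cx; rewrite !(nE C).
pose near_a p q := [&& H p q, cyc a p c & cyc d q a].
pose near_b x y := [&& H x y, cyc c x b & cyc b y d].
have : near_b r' l'.
  rewrite /near_b (diss_sym dH Hlr') /=.
  have /and3P[/ne n1 /ne n2 _] := diss_col dH Hlr'.
  have /lr' : c != b by move: cr; cyco.
  have /lr' : d != b by move: cr; cyco.
  by move: n1 n2 cr; cyco.
have : near_a l r.
  rewrite /near_a Hlr /=.
  have /and3P[/ne n1 /ne n2 _] := diss_col dH Hlr.
  have /lr : c != a by move: cr; cyco.
  have /lr : d != a by move: cr; cyco.
  by move: n1 n2 cr; cyco.
clear Hlr lr Hlr' lr'; move: l r r' l' => p q x y.
have [m] := ubnP ((pos a x - pos a p) + (pos a q - pos a y))%N.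
elim: m p q x y => // m IH p q x y; rewrite ltnS => lem na nb.
have [/and3P[Hpq p1 q1] /and3P[Hxy x1 y1]] := (na, nb).
have [||||r [s [Hrs btw]]] := A p q x y Hpq Hxy; try by move: cr p1 q1 x1 y1; cyco.
have /and3P[/ne n1 /ne n2 _] := diss_col dH Hrs.
have lt1 := pos_cyc (i := p) (j := x) (a := a).
have lt2 := pos_cyc (i := y) (j := q) (a := a).
have [pr rx ys sq] : [/\ pos a p <= pos a r, pos a r <= pos a x,
    pos a y <= pos a s & pos a s <= pos a q]%N.
  by case/and5P: btw => h1 h2 h3 h4 _; split; apply: pos_cycw.
have ltp : (pos a p < pos a x)%N by apply: pos_cyc; move: cr p1 x1; cyco.
have ltq : (pos a y < pos a q)%N by apply: pos_cyc; move: cr q1 y1; cyco.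
case: (boolP (near_a r s)) => [nars|nn1].
  apply: (IH r s x y) => //; apply: leq_trans lem.
  have : cyc a p r || cyc a s q by move: btw nars n1 n2 p1 q1; rewrite /near_a Hrs; cyco.
  by case/orP => /pos_cyc; move: pr rx ys sq ltp ltq; clear; lia.
case: (boolP (near_b r s)) => [nbrs|nn2].
  apply: (IH p q r s) => //; apply: leq_trans lem.
  have : cyc a r x || cyc a y s by move: btw nbrs n1 n2 x1 y1 cr; rewrite /near_b Hrs; cyco.
  by case/orP => /pos_cyc; move: pr rx ys sq ltp ltq; clear; lia.
exists r, s; split => //; first by move: cr p1 q1 x1 y1 btw n1 n2; cyco.
have : crs c d r s || crs d c r s.
  by move: cr p1 q1 x1 y1 btw n1 n2 nn1 nn2; rewrite /near_a /near_b Hrs; cyco.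
by move/orP.
Qed.

Section Sgn.
Variable R : comNzRingType.
Local Notation sgn := (@sgn N R).

Lemma sgn_resolve C H a b c d i j p q : diss C H -> ~~ C a -> ~~ C b -> ~~ C c -> ~~ C d ->
  H i j -> crs a b i j -> crs c d i j -> acc H a b -> acc H c d ->
  (forall t, ~~ ear t i j) -> (forall t, ~~ ear t j i) -> H p q ->
  sgn H [set p; q] [set a; b] + sgn H [set p; q] [set c; d] =
  sgn H [set p; q] [set a; d] + sgn H [set p; q] [set c; b].
Proof.
move=> dH nCa nCb nCc nCd Hij cab ccd A B e1 e2 Hpq.
have cad : crs a d i j by move: cab ccd; cyco.
have ccb : crs c b i j by move: cab ccd; cyco.
have nc1 := diss_nc dH Hij Hpq; have nc2 := diss_nc dH Hij (diss_sym dH Hpq).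
have [E|nE] := eqVneq [set p; q] [set i; j].
  have Aad := acc_cross dH Hij cab ccd A B; have Acb := acc_cross dH Hij ccd cab B A.
  rewrite E !(@sgn_acc _ _ C) //; ring.
(* A chord on the side of [a] and [c] sees only these ends, so the signs agree term by term; on the
   other side [b] and [d] decide, and the summands are swapped first. *)
case: (boolP (~~ cyc i p j && ~~ cyc i q j)) => [/andP[n1 n2]|n].
  apply: (f_equal2 +%R).
    exact: (@far_sgn N R C H a b d i j p q).
  exact: (@far_sgn N R C H c d b i j p q).
have n1 : ~~ cyc j p i by move: n nc1 nc2; cyco.
have n2 : ~~ cyc j q i by move: n nc1 nc2; cyco.
have [cba cbc cda cdc] : [/\ crs b a j i, crs b c j i, crs d a j i & crs d c j i].
  by split; move: cab ccd; cyco.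
have Hji := diss_sym dH Hij; rewrite (finset.setUC [set i]) in nE.
rewrite [RHS]addrC ![[set a; _]]finset.setUC ![[set c; _]]finset.setUC; apply: (f_equal2 +%R).
  exact: (@far_sgn N R C H b a c j i p q).
exact: (@far_sgn N R C H d c a j i p q).
Qed.

End Sgn.

Lemma xc_resolve a b c d i j s t : crs a b c d || crs a b d c ->
  crs a b i j -> crs c d i j ->
  (xc [set s; t] [set a; d] + xc [set s; t] [set c; b] <=
   xc [set s; t] [set a; b] + xc [set s; t] [set c; d])%N.
Proof.
move=> cr c1 c2; rewrite !xcE.
set u1 := (_ || _); set u2 := (_ || _); set v1 := (_ || _); set v2 := (_ || _).
have : (u1 || u2 ==> v1 || v2) && (u1 && u2 ==> v1 && v2).
  by rewrite /u1 /u2 /v1 /v2; move: cr c1 c2; cyco.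
by case: u1; case: u2; case: v1; case: v2.
Qed.

End Resolution.

(** * Signs of the shifts of a chord *)

Section Span.
Variable N : nat.
Implicit Types (a b c d i j l p q r s u v x y z : 'I_N) (C : pred 'I_N) (H : rel 'I_N).
Variable R : comNzRingType.
Local Notation sgn := (@sgn N R).

(** Two crossed chords without common endpoint cannot both end at [i], nor both at [j]; so one ends
    at [i], the other at [j], and [ij] lies between them. *)
Lemma hub_acc H a b i j : H i j ->
  (forall p q, H p q -> crs a b p q -> (p == i) || (q == j)) -> acc H a b.
Proof.
move=> Hij hub p q x y Hpq Hxy c1 c2 h1 h2; exists i, j; split => //.
by move: (hub _ _ Hpq c1) (hub _ _ Hxy c2) (c1) (c2) h1 h2; cyco.
Qed.

(** Only the label [t] lies between [a] and [b], so all crossed chords issue from [t]. Neighbors of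
    such a chord share [t], and neither a Z nor an S can occur. *)
Lemma sgn_fan C H t a b p q : diss C H -> H p q -> ear t b a ->
  sgn H [set p; q] [set a; b] = 0.
Proof.
move=> dH Hpq E.
wlog cab : p q Hpq / crs a b p q => [th|].
  case: (boolP (crs a b p q)) => [|n1]; first exact: th.
  case: (boolP (crs a b q p)) => [h|n2].
    by rewrite (finset.setUC [set p]); apply: th => //; apply: (diss_sym dH).
  by rewrite sgn_xc // xcE negb_or n1.
have pt : p = t.
  by apply/eqP/negPn/negP => npt; move: (earP E npt) cab; cyco.
rewrite pt in cab *; rewrite sgnE //.
have -> : incl H b q t = false.
  apply/negbTE/negP => /existsP[z /andP[h _]]; have /(earP E) : z != t by move: h; cyco.
  by move: h cab; cyco.
have -> : incr H a t q = false.
  apply/negbTE/negP => /existsP[z /andP[h _]]; have /(earP E) : z != t by move: h; cyco.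
  by move: h cab; cyco.
by rewrite andbF subrr.
Qed.

(** The labels [a] and [b] are those just after [u] and [v], so [ab] is [uv] rotated by one step.
    Each other chord it crosses ends at [u] or at [v]: two fans hinged on [uv], where the only S
    occurs. *)
Lemma sgn_before C H u v a b p q : diss C H -> ~~ C a -> ~~ C b -> H u v ->
  (forall i, i != a -> cycw a i u) -> (forall i, i != b -> cycw b i v) ->
  ~~ ear a v u -> ~~ ear b u v -> H p q ->
  [/\ crs a b v u, acc H a b &
      sgn H [set p; q] [set a; b] = - ([set p; q] == [set u; v])%:R].
Proof.
move=> dH nCa nCb Huv hu hv ea eb Hpq.
have ne t x : ~~ C t -> C x -> x != t by move=> ?; apply: contraTN => /eqP ->.
have /and3P[Cu Cv uv] := diss_col dH Huv.
have hau x : C x -> (x != a) && cycw a x u by move=> Cx; rewrite hu (ne a).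
have hbv x : C x -> (x != b) && cycw b x v by move=> Cx; rewrite hv (ne b).
have nab : a != b.
  by apply: contra_neqN uv => /eqP e; move: (hau _ Cv) (hbv _ Cu); rewrite e; cyco.
have hab : cyc a v b && cyc b u a.
  have nba : b != a by rewrite eq_sym.
  by move: (hau _ Cv) (hbv _ Cu) (hu b nba) (hv a nab) uv (nab); cyco.
have cr : crs a b v u by move: hab; cyco.
have A : acc H a b.
  apply: (hub_acc (diss_sym dH Huv)) => i j Hij c1.
  have /and3P[Ci Cj _] := diss_col dH Hij.
  move: cr uv c1 (hau _ Ci) (hau _ Cj) (hbv _ Ci) (hbv _ Cj).
  by move: (diss_nc dH Huv Hij) (diss_nc dH Huv (diss_sym dH Hij)); cyco.
split=> //.
have [E|nE] := eqVneq [set p; q] [set u; v].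
  have [l [r [Hlr lr]]] := diss_ear dH nCa; have [l' [r' [Hlr' lr']]] := diss_ear dH nCb.
  have /and3P[Cl Cr _] := diss_col dH Hlr; have /and3P[Cl' Cr' _] := diss_col dH Hlr'.
  have er : r = u.
    by have /lr := ne a u nCa Cu; move: (hau _ Cr); cyco.
  have er' : r' = v.
    by have /lr' := ne b v nCb Cv; move: (hbv _ Cr'); cyco.
  have nl : l != v.
    apply: contraNneq ea => e; apply/forallP => i; apply/implyP => /lr.
    by rewrite e er.
  have nl' : l' != u.
    apply: contraNneq eb => e; apply/forallP => i; apply/implyP => /lr'.
    by rewrite e er'.
  rewrite E (finset.setUC [set u]) sgnE //.
  have -> : incl H a v u = false.
    apply/negbTE/existsP => -[z /andP[h _]].
    have : z != a by move: h; cyco.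
    by move=> /hu; move: h cr; cyco.
  have -> : incr H a v u.
    apply/existsP; exists l; rewrite -er (diss_sym dH Hlr) andbT.
    have /lr/andP[h _] := ne a v nCa Cv.
    by move: h nl (ne a v nCa Cv) (ne a l nCa Cl); cyco.
  have -> : incr H b u v.
    apply/existsP; exists l'; rewrite -er' (diss_sym dH Hlr') andbT.
    have /lr'/andP[h _] := ne b u nCb Cu.
    by move: h nl' (ne b u nCb Cu) (ne b l' nCb Cl'); cyco.
  by rewrite sub0r.
rewrite oppr0.
wlog cpq : p q Hpq nE / crs a b p q => [th|].
  case: (boolP (crs a b p q)) => [|n1]; first exact: th.
  case: (boolP (crs a b q p)) => [h|n2].
    by rewrite (finset.setUC [set p]); apply: th; rewrite // ?(finset.setUC [set q]) //; apply: diss_sym dH _ _ Hpq.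
  by rewrite sgn_xc // xcE negb_or n1.
have /and3P[Cp Cq npq] := diss_col dH Hpq.
have [/(diss_nc dH Huv) n1 /(diss_nc dH Huv) n2] := (Hpq, diss_sym dH Hpq).
have h : (q == u) && (p != v) || (p == v) && (q != u).
  move: nE; rewrite set2_eq.
  by move: cr cpq (hau _ Cp) (hau _ Cq) (hbv _ Cp) (hbv _ Cq) n1 n2; cyco.
rewrite sgnE //.
have Hvu := diss_sym dH Huv.
have -> : incl H a p q && incl H b q p = false.
  apply/negbTE/negP => /andP[/existsP[z /andP[h1 Hpz]] /existsP[t /andP[h2 Hqt]]].
  have /and3P[_ Cz _] := diss_col dH Hpz; have /and3P[_ Ct _] := diss_col dH Hqt.
  move: (hau _ Cz) (hbv _ Cz) (hau _ Ct) (hbv _ Ct) (hau _ Cp) (hbv _ Cp) (hau _ Cq) (hbv _ Cq) h1 h2 cr cpq.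
  by case/orP: h => /andP[/eqP -> _]; cyco.
have -> : incr H a p q && incr H b q p = false.
  apply/negbTE/negP => /andP[/existsP[z /andP[h1 Hqz]] /existsP[t /andP[h2 Hpt]]].
  have /and3P[_ Cz _] := diss_col dH Hqz; have /and3P[_ Ct _] := diss_col dH Hpt.
  move: (hau _ Cz) (hbv _ Cz) (hau _ Ct) (hbv _ Ct) (hau _ Cp) (hbv _ Cp) (hau _ Cq) (hbv _ Cq) h1 h2 cr cpq.
  move: (diss_nc dH Huv Hpt) (diss_nc dH Huv (diss_sym dH Hpt)).
  move: (diss_nc dH Huv Hqz) (diss_nc dH Huv (diss_sym dH Hqz)).
  by case/orP: h => /andP[/eqP -> n]; move: n; cyco.
by rewrite subrr.
Qed.

(** Now [c] and [d] are the labels just before [v] and [u]. Resolving [ab] and [cd] across [uv]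
    leaves [ad] and [cb], which cut off only [u] and [v] and have zero signs; the signs of [cd] are
    thus opposite to those of [ab]. *)
Lemma sgn_after C H u v a b c d p q : diss C H ->
  ~~ C a -> ~~ C b -> ~~ C c -> ~~ C d -> H u v ->
  (forall i, i != a -> cycw a i u) -> (forall i, i != b -> cycw b i v) ->
  (forall i, i != c -> cycw c v i) -> (forall i, i != d -> cycw d u i) ->
  (forall t, ~~ ear t u v) -> (forall t, ~~ ear t v u) -> H p q ->
  [/\ crs d c u v, acc H d c &
      sgn H [set p; q] [set c; d] = ([set p; q] == [set u; v])%:R].
Proof.
move=> dH nCa nCb nCc nCd Huv ha hb hc hd e1 e2 Hpq.
have [cab Aab sab] := sgn_before dH nCa nCb Huv ha hb (e2 _) (e1 _) Hpq.
have ne t x : ~~ C t -> C x -> x != t by move=> ?; apply: contraTN => /eqP ->.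
have /and3P[Cu Cv uv] := diss_col dH Huv.
have hcv x : C x -> (x != c) && cycw c v x by move=> Cx; rewrite hc (ne c).
have hdu x : C x -> (x != d) && cycw d u x by move=> Cx; rewrite hd (ne d).
have ndc : d != c.
  by apply: contra_neqN uv => /eqP e; move: (hcv _ Cu) (hdu _ Cv); rewrite e; cyco.
have cdc : crs d c u v.
  have ncd : c != d by rewrite eq_sym.
  by move: (hcv _ Cu) (hdu _ Cv) (hc d ndc) (hd c ncd) uv (ndc); cyco.
have Adc : acc H d c.
  apply: (hub_acc Huv) => i j Hij c1.
  have /and3P[Ci Cj _] := diss_col dH Hij.
  move: cdc uv c1 (hcv _ Ci) (hcv _ Cj) (hdu _ Ci) (hdu _ Cj).
  by move: (diss_nc dH Huv Hij) (diss_nc dH Huv (diss_sym dH Hij)); cyco.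
split=> //; have ccd : crs c d v u by move: cdc; cyco.
have := @sgn_resolve _ R C H a b c d v u p q dH nCa nCb nCc nCd (diss_sym dH Huv)
  cab ccd Aab (acc_sym dH Adc) e2 e1 Hpq.
have [eu ev] : ear u a d /\ ear v b c.
  split; apply/forallP => i; apply/implyP => ni.
    have : d != u by rewrite eq_sym ne.
    have : a != u by rewrite eq_sym ne.
    have /implyP := ha i; have /implyP := hd i.
    by move: ni cab cdc; cyco.
  have : b != v by rewrite eq_sym ne.
  have : c != v by rewrite eq_sym ne.
  have /implyP := hb i; have /implyP := hc i.
  by move: ni cab cdc; cyco.
rewrite (finset.setUC [set a] [set d]).
rewrite (sgn_fan dH Hpq eu).
rewrite (sgn_fan dH Hpq ev) sab addr0 addrC => /eqP.
by rewrite subr_eq0 => /eqP.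
Qed.
End Span.

(** * Duality of signs *)

(** When [Q] is not empty, each of the two sets is [Q] without one extreme element. *)
Lemma card_not_last (T : finType) (f : T -> nat) (Q : {set T}) :
  {in Q &, injective f} ->
  #|[set q in Q | [exists z in Q, f q < f z]%N]| =
  #|[set q in Q | [exists z in Q, f z < f q]%N]|.
Proof.
move=> inj; have [->|[x Qx]] := set_0Vmem Q.
  by congr #|pred_of_set _|; apply/setP => x; rewrite !inE.
case: (@arg_maxnP _ x (mem Q) f Qx) => m Qm mx.
case: (@arg_minnP _ x (mem Q) f Qx) => w Qw mw.
suff [-> ->] : [set q in Q | [exists z in Q, f q < f z]%N] = Q :\ m /\
    [set q in Q | [exists z in Q, f z < f q]%N] = Q :\ w.
  have := cardsD1 m Q; rewrite (cardsD1 w Q).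
  by rewrite (Qm : m \in Q) (Qw : w \in Q) => /eqP; rewrite eqn_add2l => /eqP ->.
split; apply/setP => q; rewrite !inE andbC; have [Qq|] := boolP (q \in Q);
  rewrite ?andbF ?andbT //.
  apply/existsP/idP => [[z /andP[Qz lt]]|ne].
    by apply: contraTneq lt => ->; rewrite -leqNgt; apply: mx.
  exists m; rewrite (Qm : m \in Q) ltn_neqAle (mx q Qq : f q <= f m)%N andbT.
  by apply: contraNneq ne => /inj ->.
apply/existsP/idP => [[z /andP[Qz lt]]|ne].
  by apply: contraTneq lt => ->; rewrite -leqNgt; apply: mw.
exists w; rewrite (Qw : w \in Q) ltn_neqAle (mw q Qq : f w <= f q)%N andbT.
by apply: contraNneq ne => /inj <-.
Qed.

Section Duality.
Variable N : nat.
Implicit Types (a b c d i j l p q r s u v x y z : 'I_N) (C : pred 'I_N) (H : rel 'I_N).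

Lemma pos_ltE a i j : i != a -> j != a -> (pos a i < pos a j)%N = cyc a i j.
Proof.
move=> ia ja; apply/idP/idP => [lt|]; last exact: pos_cyc.
have ne : i != j by apply: contraTneq lt => ->; rewrite ltnn.
have := @pos_cyc N a j i; case: (boolP (cyc a j i)) => [_ /(_ isT)|n _].
  by rewrite ltnNge ltnW.
by move: ia ja ne n; cyco.
Qed.

Lemma pos_inj a : {in [pred i | i != a] &, injective (pos a)}.
Proof.
move=> i j /= ia ja e; apply/eqP/negPn/negP => ne.
have := pos_ltE ia ja; have := pos_ltE ja ia; rewrite e ltnn => n1 n2.
by move: (negbT (esym n1)) (negbT (esym n2)) ia ja ne; rewrite !inE; cyco.
Qed.

Variable R : comNzRingType.
Local Notation sgn := (@sgn N R).

(** The crossed chords at [p] form a fan. A chord counts for [incl] unless it is the one nearest to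
    [a], and for [incr] unless it is the one nearest to [b]. *)
Lemma sum_incl_incr H a b p :
  \sum_(q | H p q && crs a b p q) ((incl H a p q)%:R - (incr H b q p)%:R) = 0 :> R.
Proof.
pose Q := [set q | H p q && crs a b p q].
have nb q : q \in Q -> q != b by rewrite inE => /andP[_]; cyco.
rewrite sumrB; apply/eqP; rewrite subr_eq0.
have card (P : pred 'I_N) :
    \sum_(q | H p q && crs a b p q) (P q)%:R = #|[set q in Q | P q]|%:R :> R.
  rewrite -natr_sum; congr (_%:R); rewrite -sum1_card big_mkcond /= [RHS]big_mkcond /=.
  by apply: eq_bigr => q _; rewrite !inE; case: (_ && _); case: (P q).
rewrite !card; apply/eqP; congr (_%:R).
have inj : {in Q &, injective (pos b)}.
  by move=> i j /nb ib /nb jb; apply: pos_inj.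
have := card_not_last inj.
set X := [set _ in _ | _]; set Y := [set _ in _ | _] => E.
suff [-> ->] : [set q in Q | incl H a p q] = X /\ [set q in Q | incr H b q p] = Y by [].
split; apply/setP => q; rewrite [LHS]inE [RHS]inE; apply: andb_id2l => Qq.
  apply/existsP/existsP => -[z /andP[h1 h2]]; exists z.
    have Qz : z \in Q by move: Qq; rewrite !inE h2 => /andP[_]; move: h1; cyco.
    by rewrite Qz pos_ltE ?nb //; move: Qq; rewrite inE => /andP[_]; move: h1; cyco.
  rewrite pos_ltE ?nb // in h2; move: Qq h1; rewrite !inE => /andP[_ h3] /andP[-> h4].
  by rewrite andbT; move: h2 h3 h4; cyco.
apply/existsP/existsP => -[z /andP[h1 h2]]; exists z.
  have Qz : z \in Q by move: Qq; rewrite !inE h2 => /andP[_]; move: h1; cyco.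
  by rewrite Qz pos_ltE ?nb.
rewrite pos_ltE ?nb // in h2; move: Qq h1; rewrite !inE => /andP[_ h3] /andP[-> h4].
by rewrite andbT.
Qed.

(** Since [cd] lies on the side of [ab] that contains [p], its sign for [pq] depends on [p] alone
    and factors out of the fan at [p], whose sum vanishes. A fan containing the side that cuts off
    [a] or [b] escapes [sgn_acc], but there the factor itself is zero. *)
Lemma dual_off C H1 H2 a b c d : diss C H1 -> diss (predC C) H2 ->
  acc H1 a b -> H2 a b -> H2 c d -> [set c; d] != [set a; b] ->
  ~~ cyc b c a -> ~~ cyc b d a ->
  \sum_p \sum_(q | H1 p q && crs a b p q)
    sgn H1 [set p; q] [set a; b] * sgn H2 [set c; d] [set p; q] = 0.
Proof.
move=> dH1 dH2 A Hab Hcd nE nc nd; apply: big1 => p _.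
have /and3P[Ca Cb _] := diss_col dH2 Hab.
have same q q' : H1 p q && crs a b p q -> H1 p q' && crs a b p q' ->
    sgn H2 [set c; d] [set p; q] = sgn H2 [set c; d] [set p; q'].
  move=> /andP[Hpq c1] /andP[_ c2]; have /and3P[Cp _ _] := diss_col dH1 Hpq.
  apply: (@far_sgn N R (predC C) H2 p q q' b a c d) => //.
  - by rewrite /= negbK.
  - exact: (diss_sym dH2).
  - by rewrite (finset.setUC [set b]).
  - by move: c1; cyco.
  - by move: c2; cyco.
case: (pickP (fun q => [&& H1 p q && crs a b p q & ear a p q || ear b q p])) => [q0|no].
  move=> /andP[h0 e0]; apply: big1 => q hq; rewrite (same q q0 hq h0).
  suff -> : sgn H2 [set c; d] [set p; q0] = 0 by rewrite mulr0.
  by case/orP: e0 => e; [rewrite (finset.setUC [set p])|]; apply: (sgn_fan R dH2 Hcd e).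
case: (pickP (fun q => H1 p q && crs a b p q)) => [q0 h0|none]; last by rewrite big_pred0.
transitivity (\sum_(q | H1 p q && crs a b p q) ((incl H1 a p q)%:R - (incr H1 b q p)%:R)
    * sgn H2 [set c; d] [set p; q0]); last by rewrite -mulr_suml sum_incl_incr mul0r.
apply: eq_bigr => q hq; have /andP[Hpq cr] := hq; rewrite (same q q0 hq h0).
have := no q; rewrite /= hq /= => /negbT; rewrite negb_or => /andP[e1 e2].
by rewrite (sgn_acc R dH1 Ca Cb).
Qed.

(** The sum with [A] cancels along the fans at [p]. The one with [B] needs fans at [q], along which
    [J] cancels rather than [I]; the products [I * B] and [J * B] differ only at the side cutting
    off [b], by [1]. *)
Lemma dual_diag C H1 H2 a b : diss C H1 -> diss (predC C) H2 ->
  acc H1 a b -> (forall p q, H1 p q -> acc H2 p q) -> H2 a b ->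
  (forall t, ~~ ear t a b) -> (forall t, ~~ ear t b a) ->
  \sum_p \sum_(q | H1 p q && crs a b p q)
    sgn H1 [set p; q] [set a; b] * sgn H2 [set a; b] [set p; q] = -1.
Proof.
move=> dH1 dH2 A1 A2 Hab e1 e2; have /and3P[Ca Cb nab] := diss_col dH2 Hab.
pose A p : R := (incl H2 p b a)%:R; pose B q : R := (incr H2 q a b)%:R.
pose I p q : R := (incl H1 a p q)%:R - (incr H1 b q p)%:R.
pose J p q : R := (incl H1 b q p)%:R - (incr H1 a p q)%:R.
have Eterm p q : H1 p q && crs a b p q ->
    sgn H1 [set p; q] [set a; b] * sgn H2 [set a; b] [set p; q] = I p q * A p - I p q * B q.
  move=> /andP[Hpq cr]; have /and3P[Cp Cq _] := diss_col dH1 Hpq.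
  have E2 : sgn H2 [set a; b] [set p; q] = A p - B q.
    rewrite (finset.setUC [set a]); apply: (sgn_acc R dH2) => //=; rewrite ?negbK //.
    - exact: (diss_sym dH2).
    - exact: A2.
    - by move: cr; cyco.
  rewrite E2 -mulrBr; case: (boolP (ear a p q || ear b q p)) => [e|].
    suff /eqP : sgn H2 [set a; b] [set p; q] = 0 by rewrite E2 => /eqP->; rewrite !mulr0.
    by case/orP: e => e; [rewrite (finset.setUC [set p])|]; apply: (sgn_fan R dH2 Hab e).
  by rewrite negb_or => /andP[n1 n2]; rewrite (sgn_acc R dH1 Ca Cb).
have EB p q : H1 p q && crs a b p q -> I p q * B q = J p q * B q + (ear b q p)%:R.
  move=> /andP[Hpq cr]; have /and3P[Cp Cq _] := diss_col dH1 Hpq.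
  (* Here [q] is the label next to [b], so the chord of [H2] cutting off [q] ends at [b]. It is not
     [ab], and serves as the witness for [incr]. *)
  have Bb : ear b q p -> B q = 1.
    move=> e; rewrite /B (_ : incr H2 q a b) //.
    have nq : ~~ (predC C) q by rewrite /= negbK.
    have [l [r [Hlr lr]]] := diss_ear dH2 nq.
    have /and3P[Cl Cr _] := diss_col dH2 Hlr.
    have nx x : predC C x -> x != q by apply: contraTneq => ->.
    have er : r = b.
      have := nx _ Cr; have := earP e (_ : r != b).
      have /lr/andP[_] := nx _ Cb; move=> h1 h2 h3.
      by apply/eqP/negPn/negP => nrb; move: (h2 nrb) h1 h3 (nrb); cyco.
    apply/existsP; exists l; rewrite -er (diss_sym dH2 Hlr) andbT.
    have nl : l != a.
      apply: contraNneq (e1 q) => ela; apply/forallP => i; apply/implyP => /lr.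
      by rewrite ela er.
    have /lr/andP[h _] := nx _ Ca.
    by move: h nl (nx _ Cl) (nx _ Ca); cyco.
  have Ba : ear a p q -> B q = 0.
    move=> e; rewrite /B (_ : incr H2 q a b = false) //.
    apply/negbTE/negP => /existsP[z /andP[h Hz]].
    have : z != a by move: h; cyco.
    by move/(earP e); move: h cr; cyco.
  have cr' : crs b a q p by move: cr; cyco.
  have [ea|na] := boolP (ear a p q).
    rewrite Ba // !mulr0 add0r; case: (boolP (ear b q p)) => // /Bb /eqP.
    by rewrite Ba // eq_sym oner_eq0.
  rewrite /I /J (inc_xor dH1 Ca Hpq A1 cr na); have [eb|nb] := boolP (ear b q p).
    by rewrite Bb // (ear_incl _ eb) (ear_incr _ eb); case: incl; rewrite /=; ring.
  rewrite (inc_xor dH1 Cb (diss_sym dH1 Hpq) (acc_sym dH1 A1) cr' nb) addr0.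
  by congr (_ * _); case: incl; case: incl; rewrite /=; ring.
transitivity (\sum_p \sum_(q | H1 p q && crs a b p q) I p q * A p -
    \sum_p \sum_(q | H1 p q && crs a b p q) I p q * B q).
  rewrite -sumrB; apply: eq_bigr => p _; rewrite -sumrB.
  by apply: eq_bigr => q; apply: Eterm.
rewrite [X in X - _]big1 => [|p _]; last first.
  by rewrite -mulr_suml sum_incl_incr mul0r.
rewrite sub0r; congr (- _).
transitivity (\sum_p \sum_(q | H1 p q && crs a b p q) J p q * B q +
    \sum_p \sum_(q | H1 p q && crs a b p q) (ear b q p)%:R).
  rewrite -big_split; apply: eq_bigr => p _; rewrite -big_split.
  by apply: eq_bigr => q; apply: EB.
rewrite (exchange_big_dep xpredT) //= big1 => [|q _]; last first.
  rewrite -mulr_suml (eq_bigl (fun p => H1 q p && crs b a q p)) => [|p].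
    by rewrite sum_incl_incr mul0r.
  congr (_ && _); first by apply/idP/idP; apply: (diss_sym dH1).
  by rewrite /crs andbC.
have [l [r [Hlr lr]]] := diss_ear dH1 Cb.
have /and3P[Cl Cr nlr] := diss_col dH1 Hlr.
have ne t x : ~~ C t -> C x -> x != t by move=> ?; apply: contraTN => /eqP ->.
have elr : ear b l r by apply/forallP => i; apply/implyP; apply: lr.
have uniq p q : H1 p q -> ear b q p -> (p == r) && (q == l).
  move=> Hpq e; have /and3P[Cp Cq _] := diss_col dH1 Hpq.
  have := earP e (ne _ _ Cb Cl); have := earP e (ne _ _ Cb Cr).
  have := lr _ (ne _ _ Cb Cp); have := lr _ (ne _ _ Cb Cq).
  by move: (ne _ _ Cb Cl) (ne _ _ Cb Cr) (ne _ _ Cb Cp) (ne _ _ Cb Cq); cyco.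
have crl : crs a b r l.
  have /lr := nab; move: nlr nab (ne _ _ Ca Cl) (ne _ _ Cb Cl) (ne _ _ Ca Cr) (ne _ _ Cb Cr).
  by cyco.
rewrite add0r (bigD1 r) //= (bigD1 l) /= ?(diss_sym dH1 Hlr) ?crl // elr.
rewrite big1 => [|q /andP[/andP[Hq _] ql]]; last first.
  by case: (boolP (ear b q r)) => // /(uniq _ _ Hq); rewrite (negPf ql) andbF.
rewrite big1 => [|p pr]; first by rewrite !addr0.
apply: big1 => q /andP[Hq _].
by case: (boolP (ear b q p)) => // /(uniq _ _ Hq); rewrite (negPf pr).
Qed.

Lemma sum_chords (Dbar : {set {set 'I_N}}) a b (F : {set 'I_N} -> R) :
  (forall y : {set 'I_N}, y \in Dbar -> exists p q, y = [set p; q]) ->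
  (forall y : {set 'I_N}, y \in Dbar -> ~~ xc y [set a; b] -> F y = 0) ->
  \sum_(e in Dbar) F e =
  \sum_p \sum_(q | ([set p; q] \in Dbar) && crs a b p q) F [set p; q].
Proof.
move=> two F0; rewrite pair_big_dep /=.
pose A := [set u : 'I_N * 'I_N | ([set u.1; u.2] \in Dbar) && crs a b u.1 u.2].
pose h (u : 'I_N * 'I_N) := [set u.1; u.2].
have inj : {in A &, injective h}.
  move=> [p q] [x y]; rewrite !inE /= => /andP[_ c1] /andP[_ c2].
  rewrite /h /= => /eqP /set2_eqP[[-> ->]//|[e1 e2]].
  by exfalso; move: c1 c2; rewrite e1 e2; cyco.
have -> : \sum_(u | ([set u.1; u.2] \in Dbar) && crs a b u.1 u.2) F [set u.1; u.2] =
    \sum_(e in h @: A) F e.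
  by rewrite big_imset //=; apply: eq_bigl => u; rewrite inE.
have sub (y : {set 'I_N}) : y \in h @: A -> y \in Dbar.
  by case/imsetP => u; rewrite inE => /andP[+ _] ->.
rewrite [LHS](bigID (mem (h @: A))) /= [X in _ + X]big1 => [|y /andP[Dy ny]].
  by rewrite addr0; apply: eq_bigl => y; apply/andb_idl; apply: sub.
apply: F0 => //; have [p [q e]] := two y Dy; apply: contra ny; rewrite e xcE.
case/orP => cr; apply/imsetP; [exists (p, q)|exists (q, p)]; rewrite ?inE /= ?cr -?e ?Dy //.
  by rewrite finset.setUC -e Dy.
by rewrite e finset.setUC.
Qed.

(* With [H1] the chords of [D] and [H2] those of a maximal accordion dissection,
   this is the duality between [g]-vectors and [c]-vectors. *)
Lemma sgn_dual C (Dbar : {set {set 'I_N}}) H1 H2 a b c d :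
  (forall y : {set 'I_N}, y \in Dbar -> exists p q, y = [set p; q]) ->
  (forall p q, H1 p q = ([set p; q] \in Dbar)) ->
  diss C H1 -> diss (predC C) H2 ->
  (forall x y, H2 x y -> acc H1 x y) -> (forall p q, H1 p q -> acc H2 p q) ->
  H2 a b -> H2 c d -> (forall t, ~~ ear t a b) -> (forall t, ~~ ear t b a) ->
  \sum_(e in Dbar) sgn H1 e [set a; b] * sgn H2 [set c; d] e =
  - ([set c; d] == [set a; b])%:R.
Proof.
move=> two H1E dH1 dH2 A1 A2 Hab Hcd e1 e2.
rewrite (@sum_chords Dbar a b) // => [|y _ n]; last by rewrite sgn_xc // mul0r.
under eq_bigr => p _ do (under eq_bigl => q do rewrite -H1E).
have [E|nE] := eqVneq [set c; d] [set a; b].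
  by rewrite E (dual_diag dH1 dH2) //; apply: A1.
rewrite oppr0; have nc1 := diss_nc dH2 Hab Hcd.
have nc2 := diss_nc dH2 Hab (diss_sym dH2 Hcd).
case: (boolP (~~ cyc b c a && ~~ cyc b d a)) => [/andP[n1 n2]|n].
  by apply: (dual_off dH1 dH2) => //; apply: A1.
have n1 : ~~ cyc a c b by move: n nc1 nc2; cyco.
have n2 : ~~ cyc a d b by move: n nc1 nc2; cyco.
rewrite (exchange_big_dep xpredT) //=.
have Hba := diss_sym dH2 Hab.
rewrite (finset.setUC [set a]) in nE *.
rewrite -[RHS](dual_off dH1 dH2 (A1 _ _ Hba) Hba Hcd nE n1 n2).
apply: eq_bigr => q _; apply: eq_big => [p|p _]; last by rewrite (finset.setUC [set p]).
congr (_ && _); first by apply/idP/idP; apply: (diss_sym dH1).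
by rewrite /crs andbC.
Qed.

End Duality.

Import Order.TTheory Num.Theory.
Import numFieldNormedType.Exports.
Local Open Scope classical_set_scope.
Local Open Scope ring_scope.

(** * Existence of minimizers over a compact polyhedron *)

Section Minimum.
Context {R : realType} {S : finType}.
Implicit Types (t : S -> R) (v : 'rV[R]_#|S|).

Definition of_row v : S -> R := fun s => v 0 (enum_rank s).

Lemma of_row_continuous s : continuous (fun v => of_row v s).
Proof. exact: coord_continuous. Qed.

Lemma sum_continuous (T : topologicalType) (J : finType) (F : J -> T -> R) :
  (forall j, continuous (F j)) -> continuous (fun x => \sum_j F j x).
Proof.
move=> cF; apply: continuous_big => [x|j _]; last exact: cF.
exact: (@add_continuous R^o x).
Qed.

Lemma linear_continuous_row (c : S -> R) :
  continuous (fun v => \sum_s of_row v s * c s).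
Proof.
apply: sum_continuous => s v.
apply: (@continuousM R _ (fun v => of_row v s) (fun=> c s)); last exact: cst_continuous.
exact: of_row_continuous.
Qed.

(** As [k] is at least [1], the last constraint confines [t] to a box and the polyhedron is compact.
    It serves twice: for the point of a convex hull nearest to a given one, and for a combination of
    least weight. *)
Lemma polyhedron_min (J : finType) (a : S -> J -> R) (b : J -> R) (k : S -> R) (B : R)
    (f : (S -> R) -> R) (t0 : S -> R) :
  (forall s, 1 <= k s) -> continuous (fun v => f (of_row v)) ->
  let K t := [/\ forall s, 0 <= t s, forall j, \sum_s t s * a s j = b j &
                 \sum_s t s * k s <= B] in
  K t0 -> exists2 t, K t & forall u, K u -> f t <= f u.
Proof.
move=> k1 cf K K0.
have rowK t : of_row (\row_j t (enum_val j)) = t.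
  by apply/funext => s; rewrite /of_row mxE enum_rankK.
pose Kr := [set v | K (of_row v)].
have clK : closed Kr.
  have -> : Kr = (\bigcap_s [set v | 0 <= of_row v s]) `&`
      (\bigcap_j [set v | \sum_s of_row v s * a s j = b j]) `&`
      [set v | \sum_s of_row v s * k s <= B].
    apply/seteqP; split=> [v [h1 h2 h3]|v [[h1 h2] h3]].
      by split; [split=> s _; [exact: h1|exact: h2]|exact: h3].
    by split=> // s; [exact: h1|exact: h2].
  have cl (c : S -> R) (D : set R) : closed D -> closed [set v | D (\sum_s of_row v s * c s)].
    by have /continuous_closedP/(_ D) := @linear_continuous_row c.
  apply: closedI; last exact: (cl k _ (@closed_le R B)).
  apply: closedI; apply: closed_bigI => j _; last exact: (cl (a^~ j) _ (@closed_eq R (b j))).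
  have /continuous_closedP/(_ [set x | 0 <= x]) := @of_row_continuous j; apply.
  exact: (@closed_ge R 0).
have cK : compact Kr.
  apply: (subclosed_compact clK (rV_compact (fun=> @segment_compact R 0 B))) => v [h1 _ h3] i.
  have -> : v ord0 i = of_row v (enum_val i) by rewrite /of_row enum_valK.
  rewrite /= in_itv /= h1 /=; apply: le_trans h3.
  rewrite (bigD1 (enum_val i)) //= ler_wpDr ?sumr_ge0 // => [s _|].
    by rewrite mulr_ge0 // (le_trans ler01).
  by rewrite ler_peMr.
have [|v vK vmin] := EVT_min_rV _ cK (continuous_subspaceT cf).
  by exists (\row_j t0 (enum_val j)); rewrite /Kr /= rowK.
exists (of_row v); first by move: vK; rewrite inE.
by move=> u Ku; rewrite -(rowK u); apply: vmin; rewrite inE /Kr /= rowK.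
Qed.

End Minimum.

(** * Scalar product, convex combinations and separation *)

Section Dot.
Context {R : realType} {I : finType}.
Local Notation V := {ffun I -> R^o}.
Implicit Types (x y z : V).

Lemma dotC x y : dot x y = dot y x.
Proof. by apply: eq_bigr => i _; rewrite mulrC. Qed.

Lemma dotDl x y z : dot (x + y) z = dot x z + dot y z.
Proof. by rewrite -big_split; apply: eq_bigr => i _; rewrite ffunE mulrDl. Qed.

Lemma dotZl (a : R) x y : dot (a *: x) y = a * dot x y.
Proof. by rewrite mulr_sumr; apply: eq_bigr => i _; rewrite ffunE -mulrA. Qed.

Lemma dot0l x : dot 0 x = 0.
Proof. by rewrite /dot big1 // => i _; rewrite ffunE mul0r. Qed.

Lemma dotNl x y : dot (- x) y = - dot x y.
Proof. by rewrite -scaleN1r dotZl mulN1r. Qed.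

Lemma dotBl x y z : dot (x - y) z = dot x z - dot y z.
Proof. by rewrite dotDl dotNl. Qed.

Lemma dotDr x y z : dot z (x + y) = dot z x + dot z y.
Proof. by rewrite !(dotC z) dotDl. Qed.

Lemma dotZr (a : R) x y : dot y (a *: x) = a * dot y x.
Proof. by rewrite !(dotC y) dotZl. Qed.

Lemma dotBr x y z : dot z (x - y) = dot z x - dot z y.
Proof. by rewrite !(dotC z) dotBl. Qed.

Lemma dot_suml (J : Type) (r : seq J) (P : pred J) (F : J -> V) y :
  dot (\sum_(j <- r | P j) F j) y = \sum_(j <- r | P j) dot (F j) y.
Proof. by apply: (big_morph (dot^~ y)) => [x z|]; [apply: dotDl|apply: dot0l]. Qed.

Lemma dot_sumr (J : Type) (r : seq J) (P : pred J) (F : J -> V) y :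
  dot y (\sum_(j <- r | P j) F j) = \sum_(j <- r | P j) dot y (F j).
Proof. by rewrite dotC dot_suml; apply: eq_bigr => j _; rewrite dotC. Qed.

Lemma dot_subZ (e : R) x y :
  dot (x - e *: y) (x - e *: y) = dot x x - 2 * e * dot x y + e * (e * dot y y).
Proof. by rewrite !(dotBl, dotBr, dotZl, dotZr) (dotC y x); ring. Qed.

Lemma dot_ge0 x : 0 <= dot x x.
Proof. by apply: sumr_ge0 => i _; apply: sqr_ge0. Qed.

Lemma dot_eq0 x : dot x x = 0 -> x = 0.
Proof.
move=> /eqP; rewrite psumr_eq0 => [/allP h|i _]; last exact: sqr_ge0.
apply/ffunP => i; have := h i (mem_index_enum i).
by rewrite -expr2 sqrf_eq0 ffunE => /eqP.
Qed.

Lemma convex_setP (W : lmodType R) (C : set W) : convex_set C <->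
  forall (x y : W) (t : R), C x -> C y -> 0 <= t <= 1 -> C (t *: x + (1 - t) *: y).
Proof.
split=> [cC x y t Cx Cy /andP[t0 t1]|cC x y t].
  by have := cC x y (Itv01 t0 t1); rewrite !inE; apply.
rewrite !inE => Cx Cy; apply: (cC x y t%:num) => //.
by rewrite ge0 le1.
Qed.

Lemma convex_comb (W : lmodType R) (C : set W) (J : Type) (r : seq J) (t : J -> R)
    (p : J -> W) : convex_set C -> (forall j, C (p j)) -> (forall j, 0 <= t j) ->
  0 < \sum_(j <- r) t j ->
  C ((\sum_(j <- r) t j)^-1 *: \sum_(j <- r) t j *: p j).
Proof.
move=> /convex_setP cC Cp t0; elim: r => [|j r IH]; first by rewrite big_nil ltxx.
rewrite !big_cons; set s := \sum_(j <- r) t j => s0.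
have s_ge0 : 0 <= s by apply: sumr_ge0.
have [e|sn0] := eqVneq s 0.
  rewrite e addr0 in s0 *.
  have -> : \sum_(j <- r) t j *: p j = 0.
    move: e; rewrite /s; elim: (r) => [|i l IHl]; first by rewrite !big_nil.
    rewrite !big_cons => /eqP; rewrite paddr_eq0 ?sumr_ge0 // => /andP[/eqP -> /eqP /IHl ->].
    by rewrite scale0r addr0.
  by rewrite addr0 scalerA mulVf ?scale1r // gt_eqF.
have sp : 0 < s by rewrite lt0r sn0.
have := cC _ _ (t j / (t j + s)) (Cp j) (IH sp); rewrite -/s => h.
have -> : (t j + s)^-1 *: (t j *: p j + \sum_(i <- r) t i *: p i) =
    (t j / (t j + s)) *: p j + (1 - t j / (t j + s)) *: (s^-1 *: \sum_(i <- r) t i *: p i).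
  rewrite scalerDr !scalerA mulrC; congr (_ *: _ + _ *: _).
  by field; rewrite sn0 gt_eqF.
apply: h; rewrite divr_ge0 ?(ltW s0) //= ler_pdivrMr // mul1r lerDl //.
Qed.

(** Let [z t] be the point of the hull nearest to [x]. If it is not [x], then [x - z t] separates:
    were its scalar product with [p j - z t] positive, a small step towards [p j] would shorten the
    distance. *)
Lemma conv_separation (J : finType) (p : J -> V) (j0 : J) x :
  (forall C : set V, convex_set C -> (forall j, C (p j)) -> C x) \/
  exists y, forall j, dot y (p j) < dot y x.
Proof.
pose z (t : J -> R) : V := \sum_j t j *: p j.
pose f t := dot (x - z t) (x - z t).
have zE t i : (x - z t) i = x i - \sum_j t j * p j i.
  by rewrite !ffunE sum_ffunE; congr (_ - _); apply: eq_bigr => j _; rewrite ffunE.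
have cf : continuous (fun v : 'rV[R]_#|J| => f (of_row v)).
  apply: sum_continuous => i v.
  have c : continuous (fun v : 'rV[R]_#|J| => (x - z (of_row v)) i).
    under eq_fun do rewrite zE.
    move=> w; apply: (@continuousB R R^o _ (fun=> x i)); first exact: cst_continuous.
    exact: linear_continuous_row.
  by apply: continuousM; apply: c.
have [|t [t0 t1 _] tmin] := @polyhedron_min R J unit (fun _ _ => 1) (fun=> 1)
   (fun=> 1) 1 f (fun j => (j == j0)%:R)
   (fun=> lexx 1) cf.
  split=> [s|_|].
  - by rewrite ler0n.
  - under eq_bigr do rewrite mulr1.
    by rewrite (bigD1 j0) //= eqxx big1 ?addr0 // => j /negPf ->.
  - under eq_bigr do rewrite mulr1.
    by rewrite (bigD1 j0) //= eqxx big1 ?addr0 // => j /negPf ->.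
have {}t1 : \sum_j t j = 1 by rewrite -(t1 tt); apply: eq_bigr => j _; rewrite mulr1.
have [e|ne] := eqVneq (x - z t) 0.
  left=> C cC Cp; have -> : x = z t by apply/eqP; rewrite -subr_eq0 e.
  have := convex_comb (r := index_enum J) cC Cp t0; rewrite t1 invr1 scale1r; apply.
  exact: ltr01.
right; exists (x - z t) => j.
have ypos : 0 < dot (x - z t) (x - z t).
  by rewrite lt0r dot_ge0 andbT; apply: contraNneq ne => /dot_eq0 ->.
set y := x - z t in ypos *.
suff le0 : dot y (p j - z t) <= 0.
  by move: le0 ypos; rewrite {4}/y !dotBr; lra.
rewrite leNgt; apply/negP => apos.
set d := p j - z t in apos; set a := dot y d in apos; pose b := dot d d.
have b0 : 0 <= b by apply: dot_ge0.
(* The squared distance changes by [e * (e * b - 2 * a)]; this [e] is positive, at most [1], and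
   satisfies [e * b < a]. *)
pose e := a / (a + b + 1).
have abp : 0 < a + b + 1 by lra.
have e0 : 0 < e by rewrite divr_gt0.
have e1 : e <= 1 by rewrite ler_pdivrMr // mul1r; lra.
have eb : e * b < a.
  by rewrite /e mulrAC ltr_pdivrMr // ltr_pM2l //; lra.
pose u i := (1 - e) * t i + e * (i == j)%:R.
have sumj (F : J -> R) : \sum_i F i * (i == j)%:R = F j.
  by rewrite (bigD1 j) //= eqxx mulr1 big1 ?addr0 // => i /negPf ->; rewrite mulr0.
have u1 : \sum_i u i = 1.
  rewrite big_split /= -mulr_sumr t1 (sumj (fun=> e)); lra.
have zu : x - z u = y - e *: d.
  have -> : z u = (1 - e) *: z t + e *: p j.
    rewrite /z (eq_bigr (fun i => (1 - e) *: (t i *: p i) + (e * (i == j)%:R) *: p i)).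
      rewrite big_split /= -scaler_sumr; congr (_ + _).
      by rewrite (bigD1 j) //= eqxx mulr1 big1 ?addr0 // => i /negPf ->; rewrite mulr0 scale0r.
    by move=> i _; rewrite /u [LHS]scalerDl scalerA.
  by rewrite /y /d scalerBr scalerBl scale1r; apply/ffunP => i; rewrite !ffunE; ring.
have := tmin u; rewrite /f -/y zu => h.
suff : dot (y - e *: d) (y - e *: d) < dot y y.
  rewrite ltNge h //; split=> [s|_|].
  - by rewrite /u addr_ge0 // mulr_ge0 ?ler0n // ?subr_ge0 // ltW.
  - by rewrite (eq_bigr u) ?u1 // => i _; rewrite mulr1.
  - by rewrite (eq_bigr u) ?u1 // => i _; rewrite mulr1.
by rewrite dot_subZ -/a -/b; nra.
Qed.

End Dot.

(** * Fans and polytopes from an exchange relation *)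

Section ResolutionFan.
Context {R : realType} {I S : finType}.
Local Notation V := {ffun I -> R^o}.
Variables (A : {set S}) (cx : rel S) (g : S -> V) (c : {set S} -> S -> V).
Implicit Types (E F : {set S}) (d e u v : S) (t : S -> R).

Definition compat E := E \subset A /\ {in E &, forall d e, ~~ cx d e}.
Definition maximal_compat E := compat E /\ forall F, compat F -> E \subset F -> F = E.
Definition cx_height d := #|[set e in A | cx e d]%SET|.
Definition vertex E : V := \sum_(d in E) (cx_height d)%:R *: c E d.
Definition cone E : set V :=
  [set \sum_(d in E) t d *: g d | t in [set t : S -> R | forall d, 0 <= t d]].
Definition facets : set V := \bigcap_(d in [set` A]) [set x | dot (g d) x <= (cx_height d)%:R].

Hypothesis cx_sym : symmetric cx.
Hypothesis cx_irr : irreflexive cx.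
Hypothesis g_span : forall i (s : bool), exists2 d, d \in A &
  g d = [ffun j => (-1) ^+ s * (j == i)%:R].
(** The alternatives [g u = 0] and [g v = 0] stand for resolved chords that are polygon edges, hence
    outside [A]. *)
Hypothesis g_resolve : forall d e, d \in A -> e \in A -> cx d e -> exists u v,
  [/\ u \in A \/ g u = 0, v \in A \/ g v = 0, g d + g e = g u + g v,
      forall f, f \in A -> (cx f u + cx f v <= cx f d + cx f e)%N &
      [&& ~~ cx d u, ~~ cx d v, ~~ cx e u & ~~ cx e v]].
Hypothesis g_dual : forall E d e, maximal_compat E -> d \in E -> e \in E ->
  dot (g d) (c E e) = (d == e)%:R.

Lemma cx_heightE d : cx_height d = (\sum_(e in A) cx e d)%N.
Proof.
rewrite /cx_height -sum1_card big_mkcond /= [RHS]big_mkcond; apply: eq_bigr => e _.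
by rewrite inE; case: (e \in A); case: (cx e d).
Qed.

Lemma compat_max E : compat E -> exists2 F, maximal_compat F & E \subset F.
Proof.
have [m] := ubnP (#|S| - #|E|)%N; elim: m E => // m IH E lt cE.
have [mE|nmE] := pselect (maximal_compat E); first by exists E.
have [F [cF [EF nEF]]] : exists F, compat F /\ E \subset F /\ F <> E.
  apply: contrapT => no; apply: nmE; split=> // F cF EF.
  by apply: contrapT => nFE; apply: no; exists F.
have [||G mG FG] := IH F; last by exists G => //; apply: fintype.subset_trans EF FG.
- have pr : E \proper F by rewrite finset.properEneq EF andbT; apply/eqP => e; apply: nEF.
  have : (#|F| <= #|S|)%N by apply: max_card.
  by have := proper_card pr; move: lt; clear; lia.
- by [].
Qed.

Lemma maximal_crossed E d : maximal_compat E -> d \in A -> d \notin E ->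
  exists2 e, e \in E & cx e d.
Proof.
move=> [[EA nc] mE] Ad nEd; apply: contrapT => no.
have nod e : e \in E -> ~~ cx e d by move=> Ee; apply/negP => h; apply: no; exists e.
have : compat (d |: E).
  split; first by apply/fintype.subsetP => e /finset.setU1P[->//|/(fintype.subsetP EA)].
  move=> e f /finset.setU1P[->|Ee] /finset.setU1P[->|Ef]; rewrite ?cx_irr //; last exact: nc.
    by rewrite cx_sym nod.
  exact: nod.
move/mE => /(_ (finset.subsetUr _ _)) EE; move/negP: nEd; apply.
by rewrite -EE finset.setU11.
Qed.

Lemma vertex_eq E d : maximal_compat E -> d \in E ->
  dot (g d) (vertex E) = (cx_height d)%:R.
Proof.
move=> mE Ed; rewrite dot_sumr (bigD1 d) //= dotZr (g_dual mE) // eqxx mulr1.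
by rewrite big1 ?addr0 // => e /andP[Ee ne]; rewrite dotZr (g_dual mE) // eq_sym (negPf ne) mulr0.
Qed.

Lemma resolve_height d e u v : d \in A -> e \in A -> cx d e ->
  (forall f, f \in A -> (cx f u + cx f v <= cx f d + cx f e)%N) ->
  ~~ cx d u -> ~~ cx d v -> (cx_height u + cx_height v < cx_height d + cx_height e)%N.
Proof.
move=> Ad Ae de le du dv; rewrite !cx_heightE -!big_split /=.
rewrite (bigD1 d) //= [X in (_ < X)%N](bigD1 d) //= cx_irr de (negPf du) (negPf dv).
by rewrite ltnS; apply: leq_sum => f /andP[Af _]; apply: le.
Qed.

(** Induction on the number of chords of [E] crossing [d]. Resolving [d] with one of them, [e],
    gives [u] and [v] that cross fewer of them, because [e] crosses neither and no other chord of
    [E] crosses [e]. As [g e] is tight at the vertex, the drop of the heights falls entirely on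
    [d]. *)
Lemma vertex_lt E d : maximal_compat E -> d \in A -> d \notin E ->
  dot (g d) (vertex E) < (cx_height d)%:R.
Proof.
move=> mE; have [m] := ubnP (\sum_(e in E) cx e d)%N.
elim: m d => // m IH d; rewrite ltnS => lem Ad nEd.
have [EA nc] := mE.1.
have [e Ee ed] := maximal_crossed mE Ad nEd; have Ae := fintype.subsetP EA _ Ee.
have de : cx d e by rewrite cx_sym.
have [u [v [hu hv guv lec /and4P[du dv eu ev]]]] := g_resolve Ad Ae de.
have ltE : (\sum_(f in E) cx f u + \sum_(f in E) cx f v < \sum_(f in E) cx f d)%N.
  rewrite -big_split (bigD1 e) //= [X in (_ < X)%N](bigD1 e) //= ed (negPf eu) (negPf ev).
  rewrite ltnS; apply: leq_sum => f /andP[Ef _].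
  by have := lec f (fintype.subsetP EA _ Ef); rewrite (negPf (nc f e Ef Ee)) addn0.
have lew w : w \in A \/ g w = 0 -> (\sum_(f in E) cx f w < m)%N ->
    dot (g w) (vertex E) <= (cx_height w)%:R.
  move=> [Aw|->] lt; last by rewrite dot0l.
  have [Ew|nEw] := boolP (w \in E); first by rewrite vertex_eq.
  exact/ltW/IH.
have ku := lew u hu; have kv := lew v hv.
have lt := resolve_height Ad Ae de lec du dv.
have : dot (g d) (vertex E) + dot (g e) (vertex E) =
    dot (g u) (vertex E) + dot (g v) (vertex E) by rewrite -!dotDl guv.
have : dot (g u) (vertex E) <= (cx_height u)%:R.
  by apply: ku; apply: leq_trans (leq_trans _ ltE) lem; rewrite ltnS leq_addr.
have : dot (g v) (vertex E) <= (cx_height v)%:R.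
  by apply: kv; apply: leq_trans (leq_trans _ ltE) lem; rewrite ltnS leq_addl.
have : (cx_height u)%:R + (cx_height v)%:R < (cx_height d)%:R + (cx_height e)%:R :> R.
  by rewrite -!natrD ltr_nat.
by rewrite (vertex_eq mE Ee); lra.
Qed.

Lemma vertex_facets E : maximal_compat E -> facets (vertex E).
Proof.
move=> mE d Ad /=; have [Ed|nEd] := boolP (d \in E); first by rewrite vertex_eq.
exact/ltW/vertex_lt.
Qed.

(* Among the nonnegative combinations of the [g d] equal to [y], one of least
   total weight has compatible support: resolving two crossing summands would
   lower the weight. *)
Lemma cone_complete (y : V) : exists E t, [/\ compat E, forall d, 0 <= t d,
  forall d, (0 < t d) = (d \in E) & y = \sum_(d in E) t d *: g d].
Proof.
(* The added [1] makes the feasible set bounded, and it does not affect the comparison of two chords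
   with two chords. *)
pose k d : R := (cx_height d).+1%:R.
have k1 d : 1 <= k d by rewrite ler1n.
pose f (t : S -> R) := \sum_d t d * k d.
(* Indices outside [A] carry the zero vector: a resolved chord that is an edge can receive weight
   without changing the combination. *)
pose G d i : R := if d \in A then g d i else 0.
have sum1 (F : S -> R) u : \sum_d (d == u)%:R * F d = F u.
  by rewrite (bigD1 u) //= eqxx mul1r big1 ?addr0 // => d /negPf ->; rewrite mul0r.
have [t0 [t00 t0y]] : exists t0 : S -> R, (forall d, 0 <= t0 d) /\
    forall i, \sum_d t0 d * G d i = y i.
  have /choice[p hp] : forall i, exists d, d \in A /\
      g d = [ffun j => (-1) ^+ (y i < 0)%R * (j == i)%:R].
    by move=> i; have [d Ad gd] := g_span i (y i < 0); exists d.
  (* Decomposing [y] along signed basis vectors gives a feasible point, whose weight is the bound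
     imposed on the minimization. *)
  exists (fun d => \sum_i `|y i| * (d == p i)%:R); split=> [d|i].
    by apply: sumr_ge0 => i _; rewrite mulr_ge0 ?ler0n.
  under eq_bigr do rewrite mulr_suml.
  rewrite exchange_big (bigD1 i) //= [X in _ + X]big1 ?addr0 => [|j ji].
    under eq_bigr do rewrite -mulrA.
    rewrite -mulr_sumr (sum1 (G^~ i)) /G; have [-> ->] := hp i.
    by rewrite ffunE eqxx mulr1 mulrC mulr_sign_norm.
  under eq_bigr do rewrite -mulrA.
  rewrite -mulr_sumr (sum1 (G^~ i)) /G; have [-> ->] := hp j.
  by rewrite ffunE eq_sym (negPf ji) !mulr0.
have cf : continuous (fun v : 'rV[R]_#|S| => f (of_row v)) by apply: linear_continuous_row.
have [//|t [tge ty tB] tmin] := @polyhedron_min R S I G y k (f t0) f t0 k1 cf.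
pose E := [set d in A | 0 < t d]%SET.
exists E, (fun d => if d \in A then t d else 0); split.
- split=> [|d e]; first by apply/fintype.subsetP => d; rewrite inE => /andP[].
  rewrite !inE => /andP[Ad td] /andP[Ae te]; apply/negP => de.
  have [u [v [hu hv guv lec /and4P[du dv _ _]]]] := g_resolve Ad Ae de.
  have Gg w i : w \in A \/ g w = 0 -> G w i = g w i.
    by rewrite /G; case: ifP => // _ [//|->]; rewrite ffunE.
  pose m := Num.min (t d) (t e).
  have m0 : 0 < m by rewrite lt_min td.
  (* The direction of the exchange: weight passes from [d] and [e] to [u] and [v], and [m] is the
     largest amount that both can give. *)
  pose h x : R := (x == u)%:R + (x == v)%:R - (x == d)%:R - (x == e)%:R.
  have sumh (F : S -> R) : \sum_x (t x + m * h x) * F x = \sum_x t x * F x + m * (F u + F v - F d - F e).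
    rewrite -(sum1 F u) -(sum1 F v) -(sum1 F d) -(sum1 F e) -!sumrN -!big_split /=.
    rewrite mulr_sumr -big_split /=; apply: eq_bigr => x _; rewrite /h; ring.
  have klt : k u + k v < k d + k e.
    rewrite /k -!natrD ltr_nat; rewrite !addSn !addnS !ltnS.
    exact: resolve_height Ad Ae de lec du dv.
  have fh : f (fun x => t x + m * h x) < f t.
    by rewrite /f sumh -ltrBDl subrr pmulr_rlt0 //; lra.
  have := fh; rewrite ltNge => /negP; apply; apply: tmin.
  split=> [x|i|]; last exact: le_trans (ltW fh) tB.
    have nde : (d == e) = false by apply/negP => /eqP ede; rewrite ede cx_irr in de.
    have md : m <= t d by rewrite ge_min lexx.
    have me : m <= t e by rewrite ge_min lexx orbT.
    have := tge x; rewrite /h.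
    have pu : 0 <= m * (x == u)%:R by rewrite mulr_ge0 ?ler0n // ltW.
    have pv : 0 <= m * (x == v)%:R by rewrite mulr_ge0 ?ler0n // ltW.
    case: (eqVneq x d) pu pv => [->|_] pu pv; first by rewrite nde /=; lra.
    by case: (eqVneq x e) pu pv => [->|_] pu pv /=; lra.
  rewrite sumh ty !Gg //; [|by left|by left].
  have : (g d + g e) i = (g u + g v) i by rewrite guv.
  by rewrite !ffunE => eqi; rewrite -addrA -opprD eqi subrr mulr0 addr0.
- by move=> d; case: ifP.
- by move=> d; rewrite inE; case: ifP => //; rewrite ltxx.
apply/ffunP => i; rewrite -ty sum_ffunE [RHS]big_mkcond; apply: eq_bigr => d _.
rewrite /G inE; have [Ad|] := boolP (d \in A); last by rewrite mulr0.
rewrite /=; case: ifP => [_|/negbT]; first by rewrite ffunE.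
by rewrite -leNgt => t0'; rewrite (le_anti (_ : t d <= 0 <= t d)) ?mul0r // t0' tge.
Qed.

Lemma cone_le E t x : compat E -> (forall d, 0 <= t d) -> facets x ->
  dot (\sum_(d in E) t d *: g d) x <= \sum_(d in E) t d * (cx_height d)%:R.
Proof.
move=> [EA _] t0 Px; rewrite dot_suml; apply: ler_sum => d Ed; rewrite dotZl.
by apply: ler_wpM2l => //; apply: (Px d); apply: (fintype.subsetP EA).
Qed.

Lemma cone_vertex E F t : maximal_compat F -> E \subset F ->
  dot (\sum_(d in E) t d *: g d) (vertex F) = \sum_(d in E) t d * (cx_height d)%:R.
Proof.
move=> mF EF; rewrite dot_suml; apply: eq_bigr => d Ed.
by rewrite dotZl vertex_eq // (fintype.subsetP EF).
Qed.

(** A point of [facets] outside the hull would be strictly separated from all vertices by some [y].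
    But [y] is in the cone of a compatible set, and the vertex of any maximal set containing it
    maximizes [y] on [facets]. *)
Lemma hull_facets : conv_hull [set vertex E | E in maximal_compat] = facets.
Proof.
apply/seteqP; split=> [|x Px].
  apply: smallest_sub => [|_ [E mE <-]]; last exact: vertex_facets.
  apply/convex_setP => x y t Px Py /andP[t0 t1] d Ad /=.
  have := Px d Ad; have := Py d Ad; rewrite /= dotDr !dotZr; nra.
pose J := {E : {set S} | `[< maximal_compat E >]}.
have [|F0 mF0 _] := @compat_max finset.set0.
  by split=> [|d e]; rewrite ?finset.sub0set ?inE.
have [cx_x|[y hy]] := conv_separation (fun j : J => vertex (val j))
    (exist _ F0 (asboolT mF0)) x.
  move=> C [cC hC]; apply: cx_x => // j; apply: hC.
  by exists (val j) => //; apply/asboolP/(valP j).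
have [E [t [cE t0 _ ey]]] := cone_complete y.
have [F mF EF] := compat_max cE.
have := hy (exist _ F (asboolT mF)); rewrite /= ey (cone_vertex t mF EF).
by rewrite ltNge cone_le.
Qed.

(** A combination of the facet inequalities with positive weights is tight only where each of them
    is; the bound is attained at the vertex of a maximal set containing [E]. *)
Lemma maximizers_cone E t x : compat E -> (forall d, 0 <= t d) ->
  (forall d, d \in E -> 0 < t d) ->
  maximizers facets (\sum_(d in E) t d *: g d) x <->
  facets x /\ forall d, d \in E -> dot (g d) x = (cx_height d)%:R.
Proof.
move=> cE t0 tp; split=> [[Px mx]|[Px ex]]; last first.
  split=> // z Pz; apply: le_trans (cone_le cE t0 Pz) _.
  rewrite dot_suml; apply: ler_sum => d Ed; by rewrite dotZl ex.
split=> // d Ed; have [F mF EF] := compat_max cE.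
have := mx _ (vertex_facets mF); rewrite (cone_vertex t mF EF) => h.
have Pd e : e \in E -> dot (g e) x <= (cx_height e)%:R.
  by move=> Ee; apply: (Px e); apply: (fintype.subsetP cE.1).
apply/eqP; rewrite eq_le Pd //= leNgt; apply/negP => lt.
move: h; rewrite leNgt dot_suml => /negP; apply.
rewrite (bigD1 d) //= [ltRHS](bigD1 d) //=; apply: ltr_leD.
  by rewrite dotZl ltr_pM2l // tp.
by apply: ler_sum => e /andP[Ee _]; rewrite dotZl ler_wpM2l // Pd.
Qed.

(* If [d] belonged to every maximal compatible set containing [E], then so
   would it to the ones whose vertex maximizes [m *: y - g d], [m] large; but
   the coordinate of that vector along [d] is negative. *)
Lemma avoid_chord E d : compat E -> d \in A -> d \notin E ->
  exists F, [/\ maximal_compat F, E \subset F & d \notin F].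
Proof.
move=> cE Ad nEd; apply: contrapT => no.
have all_d F : maximal_compat F -> E \subset F -> d \in F.
  by move=> mF EF; apply: contrapT => /negP nFd; apply: no; exists F.
have [F0 mF0 EF0] := compat_max cE.
pose y : V := \sum_(e in E) 1 *: g e.
have yE F : dot y (vertex F) = \sum_(e in E) dot (g e) (vertex F).
  by rewrite dot_suml; apply: eq_bigr => e _; rewrite scale1r.
pose D F := dot y (vertex F0) - dot y (vertex F).
pose num F := dot (g d) (vertex F0) - dot (g d) (vertex F).
(* Larger than [num F / D F] for each [F] at once; a set [F] missing part of [E] has [D F > 0] and
   then cannot beat [F0] on [m *: y - g d]. *)
pose m := 1 + \sum_(F : {set S}) `|num F| / `|D F|.
have [E3 [t [cE3 t0 _ ey]]] := cone_complete (m *: y - g d).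
have [F mF EF] := compat_max cE3.
have ub : dot (m *: y - g d) (vertex F0) <= dot (m *: y - g d) (vertex F).
  by rewrite ey (cone_vertex t mF EF); apply: cone_le => //; apply: vertex_facets.
have [EsF|nEsF] := boolP (E \subset F).
  have Fd := all_d F mF EsF.
  have := congr1 (dot^~ (c F d)) ey; rewrite /= dotBl dotZl !dot_suml.
  rewrite big1 => [|e Ee]; last first.
    rewrite scale1r (g_dual mF (fintype.subsetP EsF _ Ee) Fd).
    by case: eqP => // e_d; rewrite -e_d Ee in nEd.
  rewrite (g_dual mF) // eqxx mulr0 sub0r => e1.
  have : 0 <= \sum_(e in E3) dot (t e *: g e) (c F d).
    apply: sumr_ge0 => e E3e; rewrite dotZl (g_dual mF (fintype.subsetP EF _ E3e) Fd).
    by rewrite mulr_ge0 ?ler0n.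
  by rewrite -e1 oppr_ge0 ler10.
have D0 : 0 < D F.
  have [e Ee nFe] := fintype.subsetPn nEsF.
  have Ae := fintype.subsetP cE.1.
  rewrite /D !yE -sumrB (bigD1 e) //= ltr_wpDr //.
    apply: sumr_ge0 => f /andP[Ef _].
    rewrite (vertex_eq mF0 (fintype.subsetP EF0 _ Ef)) subr_ge0.
    by apply: (vertex_facets mF); apply: Ae.
  by rewrite (vertex_eq mF0 (fintype.subsetP EF0 _ Ee)) subr_gt0 vertex_lt // Ae.
have : m * D F <= num F by move: ub; rewrite !dotBl !dotZl /num /D; lra.
apply/negP; rewrite -ltNge.
have : `|num F| / D F <= \sum_(G : {set S}) `|num G| / `|D G|.
  rewrite (bigD1 F) //= (gtr0_norm D0) lerDl; apply: sumr_ge0 => G _.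
  by rewrite divr_ge0.
rewrite ler_pdivrMr // => h; have := ler_norm (num F); rewrite /m mulrDl mul1r; lra.
Qed.

(** A vector [z] of the normal cone lies in the cone of some compatible [E']. It is maximal at the
    vertex of every maximal [F] containing [E], which forces [E'] into each such [F], hence into [E]
    by [avoid_chord]. *)
Lemma normal_cone_eq E t : compat E -> (forall d, 0 <= t d) ->
  (forall d, d \in E -> 0 < t d) ->
  normal_cone facets (maximizers facets (\sum_(d in E) t d *: g d)) = cone E.
Proof.
move=> cE t0 tp; apply/seteqP; split=> [z hz|z [s s0 <-] x]; last first.
  move=> /(maximizers_cone _ cE t0 tp)[Px ex]; split=> // w Pw.
  apply: le_trans (cone_le cE s0 Pw) _.
  by rewrite dot_suml; apply: ler_sum => d Ed; rewrite dotZl ex.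
have [E' [s [cE' s0 sE' ez]]] := cone_complete z.
have sub F : maximal_compat F -> E \subset F -> E' \subset F.
  move=> mF EF; have : maximizers facets z (vertex F).
    apply: hz; apply/(maximizers_cone _ cE t0 tp); split; first exact: vertex_facets.
    by move=> d Ed; apply: vertex_eq => //; apply: (fintype.subsetP EF).
  rewrite ez => /(maximizers_cone _ cE' s0) []; first by move=> d; rewrite -sE'.
  move=> _ eF; apply/fintype.subsetP => d E'd; apply: contrapT => /negP nFd.
  by have := vertex_lt mF (fintype.subsetP cE'.1 _ E'd) nFd; rewrite eF // ltxx.
have E'E : E' \subset E.
  apply/fintype.subsetP => d E'd; apply: contrapT => /negP nEd.
  have [F [mF EF]] := avoid_chord cE (fintype.subsetP cE'.1 _ E'd) nEd.
  by rewrite (fintype.subsetP (sub F mF EF)).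
exists s => //; rewrite ez [LHS]big_mkcond [RHS]big_mkcond; apply: eq_bigr => d _.
case: (boolP (d \in E')) => [/(fintype.subsetP E'E) -> //|]; rewrite -sE' -leNgt => sd0.
by rewrite (le_anti (_ : s d <= 0 <= s d)) ?sd0 ?s0 // scale0r; case: ifP.
Qed.

Lemma normal_fan_facets : normal_fan facets = [set cone E | E in compat].
Proof.
apply/seteqP; split=> [_ [F [_ [y ->]] <-]|_ [E cE <-]].
  have [E [t [cE t0 tE ->]]] := cone_complete y.
  by exists E => //; rewrite normal_cone_eq // => d; rewrite tE.
pose y : V := \sum_(d in E) 1 *: g d.
exists (maximizers facets y); last by apply: normal_cone_eq.
split; last by exists y.
have [F mF EF] := compat_max cE; exists (vertex F).
apply/maximizers_cone => //; split; first exact: vertex_facets.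
by move=> d Ed; apply: vertex_eq => //; apply: (fintype.subsetP EF).
Qed.

End ResolutionFan.

(** * Plane geometry *)

Section Plane.
Context {R : realType}.
Local Notation plane := (R^o * R^o)%type.
Implicit Types x y z w : plane.

Definition mix (t : R) x y : plane := (1 - t) *: x + t *: y.

Lemma plane_ext x y : x.1 = y.1 -> x.2 = y.2 -> x = y.
Proof. by case: x y => [? ?] [? ?] /= -> ->. Qed.

Lemma mix1 t x y : (mix t x y).1 = (1 - t) * x.1 + t * y.1.
Proof. by []. Qed.

Lemma mix2 t x y : (mix t x y).2 = (1 - t) * x.2 + t * y.2.
Proof. by []. Qed.

Lemma mix_at0 x y : mix 0 x y = x.
Proof. by rewrite /mix subr0 scale1r scale0r addr0. Qed.

Lemma mix_at1 x y : mix 1 x y = y.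
Proof. by rewrite /mix subrr scale1r scale0r add0r. Qed.

Lemma convex_mix (C : set plane) x y t : convex_set C -> C x -> C y ->
  0 <= t <= 1 -> C (mix t x y).
Proof.
move=> /convex_setP cC Cx Cy /andP[t0 t1].
have := cC x y (1 - t) Cx Cy; rewrite subKr; apply.
by rewrite subr_ge0 t1 gerBl.
Qed.

Lemma convex_mixP (C : set plane) :
  (forall x y t, C x -> C y -> 0 <= t <= 1 -> C (mix t x y)) -> convex_set C.
Proof.
move=> cC; apply/convex_setP => x y t Cx Cy t01.
by have := cC y x t Cy Cx t01; rewrite /mix addrC.
Qed.

Lemma conv_hull_convex (W : lmodType R) (A : set W) : convex_set (conv_hull A).
Proof.
apply/convex_setP => x y t hx hy t01 C [cC AC].
by move/convex_setP: (cC); apply=> //; [apply: hx|apply: hy].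
Qed.

Lemma conv_hull2 x y : conv_hull [set x; y] = [set mix t x y | t in `[0, 1]].
Proof.
apply/seteqP; split.
  apply: smallest_sub => [|z [->|->]]; last 2 first.
  - by exists 0; rewrite ?mix_at0 //= in_itv /= lexx ler01.
  - by exists 1; rewrite ?mix_at1 //= in_itv /= lexx ler01.
  apply: convex_mixP => _ _ t [s + <-] [u + <-]; rewrite /= !in_itv /=.
  move=> /andP[s0 s1] /andP[u0 u1] /andP[t0 t1].
  exists ((1 - t) * s + t * u); first by rewrite /= in_itv /=; apply/andP; split; nra.
  by apply: plane_ext; rewrite !(mix1, mix2); ring.
move=> _ [t + <-]; rewrite /= in_itv /= => t01.
apply: convex_mix => //; first exact: conv_hull_convex.
  by apply: sub_gen_smallest; left.
by apply: sub_gen_smallest; right.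
Qed.

Lemma orientation_mix x y z w t :
  orientation x y (mix t z w) = (1 - t) * orientation x y z + t * orientation x y w.
Proof. by rewrite /orientation mix1 mix2; ring. Qed.

Lemma orientationC x y z : orientation y x z = - orientation x y z.
Proof. by rewrite /orientation; ring. Qed.

Lemma orientation_rot x y z : orientation y z x = orientation x y z.
Proof. by rewrite /orientation; ring. Qed.

Lemma orientation_l x y : orientation x y x = 0.
Proof. by rewrite /orientation; ring. Qed.

Lemma orientation_r x y : orientation x y y = 0.
Proof. by rewrite /orientation; ring. Qed.

Lemma fst_cont : continuous (fun z : plane => z.1).
Proof. by move=> z; apply: cvg_fst. Qed.

Lemma snd_cont : continuous (fun z : plane => z.2).
Proof. by move=> z; apply: cvg_snd. Qed.

Lemma orientation_continuous x y : continuous (fun z => orientation x y z : R).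
Proof.
pose f (z : plane) : R^o := (y.1 - x.1) * (z.2 - x.2).
pose g (z : plane) : R^o := (y.2 - x.2) * (z.1 - x.1).
have cf : continuous f.
  move=> z; apply: (@continuousM R plane (cst (y.1 - x.1)) (fun z => z.2 - x.2)).
    exact: cst_continuous.
  apply: (@continuousB R R^o plane snd (cst x.2)); last exact: cst_continuous.
  exact: snd_cont.
have cg : continuous g.
  move=> z; apply: (@continuousM R plane (cst (y.2 - x.2)) (fun z => z.1 - x.1)).
    exact: cst_continuous.
  apply: (@continuousB R R^o plane fst (cst x.1)); last exact: cst_continuous.
  exact: fst_cont.
by move=> z; apply: (@continuousB R R^o plane f g); [apply: cf|apply: cg].
Qed.

Definition disk : set plane := [set z | z.1 ^+ 2 + z.2 ^+ 2 <= 1].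

Lemma disk_convex : convex_set disk.
Proof.
apply: convex_mixP => x y t; rewrite /disk /= => hx hy /andP[t0 t1].
have h : 0 <= t * (1 - t) * ((x.1 - y.1) ^+ 2 + (x.2 - y.2) ^+ 2).
  by apply: mulr_ge0; [apply: mulr_ge0 => //; rewrite subr_ge0|apply: addr_ge0; apply: sqr_ge0].
have -> : ((1 - t) * x.1 + t * y.1) ^+ 2 + ((1 - t) * x.2 + t * y.2) ^+ 2 =
  (1 - t) * (x.1 ^+ 2 + x.2 ^+ 2) + t * (y.1 ^+ 2 + y.2 ^+ 2)
  - t * (1 - t) * ((x.1 - y.1) ^+ 2 + (x.2 - y.2) ^+ 2) by ring.
have : (1 - t) * (x.1 ^+ 2 + x.2 ^+ 2) <= (1 - t) * 1 by rewrite ler_wpM2l // subr_ge0.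
have : t * (y.1 ^+ 2 + y.2 ^+ 2) <= t * 1 by rewrite ler_wpM2l.
by rewrite /=; lra.
Qed.

Lemma disk_closed : closed disk.
Proof.
have : continuous (fun z : plane => (z.1 * z.1 + z.2 * z.2 : R)).
  move=> z; apply: (@continuousD R R^o plane (fun z => z.1 * z.1) (fun z => z.2 * z.2)).
    by apply: (@continuousM R plane fst fst); apply: fst_cont.
  by apply: (@continuousM R plane snd snd); apply: snd_cont.
move/continuous_closedP => /(_ [set x : R | x <= 1] (@closed_le R 1)).
by congr closed; apply/seteqP; split => z; rewrite /disk /= !expr2.
Qed.

(** A chord of the circle is thus cut out by one equation inside the disk. With [t] the projection
    parameter, [t * (1 - t) * q] is [1] minus the squared norm of [z], so the disk condition bounds
    [t]. *)
Lemma line_disk x y z : x <> y -> x.1 ^+ 2 + x.2 ^+ 2 = 1 -> y.1 ^+ 2 + y.2 ^+ 2 = 1 ->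
  disk z -> orientation x y z = 0 -> exists2 t, 0 <= t <= 1 & z = mix t x y.
Proof.
move=> nxy hx hy; rewrite /disk /orientation /= => hz o0.
have q0 : 0 < (y.1 - x.1) ^+ 2 + (y.2 - x.2) ^+ 2.
  rewrite lt0r addr_ge0 ?sqr_ge0 // andbT; apply: contra_notN nxy.
  rewrite paddr_eq0 ?sqr_ge0 // !sqrf_eq0 !subr_eq0 => /andP[/eqP e1 /eqP e2].
  exact: plane_ext.
set q := _ + _ in q0.
pose t := ((z.1 - x.1) * (y.1 - x.1) + (z.2 - x.2) * (y.2 - x.2)) / q.
have tq : t * q = (z.1 - x.1) * (y.1 - x.1) + (z.2 - x.2) * (y.2 - x.2).
  by rewrite divfK // gt_eqF.
have e1 : t * (y.1 - x.1) = z.1 - x.1.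
  apply: (mulIf (negbT (gt_eqF q0))); rewrite mulrAC tq; apply/eqP; rewrite -subr_eq0.
  rewrite (_ : _ - _ = (y.2 - x.2) *
    ((y.1 - x.1) * (z.2 - x.2) - (y.2 - x.2) * (z.1 - x.1))); last by rewrite /q; ring.
  by rewrite o0 mulr0.
have e2 : t * (y.2 - x.2) = z.2 - x.2.
  apply: (mulIf (negbT (gt_eqF q0))); rewrite mulrAC tq; apply/eqP; rewrite -subr_eq0.
  rewrite (_ : _ - _ = - (y.1 - x.1) *
    ((y.1 - x.1) * (z.2 - x.2) - (y.2 - x.2) * (z.1 - x.1))); last by rewrite /q; ring.
  by rewrite o0 mulr0.
have z1 : z.1 = (1 - t) * x.1 + t * y.1.
  by rewrite -[LHS](subrK x.1) -e1; ring.
have z2 : z.2 = (1 - t) * x.2 + t * y.2.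
  by rewrite -[LHS](subrK x.2) -e2; ring.
exists t; last exact: plane_ext.
have : t * (1 - t) * q >= 0.
  have : z.1 ^+ 2 + z.2 ^+ 2 = (1 - t) * (x.1 ^+ 2 + x.2 ^+ 2) +
      t * (y.1 ^+ 2 + y.2 ^+ 2) - t * (1 - t) * q by rewrite z1 z2 /q; ring.
  by rewrite hx hy; lra.
rewrite pmulr_lge0 // => h.
by apply/andP; split; rewrite leNgt; apply/negP => lt; move: h lt; nra.
Qed.

Lemma mix_continuous x y : continuous (fun t : R => mix t x y).
Proof.
move=> t; apply: (@continuousD R plane R (fun t => (1 - t) *: x) (fun t => t *: y)).
  apply: continuousZr_tmp; apply: (@continuousB R R^o R (cst 1) id); last by [].
  exact: cst_continuous.
exact: scalel_continuous.
Qed.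

Lemma seg_connected x y : connected [set mix t x y | t in `[0, 1]].
Proof.
apply: connected_continuous_connected; first exact: segment_connected.
exact/continuous_subspaceT/mix_continuous.
Qed.

Lemma convex_component (A C : set plane) z : convex_set C -> C `<=` A -> C z ->
  C `<=` connected_component A z.
Proof.
move=> cC CA Cz w Cw; exists [set mix t z w | t in `[0, 1]].
  split; last exact: seg_connected.
    by exists 0; rewrite ?mix_at0 //= in_itv /= lexx ler01.
  by move=> _ [t + <-]; rewrite /= in_itv /= => t01; apply: CA; apply: convex_mix.
by exists 1; rewrite ?mix_at1 //= in_itv /= lexx ler01.
Qed.

Lemma closure_mix (C : set plane) z w :
  (forall t, 0 < t <= 1 -> C (mix t z w)) -> closure C z.
Proof.
move=> hC B Bz.
have : nbhs (0 : R) ((fun t => mix t z w) @^-1` B).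
  by apply: mix_continuous; rewrite mix_at0.
move=> /nbhs_ballP[e /= e0 he].
pose t := Num.min (e / 2) 1.
have t0 : 0 < t by rewrite lt_min ltr01 divr_gt0.
exists (mix t z w); split; first by apply: hC; rewrite t0 ge_min lexx orbT.
apply: he; rewrite /ball /= sub0r normrN gtr0_norm // gt_min; apply/orP; left.
by rewrite ltr_pdivrMr // ltr_pMr // ltr1n.
Qed.

Lemma boxed_nbhs (B : set plane) z : nbhs z B -> exists2 e : R, 0 < e &
  forall w, `|w.1 - z.1| < e -> `|w.2 - z.2| < e -> B w.
Proof.
move=> /nbhs_ballP[e /= e0 he]; exists e => // w h1 h2.
by apply: he; split; rewrite /ball /= distrC.
Qed.

End Plane.

(** * Points on the circle: sides of chords and crossings *)

Section Circle.
Context {R : realType} {n : nat}.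
Local Notation plane := (R^o * R^o)%type.
Variable pt : 'I_(n.*2) -> plane.
Hypothesis n2 : (2 <= n)%N.
Hypothesis hpt : clockwise_on_circle pt.
Implicit Types (i j k l p q r u v x y a b : 'I_(n.*2)) (z w : plane).
Local Notation side i j z := (orientation (pt i) (pt j) z).

(** With the half-differences [s] and [t] of the angles, the orientation is
    [- 4 sin s sin t sin (s + t)], and [s], [t], [s + t] all lie strictly between [0] and [pi]. *)
Lemma circle_orientation (a b c : R) : b < a -> c < b -> a - c < 2 * pi ->
  orientation (cos a, sin a) (cos b, sin b) (cos c, sin c) < 0 :> R.
Proof.
move=> ab bc ac; pose s := (a - b) / 2; pose t := (b - c) / 2.
have ea : a = c + (t + t) + (s + s) by rewrite /s /t; field.
have eb : b = c + (t + t) by rewrite /t; field.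
have hs : 0 < sin s by apply: sin_gt0_pi; rewrite /s; apply/andP; split; lra.
have ht : 0 < sin t by apply: sin_gt0_pi; rewrite /t; apply/andP; split; lra.
have hst : 0 < sin (s + t) by apply: sin_gt0_pi; rewrite /s /t; apply/andP; split; lra.
have -> : orientation (cos a, sin a) (cos b, sin b) (cos c, sin c) =
    - (4 * sin s * sin t * sin (s + t)) :> R.
  have -> : orientation (cos a, sin a) (cos b, sin b) (cos c, sin c) =
      sin (a - c) - sin (a - b) - sin (b - c).
    by rewrite /orientation /= !sinB; ring.
  have -> : a - c = (t + t) + (s + s) by rewrite ea; ring.
  have -> : a - b = s + s by rewrite ea eb; ring.
  have -> : b - c = t + t by rewrite eb; ring.
  rewrite !(sinD, cosD).
  apply/eqP; rewrite -subr_eq0; apply/eqP.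
  transitivity (2 * sin s * cos s * (cos t ^+ 2 + sin t ^+ 2 - 1) +
    2 * sin t * cos t * (cos s ^+ 2 + sin s ^+ 2 - 1)); first by ring.
  by rewrite !cos2Dsin2; ring.
by rewrite oppr_lt0 !mulr_gt0.
Qed.

Lemma side_lt0 i j k : cyc i j k -> side i j (pt k) < 0.
Proof.
have [theta [ept dec bnd]] := hpt.
have lt0 i' j' k' : (i' < j')%N -> (j' < k')%N -> side i' j' (pt k') < 0.
  move=> ij jk; rewrite !ept; apply: circle_orientation; rewrite ?dec //.
case/or3P => /andP[h1 h2]; first exact: lt0.
  by rewrite -orientation_rot; apply: lt0.
by rewrite -orientation_rot -orientation_rot; apply: lt0.
Qed.

Lemma side_gt0 i j k : cyc i k j -> 0 < side i j (pt k).
Proof.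
move=> h; rewrite -oppr_lt0 -orientationC; apply: side_lt0; move: h; cyco.
Qed.

Lemma side_l i j : side i j (pt i) = 0. Proof. exact: orientation_l. Qed.
Lemma side_r i j : side i j (pt j) = 0. Proof. exact: orientation_r. Qed.

Lemma label_cases i j k : i != j -> [|| k == i, k == j, cyc i j k | cyc i k j].
Proof. by cyco. Qed.

Lemma side_le0 i j k : i != j -> ~~ cyc i k j -> side i j (pt k) <= 0.
Proof.
move=> nij; case/or4P: (label_cases k nij) => [/eqP->|/eqP->|h|->//] _.
- by rewrite side_l.
- by rewrite side_r.
- exact/ltW/side_lt0.
Qed.

Lemma side_ge0 i j k : i != j -> ~~ cyc i j k -> 0 <= side i j (pt k).
Proof.
move=> nij h; rewrite -oppr_le0 -orientationC; apply: side_le0.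
  by rewrite eq_sym.
by move: h; cyco.
Qed.

Lemma pt_disk i : (pt i).1 ^+ 2 + (pt i).2 ^+ 2 = 1.
Proof. by have [theta [-> _ _]] := hpt; apply: cos2Dsin2. Qed.

Lemma disk_pt i : disk (pt i).
Proof. by rewrite /disk /= pt_disk. Qed.

Lemma third_label i j : exists k, (k != i) && (k != j).
Proof.
have : (2 < #|'I_(n.*2)|)%N by rewrite card_ord; lia.
move=> h; have : exists k, k \notin [set i; j]%SET.
  apply/existsP; apply: contraTT h; rewrite negb_exists => /forallP all.
  have /subset_leq_card : [set: 'I_(n.*2)]%SET \subset [set i; j]%SET.
    by apply/fintype.subsetP => k _; have := all k; rewrite negbK.
  by rewrite cardsT cards2 -leqNgt => h; apply: leq_trans h _; case: (i != j).
by case=> k; rewrite !inE negb_or; exists k.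
Qed.

Lemma pt_neq i j : i != j -> pt i <> pt j.
Proof.
move=> nij e; have [k /andP[ki kj]] := third_label i j.
have := label_cases k nij; rewrite (negPf ki) (negPf kj) /= => /orP[/side_lt0|/side_gt0];
  by rewrite e /orientation !subrr !mul0r subrr ltxx.
Qed.

Lemma segE i j : seg pt [set i; j]%SET = [set mix t (pt i) (pt j) | t in `[0, 1]].
Proof.
rewrite /seg -conv_hull2; congr conv_hull; apply/seteqP; split=> [_ [k + <-]|z [->|->]].
- by rewrite /= !inE => /orP[/eqP->|/eqP->]; [left|right].
- by exists i => //; rewrite /= !inE eqxx.
- by exists j => //; rewrite /= !inE eqxx orbT.
Qed.

Lemma seg_disk_line i j : i != j ->
  seg pt [set i; j]%SET = [set z | disk z /\ side i j z = 0].
Proof.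
move=> nij; rewrite segE; apply/seteqP; split=> [_ [t + <-]|z [dz oz]].
  rewrite /= in_itv /= => t01; split.
    by apply: convex_mix => //; [apply: disk_convex|apply: disk_pt|apply: disk_pt].
  by rewrite orientation_mix side_l side_r !mulr0 addr0.
have [t t01 ->] := line_disk (pt_neq nij) (pt_disk i) (pt_disk j) dz oz.
by exists t => //; rewrite /= in_itv.
Qed.

Lemma seg_side i j z : i != j -> seg pt [set i; j]%SET z -> side i j z = 0.
Proof. by move=> nij; rewrite seg_disk_line // => -[]. Qed.

Lemma seg_closed i j : i != j -> closed (seg pt [set i; j]%SET).
Proof.
move=> nij; rewrite seg_disk_line //.
have /continuous_closedP/(_ [set x : R | x = 0] (@closed_eq R 0)) :=
  @orientation_continuous R (pt i) (pt j).
by move=> c; apply: (@closedI _ disk _ disk_closed c).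
Qed.

Lemma seg_end_l i j : seg pt [set i; j]%SET (pt i).
Proof. by rewrite segE; exists 0; rewrite ?mix_at0 //= in_itv /= lexx ler01. Qed.

Lemma seg_end_r i j : seg pt [set i; j]%SET (pt j).
Proof. by rewrite finset.setUC; apply: seg_end_l. Qed.

Lemma seg_convex d : convex_set (seg pt d).
Proof. exact: conv_hull_convex. Qed.

(** Both ends of [kl] lie weakly on one side of [ij] and at least one strictly, so interior points
    of [kl] are strictly on that side. *)
Lemma side_open i j k l (t : R) : i != j -> k != l -> [set k; l]%SET != [set i; j]%SET ->
  ~~ xc [set k; l] [set i; j] -> 0 < t < 1 -> side i j (mix t (pt k) (pt l)) != 0.
Proof.
move=> nij nkl ne nx /andP[t0 t1]; rewrite orientation_mix.
have t1' : 0 < 1 - t by rewrite subr_gt0.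
have strict : ~~ ((k == i) || (k == j)) || ~~ ((l == i) || (l == j)).
  by move: ne nkl; rewrite set2_eq; cyco.
case: (boolP (~~ cyc i k j && ~~ cyc i l j)) => [/andP[h1 h2]|h].
  have k0 := side_le0 nij h1; have l0 := side_le0 nij h2; rewrite lt_eqF //.
  case/orP: strict => s.
    have : side i j (pt k) < 0 by apply: side_lt0; move: s h1 nij; cyco.
    nra.
  have : side i j (pt l) < 0 by apply: side_lt0; move: s h2 nij; cyco.
  nra.
have h1 : ~~ cyc i j k by move: h nx nkl nij; rewrite xcE; cyco.
have h2 : ~~ cyc i j l by move: h nx nkl nij; rewrite xcE; cyco.
have k0 := side_ge0 nij h1; have l0 := side_ge0 nij h2; rewrite gt_eqF //.
case/orP: strict => s.
  have : 0 < side i j (pt k) by apply: side_gt0; move: s h1 nij; cyco.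
  nra.
have : 0 < side i j (pt l) by apply: side_gt0; move: s h2 nij; cyco.
nra.
Qed.

Lemma open_seg_mix k l z : open_seg pt [set k; l]%SET z ->
  exists2 t, 0 < t < 1 & z = mix t (pt k) (pt l).
Proof.
move=> [+ nz]; rewrite segE => -[t + e]; rewrite /= in_itv /= => /andP[t0 t1].
exists t; last by [].
rewrite !lt_neqAle t0 t1 !andbT; apply/andP; split; apply/eqP => et; apply: nz.
  by exists k; [rewrite /= !inE eqxx|rewrite -e -et mix_at0].
by exists l; [rewrite /= !inE eqxx orbT|rewrite -e et mix_at1].
Qed.

Lemma crossesP i j k l : i != j -> k != l ->
  crosses pt [set i; j]%SET [set k; l]%SET <-> xc [set i; j] [set k; l].
Proof.
move=> nij nkl; split=> [[ne [z [oz1 oz2]]]|].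
  apply: contrapT => /negP nx; have [t t01 ez] := open_seg_mix oz1.
  have := side_open nkl nij ne nx t01; rewrite -ez.
  by rewrite (seg_side nkl oz2.1) eqxx.
move=> hx; have ne : [set i; j]%SET != [set k; l]%SET.
  by move: hx; rewrite xcE set2_eq; cyco.
split=> //; wlog cr : k l nkl hx ne / crs i j k l => [th|].
  have /orP[h|h] : crs i j k l || crs i j l k by move: hx; rewrite xcE; cyco.
    exact: th.
  have e : [set k; l]%SET = [set l; k]%SET by rewrite finset.setUC.
  by rewrite e in hx ne *; apply: th => //; rewrite eq_sym.
have hk : 0 < side i j (pt k) by apply: side_gt0; move: cr; cyco.
have hl : side i j (pt l) < 0 by apply: side_lt0; move: cr; cyco.
have hi : side k l (pt i) != 0 by rewrite lt_eqF // side_lt0 //; move: cr; cyco.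
have hj : side k l (pt j) != 0 by rewrite gt_eqF // side_gt0 //; move: cr; cyco.
(* The parameter where [kl] meets the line of [ij], as [side i j] is affine along [kl]. That the
   point is on the segment [ij] follows from its being in the disk. *)
pose t := side i j (pt k) / (side i j (pt k) - side i j (pt l)).
have dpos : 0 < side i j (pt k) - side i j (pt l) by lra.
have t0 : 0 < t by rewrite divr_gt0.
have t1 : t < 1 by rewrite ltr_pdivrMr // mul1r; lra.
pose z := mix t (pt k) (pt l).
have t01 : 0 <= t <= 1 by rewrite !ltW.
have zkl : seg pt [set k; l]%SET z by rewrite segE; exists t => //; rewrite /= in_itv.
have oz : side i j z = 0.
  rewrite orientation_mix /t; field; by rewrite gt_eqF.
have dz : disk z by move: zkl; rewrite seg_disk_line // => -[].
have okl := seg_side nkl zkl.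
exists z; split; split=> //; first by rewrite seg_disk_line.
  move=> [m + em]; rewrite /= !inE => /orP[/eqP e|/eqP e]; move: okl; rewrite -em e => /eqP.
    by rewrite (negPf hi).
  by rewrite (negPf hj).
move=> [m + em]; rewrite /= !inE => /orP[/eqP e|/eqP e]; move: oz; rewrite -em e => /eqP.
  by rewrite gt_eqF.
by rewrite lt_eqF.
Qed.

End Circle.

(** * Edges and ears *)

Section Labels.
Local Open Scope nat_scope.
Variable n : nat.
Hypothesis n2 : (2 <= n)%N.
Implicit Types (i j k l p q r u v x y a b t : 'I_(n.*2)) (c : color).

Lemma diagonalsE p q c :
  ([set p; q]%SET \in diagonals n c) = [&& p != q, odd p == c & odd q == c].
Proof.
rewrite inE cards2; case: (p != q) => //=; apply/forallP/andP => [h|[h1 h2] i].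
  by split; [have := h p|have := h q]; rewrite !inE eqxx ?orbT.
by rewrite !inE; apply/implyP => /orP[/eqP->|/eqP->].
Qed.

Lemma diagonalsP d c : d \in diagonals n c ->
  exists p q, [/\ d = [set p; q]%SET, p != q, odd p == c & odd q == c].
Proof.
move=> Dd; have /cards2P[p [q [npq e]]] : #|d| == 2%N.
  by move: Dd; rewrite inE => /andP[].
exists p, q; move: Dd; rewrite e diagonalsE => /and3P[h1 h2 h3]; by split.
Qed.

Lemma mod_add2 p q : (q == p + 2 %[mod n.*2])%N = (q == p + 2 :> nat) || (q + n.*2 == p + 2)%N.
Proof.
have hq := ltn_ord q; have hp := ltn_ord p.
rewrite [(q %% _)%N]modn_small //; case: (ltnP (p + 2) n.*2) => h.
  by rewrite modn_small //; lia.
rewrite -{1}(subnK h) modnDr modn_small; lia.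
Qed.

Lemma edgesE p q c : ([set p; q]%SET \in edges n c) =
  ([set p; q]%SET \in diagonals n c) && ((q == p + 2 %[mod n.*2])%N || (p == q + 2 %[mod n.*2])%N).
Proof.
rewrite [LHS]inE; apply: andb_id2l => _; apply/existsP/idP.
  move=> [i /andP[hi /existsP[j /andP[hj e]]]]; move: hi hj e; rewrite !inE.
  do 2 case/orP => /eqP->; rewrite ?mod_add2; lia.
case/orP => e; [exists p|exists q]; rewrite !inE eqxx ?orbT /=; apply/existsP;
  [exists q|exists p]; rewrite !inE eqxx ?orbT //.
Qed.

Lemma next_label a : exists l, (l == a.+1 :> nat) || (a.+1 == n.*2) && (l == 0 :> nat).
Proof.
have h := ltn_ord a; case: (ltnP a.+1 n.*2) => h'.
  by exists (Ordinal h'); rewrite /= eqxx.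
have h0 : (0 < n.*2)%N by lia.
by exists (Ordinal h0) => /=; lia.
Qed.

Lemma prev_label a : exists r, (r.+1 == a) || (a == 0 :> nat) && (r.+1 == n.*2).
Proof.
have h := ltn_ord a; case: (posnP a) => h'.
  have h0 : ((n.*2).-1 < n.*2)%N by lia.
  by exists (Ordinal h0) => /=; lia.
have h0 : (a.-1 < n.*2)%N by lia.
by exists (Ordinal h0) => /=; lia.
Qed.

Lemma next_cycw a l i : (l == a.+1 :> nat) || (a.+1 == n.*2) && (l == 0 :> nat) ->
  i != a -> cycw a l i.
Proof.
have := ltn_ord a; have := ltn_ord i; have := ltn_ord l.
by rewrite /cycw /cyc -val_eqE /=; lia.
Qed.

Lemma prev_cycw a r i : (r.+1 == a) || (a == 0 :> nat) && (r.+1 == n.*2) ->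
  i != a -> cycw a i r.
Proof.
have := ltn_ord a; have := ltn_ord i; have := ltn_ord r.
by rewrite /cycw /cyc -val_eqE /=; lia.
Qed.

Lemma next_prev_mod a l r : (l == a.+1 :> nat) || (a.+1 == n.*2) && (l == 0 :> nat) ->
  (r.+1 == a) || (a == 0 :> nat) && (r.+1 == n.*2) -> (l == r + 2 %[mod n.*2])%N.
Proof.
by rewrite mod_add2; have := ltn_ord a; have := ltn_ord l; have := ltn_ord r; lia.
Qed.

Lemma ear_edge t p q c : [set p; q]%SET \in diagonals n c -> ear t p q ->
  [set p; q]%SET \in edges n c.
Proof.
move=> D E; have [l hl] := next_label t; have [r hr] := prev_label t.
have lt : l != t by rewrite -val_eqE /=; have := ltn_ord t; lia.
have rt : r != t by rewrite -val_eqE /=; have := ltn_ord t; lia.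
have npq : p != q by move: D; rewrite diagonalsE => /and3P[].
have pl : p = l.
  apply/eqP; move: (earP E lt) (earP E rt).
  have [pt|/(next_cycw hl)] := eqVneq p t; last by move: lt rt; cyco.
  by move: npq lt rt; rewrite pt; cyco.
have qr : q = r.
  apply/eqP; move: (earP E lt) (earP E rt).
  have [pt|/(prev_cycw hr)] := eqVneq q t; last by move: lt rt; cyco.
  by move: npq lt rt; rewrite pt; cyco.
by rewrite edgesE D pl qr (next_prev_mod hl hr) orbT.
Qed.

(** On one side an edge cuts off a single label, and it has the other color. *)
Lemma edge_nc p q x y : (q == p + 2 %[mod n.*2])%N || (p == q + 2 %[mod n.*2])%N ->
  odd p = odd q -> odd x = odd p -> odd y = odd p -> ~~ (cyc p x q && cyc q y p).
Proof.
rewrite !mod_add2 /cyc => h hq hx hy; apply/negP.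
have := ltn_ord p; have := ltn_ord q; have := ltn_ord x; have := ltn_ord y.
by move: h hq hx hy; lia.
Qed.

End Labels.

(** * Dissections as chord relations, and connectedness as absence of gaps *)

Section Dissection.
Context {R : realType} {n : nat}.
Local Notation plane := (R^o * R^o)%type.
Variable pt : 'I_(n.*2) -> plane.
Hypothesis n2 : (2 <= n)%N.
Hypothesis hpt : clockwise_on_circle pt.
Implicit Types (i j k l p q r u v x y a b t : 'I_(n.*2)) (z w : plane).
Implicit Types (c : color) (E : {set segment n}).
Local Notation side i j z := (orientation (pt i) (pt j) z).

Definition chord c E : rel 'I_(n.*2) := fun p q => [set p; q]%SET \in with_edges c E.

Lemma chord_diag c E p q : E \subset internal_diagonals n c -> chord c E p q ->
  [set p; q]%SET \in diagonals n c.
Proof.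
move=> sub; rewrite /chord inE => /orP[/(fintype.subsetP sub)|]; rewrite inE => /andP[//].
Qed.

Lemma with_edgesP c E d : E \subset internal_diagonals n c -> d \in with_edges c E ->
  exists p q, d = [set p; q]%SET /\ chord c E p q.
Proof.
move=> sub Ed; have : d \in diagonals n c.
  by move: Ed; rewrite inE => /orP[/(fintype.subsetP sub)|]; rewrite inE => /andP[].
by move=> /diagonalsP[p [q [e _ _ _]]]; exists p, q; rewrite /chord -e.
Qed.

Lemma diss_chord c E : E \subset internal_diagonals n c ->
  {in E &, forall d e, ~~ xc d e} -> diss (fun i => odd i == c) (chord c E).
Proof.
move=> sub nc; have sym p q : chord c E p q -> chord c E q p.
  by rewrite /chord finset.setUC.
have col p q : chord c E p q -> [&& p != q, odd p == c & odd q == c].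
  by move=> /(chord_diag sub); rewrite diagonalsE.
split=> //.
- by move=> p q /col /and3P[-> -> ->].
- move=> p q x y Hpq Hxy; have /and3P[npq /eqP cp /eqP cq] := col _ _ Hpq.
  have /and3P[nxy /eqP cx /eqP cy] := col _ _ Hxy.
  move: (Hpq); rewrite /chord inE => /orP[Epq|]; last first.
    by rewrite edgesE // => /andP[_ h]; apply: edge_nc => //; congruence.
  move: (Hxy); rewrite /chord inE => /orP[Exy|]; last first.
    rewrite edgesE // => /andP[_ h]; apply/negP => /andP[h1 h2].
    have : ~~ (cyc x p y && cyc y q x) by apply: edge_nc => //; congruence.
    have : ~~ (cyc x q y && cyc y p x) by apply: edge_nc => //; congruence.
    by move: h1 h2 nxy; cyco.
  by have := nc _ _ Epq Exy; rewrite xcE; cyco.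
- move=> a ca; have [l hl] := next_label n2 a; have [r hr] := prev_label n2 a.
  exists l, r; split; last by move=> i ni; rewrite (next_cycw n2 hl ni) (prev_cycw n2 hr ni).
  rewrite /chord inE edgesE // (next_prev_mod n2 hl hr) orbT andbT diagonalsE.
  apply/orP; right; rewrite -val_eqE /=.
  have := ltn_ord a; have := ltn_ord l; have := ltn_ord r; move: hl hr ca => hl hr ca h1 h2 h3.
  have pl : odd l = ~~ odd a by move: hl; clear -n2 h3; lia.
  have pr : odd r = ~~ odd a by move: hr; clear -n2 h3; lia.
  have pc : ~~ odd a == c by move: ca; case: (odd a); case: (c).
  by rewrite pl pr pc !andbT; clear -n2 hl hr h1 h2 h3; lia.
Qed.

Lemma internal_not_ear c p q t : [set p; q]%SET \in internal_diagonals n c -> ~~ ear t p q.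
Proof.
by rewrite inE => /andP[ne D]; apply: contra ne => /(ear_edge n2 D).
Qed.

Section Accordion.
Variables (c : color) (E : {set segment n}).
Hypothesis sub : E \subset internal_diagonals n c.
Hypothesis dH : diss (fun i => odd i == c) (chord c E).
Local Notation H := (chord c E).

Lemma chord_neq p q : H p q -> p != q.
Proof. by move/(diss_col dH) => /and3P[]. Qed.

Lemma seg_disjoint p q x y : H p q -> H x y -> x != p -> x != q -> y != p -> y != q ->
  seg pt [set p; q]%SET `&` seg pt [set x; y]%SET = set0.
Proof.
move=> Hpq Hxy n1 n3 n4 n5; have npq := chord_neq Hpq; have nxy := chord_neq Hxy.
rewrite -subset0 => z [zpq]; rewrite segE => -[t + e]; rewrite /= in_itv /= => /andP[t0 t1].
have o0 := seg_side n2 hpt npq zpq.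
have nx : ~~ xc [set x; y] [set p; q].
  by rewrite xcE; move: (diss_nc dH Hpq Hxy) (diss_nc dH Hpq (diss_sym dH Hxy)); cyco.
have nz k : k != p -> k != q -> side p q (pt k) != 0.
  move=> kp kq; have := label_cases k npq; rewrite (negPf kp) (negPf kq) /= => /orP[h|h].
    by rewrite lt_eqF // side_lt0.
  by rewrite gt_eqF // side_gt0.
have [et|nt0] := eqVneq t 0.
  by have := nz x n1 n3; rewrite (_ : pt x = z) ?o0 ?eqxx // -e et mix_at0.
have [et|nt1] := eqVneq t 1.
  by have := nz y n4 n5; rewrite (_ : pt y = z) ?o0 ?eqxx // -e et mix_at1.
have ne : [set x; y]%SET != [set p; q]%SET by rewrite set2_eq; move: n1 n3 n4 n5; cyco.
have t01 : 0 < t < 1 by rewrite !lt_neqAle t0 t1 eq_sym nt0 nt1.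
by have := side_open hpt npq nxy ne nx t01; rewrite e o0 eqxx.
Qed.

Lemma crossed_chordP a b d : a != b ->
  (d \in with_edges c E /\ crosses pt [set a; b]%SET d) <->
  exists p q, [/\ d = [set p; q]%SET, H p q & crs a b p q].
Proof.
move=> nab; split=> [[Ed cr]|[p [q [-> Hpq cr]]]]; last first.
  split=> //; apply/(crossesP n2 hpt nab (chord_neq Hpq)).
  by rewrite xcE; move: cr; cyco.
have [p [q [e Hpq]]] := with_edgesP sub Ed; rewrite e in cr *.
move/(crossesP n2 hpt nab (chord_neq Hpq)): cr; rewrite xcE => cr.
have /orP[h|h] : crs a b p q || crs a b q p by move: cr; cyco.
  by exists p, q.
by exists q, p; rewrite finset.setUC (diss_sym dH Hpq).
Qed.

(** A gap between [pq] and [xy] splits the crossed chords into those before and those after it, two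
    disjoint finite unions of closed segments. Without gaps, each crossed chord shares an endpoint
    with one nearer to [a], down to the side cutting off [a]. *)
Lemma accordionP a b : a != b -> odd a != c -> odd b != c ->
  connected (\bigcup_(e in [set e | e \in with_edges c E /\ crosses pt [set a; b]%SET e])
    seg pt e) <-> acc H a b.
Proof.
move=> nab ca cb; set A := \bigcup_(e in _) _.
have inA p q : H p q -> crs a b p q -> seg pt [set p; q]%SET `<=` A.
  move=> Hpq cr z hz; exists [set p; q]%SET => //.
  by apply/(crossed_chordP _ nab); exists p, q.
split=> [cA p q x y Hpq Hxy c1 c2 px yq|hacc].
  apply: contrapT => no.
  pose L := [set d | exists r s, [/\ d = [set r; s]%SET, H r s, crs a b r s &
    cycw a r p && cycw a q s]].
  pose U := [set d | exists r s, [/\ d = [set r; s]%SET, H r s, crs a b r s &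
    cycw a x r && cycw a s y]].
  have cl (X : set (segment n)) :
      (forall d, X d -> exists r s, d = [set r; s]%SET /\ H r s) ->
      closed (\bigcup_(d in X) seg pt d).
    move=> hX; apply: closed_bigcup; first exact: finite_finset.
    by move=> d /hX[r [s [-> /chord_neq nrs]]]; apply: seg_closed.
  have clL : closed (\bigcup_(d in L) seg pt d).
    by apply: cl => d [r [s [e Hrs _ _]]]; exists r, s.
  have clU : closed (\bigcup_(d in U) seg pt d).
    by apply: cl => d [r [s [e Hrs _ _]]]; exists r, s.
  have LU z : (\bigcup_(d in L) seg pt d) z -> ~ (\bigcup_(d in U) seg pt d) z.
    move=> [d [r [s [-> Hrs crs1 o1]]] z1] [e [r' [s' [-> Hrs' crs2 o2]]] z2].
    have : (seg pt [set r; s]%SET `&` seg pt [set r'; s']%SET) z by split.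
    rewrite seg_disjoint //; first [by move: crs1 crs2 o1 o2 px yq c1 c2; cyco].
  have AE z : A z -> (\bigcup_(d in L) seg pt d) z \/ (\bigcup_(d in U) seg pt d) z.
    move=> [d /(crossed_chordP _ nab)[r [s [-> Hrs cr]]] hz].
    have [k1|no1] := boolP (cycw a r p && cycw a q s).
      by left; exists [set r; s]%SET => //; exists r, s.
    have [k1|no2] := boolP (cycw a x r && cycw a s y).
      by right; exists [set r; s]%SET => //; exists r, s.
    exfalso; apply: no; exists r, s; split=> //.
    have := chain dH Hrs Hpq cr c1; have := chain dH Hrs Hxy cr c2.
    by move: c1 c2 px yq cr no1 no2; cyco.
  have LA z : (\bigcup_(d in L) seg pt d) z -> A z.
    by move=> [d [r [s [-> Hrs cr _]]] hz]; apply: inA hz.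
  have Lp : (\bigcup_(d in L) seg pt d) (pt p).
    exists [set p; q]%SET; last exact: seg_end_l.
    by exists p, q; split=> //; rewrite /cycw !eqxx.
  have eLA : \bigcup_(d in L) seg pt d = A.
    apply: cA; first by exists (pt p).
    - exists (~` (\bigcup_(d in U) seg pt d)); first exact: closed_openC.
      apply/seteqP; split=> [z hz|z [/AE[//|hU nU]]]; last by case: nU.
      by split; [apply: LA|apply: LU].
    - exists (\bigcup_(d in L) seg pt d) => //.
      by apply/seteqP; split=> [z hz|z []//]; split=> //; apply: LA.
  have Ax : A (pt x) by apply: (inA x y) => //; apply: seg_end_l.
  rewrite -eLA in Ax; apply: (LU _ Ax).
  exists [set x; y]%SET; last exact: seg_end_l.
  by exists x, y; split=> //; rewrite /cycw !eqxx.
have [l [r [Hlr lr]]] := diss_ear dH ca.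
have ne t x : odd t != c -> odd x == c -> x != t.
  by move=> h; apply: contraTN => /eqP ->.
have /and3P[cl cr nlr] := diss_col dH Hlr.
have clr : crs a b l r.
  have /lr : b != a by rewrite eq_sym.
  by move: nab nlr (ne _ _ ca cl) (ne _ _ cb cl) (ne _ _ ca cr) (ne _ _ cb cr); cyco.
suff all_in : forall p q, H p q -> crs a b p q ->
    seg pt [set p; q]%SET `<=` connected_component A (pt l).
  suff -> : A = connected_component A (pt l) by apply: component_connected.
  apply/seteqP; split; last exact: connected_component_sub.
  by move=> z [d /(crossed_chordP _ nab)[p [q [-> Hpq cpq]]] hz]; apply: all_in hz.
have cseg p q z : H p q -> crs a b p q -> seg pt [set p; q]%SET z ->
    seg pt [set p; q]%SET `<=` connected_component A z.
  by move=> Hpq cpq hz; apply: convex_component => //; [apply: seg_convex|apply: inA].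
suff : forall m p q, (pos a p + (n.*2 - pos a q) < m)%N -> H p q ->
    crs a b p q -> seg pt [set p; q]%SET `<=` connected_component A (pt l).
  by move=> all_m p q; apply: all_m (ltnSn _).
elim=> // m IH p q; rewrite ltnS => lem Hpq cpq z hz.
have step z' : seg pt [set p; q]%SET z' -> connected_component A (pt l) z' ->
    connected_component A (pt l) z.
  by move=> hz' /connected_component_trans; apply; apply: cseg hz.
have [E1|nE] := boolP (ear a p q).
  apply: (step (pt p)); first exact: seg_end_l.
  have -> : p = l.
    have h1 := ne _ _ ca cl; have /and3P[cp _ _] := diss_col dH Hpq.
    by apply/eqP; move: (earP E1 h1) (lr _ (ne _ _ ca cp)) (h1) (ne _ _ ca cp); cyco.
  by apply: connected_component_refl; apply: (inA l r) => //; apply: seg_end_l.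
have apq : cyc a p q by move: cpq; cyco.
case/orP: (not_ear_inc dH ca Hpq apq (acc_half hacc cpq) nE) => /existsP[x /andP[h Hx]].
  have cpx : crs a b p x by move: h cpq; cyco.
  apply: (step (pt p)); first exact: seg_end_l.
  apply: (IH p x) => //; last exact: seg_end_l.
  have lt : (pos a q < pos a x)%N by apply: pos_cyc; move: h cpq; cyco.
  by move: lem lt (pos_max a x); clear; lia.
have cpx : crs a b x q by move: h cpq; cyco.
apply: (step (pt q)); first exact: seg_end_r.
apply: (IH x q) => //; [|exact: (diss_sym dH)|exact: seg_end_r].
have lt : (pos a x < pos a p)%N by apply: pos_cyc; move: h cpq; cyco.
by move: lem lt; clear; lia.
Qed.

End Accordion.
End Dissection.

(** * Cells *)

Section Cells.
Context {R : realType} {n : nat}.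
Local Notation plane := (R^o * R^o)%type.
Variable pt : 'I_(n.*2) -> plane.
Hypothesis n2 : (2 <= n)%N.
Hypothesis hpt : clockwise_on_circle pt.
Variables (c : color) (E : {set segment n}).
Hypothesis sub : E \subset internal_diagonals n c.
Hypothesis dH : diss (fun i => odd i == c) (chord c E).
Implicit Types (i j k l p q r u v x y a b t : 'I_(n.*2)) (z w : plane) (C : set plane).
Local Notation side i j z := (orientation (pt i) (pt j) z).
Local Notation H := (chord c E).
Local Notation cut := (cut_polygon pt c E).

Lemma mix_norm_lt (x y m e t : R) : `|x - m| < e -> `|y - m| < e -> 0 <= t <= 1 ->
  `|(1 - t) * x + t * y - m| < e.
Proof.
move=> hx hy /andP[t0 t1].
have -> : (1 - t) * x + t * y - m = (1 - t) * (x - m) + t * (y - m) by ring.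
pose M := Num.max `|x - m| `|y - m|.
have hM : M < e by rewrite gt_max hx hy.
apply: le_lt_trans hM; apply: le_trans (ler_normD _ _) _.
rewrite !normrM (ger0_norm t0) (@ger0_norm _ (1 - t)) ?subr_ge0 //.
have : (1 - t) * `|x - m| <= (1 - t) * M by rewrite ler_wpM2l ?subr_ge0 // le_max lexx.
have : t * `|y - m| <= t * M by rewrite ler_wpM2l // le_max lexx orbT.
lra.
Qed.

Lemma chord_in p q : [set p; q]%SET \in E -> H p q.
Proof. by rewrite /chord inE => ->. Qed.

Lemma polygon_convex : convex_set (polygon pt c).
Proof. exact: conv_hull_convex. Qed.

Lemma polygon_disk : polygon pt c `<=` disk.
Proof.
by apply: smallest_sub => [|_ [i _ <-]]; [apply: disk_convex|apply: disk_pt].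
Qed.

Lemma polygon_pt i : odd i == c -> polygon pt c (pt i).
Proof. by move=> /eqP h; apply: sub_gen_smallest; exists i. Qed.

Lemma cut_side u v z : [set u; v]%SET \in E -> cut z -> side u v z != 0.
Proof.
move=> Euv [/polygon_disk dz nz]; apply/eqP => o0; apply: nz; exists [set u; v]%SET => //.
by rewrite seg_disk_line // (chord_neq dH) // chord_in.
Qed.

(** The component is connected and never meets [uv], so [side u v] cannot change sign on it. *)
Lemma component_side u v z : [set u; v]%SET \in E -> cut z ->
  (forall w, connected_component cut z w -> side u v w < 0) \/
  (forall w, connected_component cut z w -> 0 < side u v w).
Proof.
move=> Euv cz; set K := connected_component cut z.
have Kcut w : K w -> cut w by apply: connected_component_sub.
have /connected_intervalP itv : connected ((fun w => side u v w : R) @` K).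
  apply: connected_continuous_connected; first exact: component_connected.
  exact/continuous_subspaceT/orientation_continuous.
have no0 w w' : K w -> K w' -> side u v w <= 0 -> 0 <= side u v w' -> False.
  move=> Kw Kw' h1 h2.
  have [|||k Kk /eqP] := itv (side u v w) (side u v w') _ _ 0; [by exists w|by exists w'| |].
    by rewrite h1.
  by rewrite (negPf (cut_side Euv (Kcut _ Kk))).
have Kz : K z by apply: connected_component_refl.
case: (ltP (side u v z) 0) => hz; [left|right] => w Kw; rewrite ltNge; apply/negP => h.
  by apply: (no0 z w) => //; apply: ltW.
exact: (no0 w z).
Qed.

Lemma closure_side_le u v (K : set plane) : (forall w, K w -> side u v w < 0) ->
  forall w, closure K w -> side u v w <= 0.
Proof.
move=> hK w cw.
have /continuous_closedP/(_ [set x : R | x <= 0] (@closed_le R 0)) :=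
  @orientation_continuous R (pt u) (pt v).
move=> /closure_id e; have : closure [set k : plane | side u v k <= 0] w.
  by apply: closureS cw => k /hK/ltW.
by rewrite -e.
Qed.

Lemma closure_side_ge u v (K : set plane) : (forall w, K w -> 0 < side u v w) ->
  forall w, closure K w -> 0 <= side u v w.
Proof.
move=> hK w cw; rewrite -oppr_le0 -orientationC; apply: closure_side_le cw => k Kk.
by rewrite orientationC oppr_lt0 hK.
Qed.

Lemma cell_side u v C : [set u; v]%SET \in E -> is_cell pt c E C ->
  (forall w, C w -> side u v w <= 0) \/ (forall w, C w -> 0 <= side u v w).
Proof.
move=> Euv [z cz ->]; case: (component_side Euv cz) => h.
  by left; apply: closure_side_le.
by right; apply: closure_side_ge.
Qed.

(* Near the midpoint of [uv], the part of the polygon on a given side of [uv]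
   is convex and avoids the diagonals, so both cells contain it. *)
Lemma cell_unique u v C1 C2 k l : [set u; v]%SET \in E ->
  is_cell pt c E C1 -> is_cell pt c E C2 ->
  seg pt [set u; v]%SET `<=` C1 -> seg pt [set u; v]%SET `<=` C2 ->
  C1 (pt k) -> C2 (pt l) -> cyc u v k -> cyc u v l -> C1 = C2.
Proof.
move=> Euv cell1 cell2 r1 r2 Ck Cl uvk uvl.
have Huv := chord_in Euv; have nuv := chord_neq dH Huv.
have neg z C x : cut z -> C = closure (connected_component cut z) -> C (pt x) ->
    cyc u v x -> forall w, connected_component cut z w -> side u v w < 0.
  move=> cz eC Cx uvx; case: (component_side Euv cz) => // h.
  rewrite eC in Cx; have := closure_side_ge h Cx.
  by rewrite leNgt side_lt0.
have [z1 cz1 e1] := cell1; have [z2 cz2 e2] := cell2.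
have neg1 := neg z1 C1 k cz1 e1 Ck uvk; have neg2 := neg z2 C2 l cz2 e2 Cl uvl.
pose m := mix 2^-1 (pt u) (pt v).
have segm : seg pt [set u; v]%SET m.
  by rewrite segE; exists 2^-1 => //; rewrite /= in_itv /=; lra.
pose U := ~` (\bigcup_(d in [set d | d \in E /\ d != [set u; v]%SET]) seg pt d).
have Um : nbhs m U.
  apply: open_nbhs_nbhs; split.
    apply/closed_openC/closed_bigcup; first exact: finite_finset.
    move=> d [Ed _]; have [|p [q [-> Hpq]]] := @with_edgesP _ c E d sub.
      by rewrite inE Ed.
    exact: seg_closed (chord_neq dH Hpq).
  move=> [d [Ed nd]]; have [|p [q [e Hpq]]] := @with_edgesP _ c E d sub.
    by rewrite inE Ed.
  have npq := chord_neq dH Hpq; rewrite e in nd *; move=> /(seg_side n2 hpt npq) /eqP.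
  apply/negP; apply: side_open; rewrite // 1?eq_sym //; last by lra.
  by rewrite xcE; move: (diss_nc dH Hpq Huv) (diss_nc dH Hpq (diss_sym dH Huv)); cyco.
have [e e0 he] := boxed_nbhs Um.
pose N := [set z | [/\ polygon pt c z, side u v z < 0, `|z.1 - m.1| < e & `|z.2 - m.2| < e]].
have Ncut : N `<=` cut.
  move=> z [pz sz b1 b2]; split=> // -[d /= Ed zd].
  have [ed|nd] := eqVneq d [set u; v]%SET.
    by move: zd; rewrite ed => /(seg_side n2 hpt nuv) s0; rewrite s0 ltxx in sz.
  by apply: (he z b1 b2); exists d.
have Nconv : convex_set N.
  apply: convex_mixP => z w t [pz sz za zb] [pw sw wa wb] t01; split.
  - exact: convex_mix polygon_convex pz pw t01.
  - by rewrite orientation_mix; move/andP: t01 => [t0 t1]; nra.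
  - by rewrite mix1; apply: mix_norm_lt.
  - by rewrite mix2; apply: mix_norm_lt.
have meet z : cut z -> closure (connected_component cut z) m ->
    (forall w, connected_component cut z w -> side u v w < 0) ->
    exists2 w, connected_component cut z w & N w.
  move=> cz clm hneg; have [w [Kw [b1 b2]]] := clm (ball m e) (nbhsx_ballx m e e0).
  exists w => //; split; [|exact: hneg| |].
  - by have [] := connected_component_sub Kw.
  - by rewrite distrC.
  - by rewrite distrC.
have m1 : closure (connected_component cut z1) m by rewrite -e1; apply: r1.
have m2 : closure (connected_component cut z2) m by rewrite -e2; apply: r2.
have [w1 K1 N1] := meet z1 cz1 m1 neg1; have [w2 K2 N2] := meet z2 cz2 m2 neg2.
rewrite e1 e2 (same_connected_component K1) (same_connected_component K2).
by rewrite (same_connected_component (convex_component Nconv Ncut N1 N2)).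
Qed.

(** By [hmin] no chord at [u] runs between [uv] and [uw], and any other chord entering the open
    triangle would cross [uv] or [uw]. The triangle is convex and avoids the diagonals, so it lies
    in one component, whose closure contains both segments. *)
Lemma triangle_cell u v (w : 'I_(n.*2)) : H u v -> H u w -> v != w ->
  (forall y, H u y -> ~~ (crs v w u y || crs v w y u)) ->
  exists C, [/\ is_cell pt c E C, seg pt [set u; v]%SET `<=` C &
                seg pt [set u; w]%SET `<=` C].
Proof.
move=> Huv Huw nvw hmin.
have [/and3P[cu cv nuv] /and3P[_ cw nuw]] := (diss_col dH Huv, diss_col dH Huw).
pose tri (x y z : R) : plane := x *: pt u + y *: pt v + z *: pt w.
pose T := [set k : plane | exists x y z : R, [/\ 0 < x, 0 < y, 0 < z, x + y + z = 1 & k = tri x y z]].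
have side_tri i j (x y z : R) : x + y + z = 1 ->
    side i j (tri x y z) = x * side i j (pt u) + y * side i j (pt v) + z * side i j (pt w).
  move=> e; have -> : x = 1 - y - z by rewrite -e; ring.
  by rewrite /orientation /tri /=; rewrite /GRing.scale /=; ring.
have Tconv : convex_set T.
  apply: convex_mixP => _ _ t [x [y [z [x0 y0 z0 e ->]]]] [x' [y' [z' [x0' y0' z0' e' ->]]]].
  move=> /andP[t0 t1].
  exists ((1 - t) * x + t * x'), ((1 - t) * y + t * y'), ((1 - t) * z + t * z').
  split; [nra|nra|nra|nra|].
  by apply: plane_ext; rewrite (mix1, mix2) /tri /= /GRing.scale /=; ring.
have Tpoly : T `<=` polygon pt c.
  move=> _ [x [y [z [x0 y0 z0 e ->]]]].
  have yz0 : y + z != 0 by rewrite gt_eqF // addr_gt0.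
  have -> : tri x y z = mix (y + z) (pt u) (mix (z / (y + z)) (pt v) (pt w)).
    have ex : x = 1 - (y + z) by rewrite -e; ring.
    by apply: plane_ext; rewrite !(mix1, mix2) /tri /= /GRing.scale /= ex; field.
  apply: convex_mix; [exact: polygon_convex|exact: polygon_pt| |lra].
  apply: convex_mix; [exact: polygon_convex|exact: polygon_pt|exact: polygon_pt|].
  have yzp : 0 < y + z by rewrite addr_gt0.
  by rewrite divr_ge0 ?(ltW z0) ?(ltW yzp) //= ler_pdivrMr // mul1r lerDr ltW.
have Tcut : T `<=` cut.
  move=> k Tk; split; first exact: Tpoly.
  move=> [d /= Ed kd]; have [|i [j [ed Hij]]] := @with_edgesP _ c E d sub.
    by rewrite inE Ed.
  have nij := chord_neq dH Hij.
  rewrite ed in kd; have s0 := seg_side n2 hpt nij kd.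
  have [x [y [z [x0 y0 z0 e ek]]]] := Tk; rewrite ek side_tri // in s0.
  have Hji := diss_sym dH Hij.
  have n1 := diss_nc dH Hij Huv; have n3 := diss_nc dH Hij (diss_sym dH Huv).
  have n4 := diss_nc dH Hij Huw; have n5 := diss_nc dH Hij (diss_sym dH Huw).
  have h1 : (i == u) ==> ~~ (crs v w i j || crs v w j i).
    by apply/implyP => /eqP eu; rewrite eu in Hij *; apply: hmin.
  have h2 : (j == u) ==> ~~ (crs v w j i || crs v w i j).
    by apply/implyP => /eqP eu; rewrite eu in Hji *; apply: hmin.
  (* The three vertices are weakly on one side of [ij], one of them strictly, so no combination with
     positive coefficients lies on [ij]. *)
  have : [&& ~~ cyc i u j, ~~ cyc i v j & ~~ cyc i w j] &&
         [|| cyc i j u, cyc i j v | cyc i j w] ||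
         [&& ~~ cyc i j u, ~~ cyc i j v & ~~ cyc i j w] &&
         [|| cyc i u j, cyc i v j | cyc i w j].
    by move: nij n1 n3 n4 n5 nuv nuw nvw h1 h2; cyco.
  case/orP => /andP[/and3P[a1 a2 a3]].
    have := side_le0 hpt nij a1; have := side_le0 hpt nij a2; have := side_le0 hpt nij a3.
    by move=> b3 b2 b1 /or3P[] /(side_lt0 hpt) b; clear -x0 y0 z0 s0 b1 b2 b3 b; nra.
  have := side_ge0 hpt nij a1; have := side_ge0 hpt nij a2; have := side_ge0 hpt nij a3.
  by move=> b3 b2 b1 /or3P[] /(side_gt0 hpt) b; clear -x0 y0 z0 s0 b1 b2 b3 b; nra.
(* Moving from a point of [uv] or [uw] towards the centroid enters the open triangle at once. *)
pose k0 := tri 3^-1 3^-1 3^-1.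
have T0 : T k0 by exists 3^-1, 3^-1, 3^-1; split=> //; lra.
exists (closure (connected_component cut k0)).
have TK := convex_component Tconv Tcut T0.
split; first by exists k0 => //; apply: Tcut.
  rewrite segE => _ [t + <-]; rewrite /= in_itv /= => /andP[t0 t1].
  apply: (@closure_mix _ _ _ k0) => s /andP[s0 s1]; apply: TK.
  exists ((1 - s) * (1 - t) + s / 3), ((1 - s) * t + s / 3), (s / 3).
  split; [nra|nra|nra|lra|].
  by apply: plane_ext; rewrite !(mix1, mix2) /k0 /tri /= /GRing.scale /=; field.
rewrite segE => _ [t + <-]; rewrite /= in_itv /= => /andP[t0 t1].
apply: (@closure_mix _ _ _ k0) => s /andP[s0 s1]; apply: TK.
exists ((1 - s) * (1 - t) + s / 3), (s / 3), ((1 - s) * t + s / 3).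
split; [nra|nra|nra|lra|].
by apply: plane_ext; rewrite !(mix1, mix2) /k0 /tri /= /GRing.scale /=; field.
Qed.

End Cells.

(** * Geometric Z and S crossings in terms of the cyclic order *)

Section Zeta.
Context {R : realType} {n : nat}.
Local Notation plane := (R^o * R^o)%type.
Variable pt : 'I_(n.*2) -> plane.
Hypothesis n2 : (2 <= n)%N.
Hypothesis hpt : clockwise_on_circle pt.
Variables (c : color) (E : {set segment n}).
Hypothesis sub : E \subset internal_diagonals n c.
Hypothesis dH : diss (fun i => odd i == c) (chord c E).
Implicit Types (i j k l p q r u v x y z a b t : 'I_(n.*2)) (C : set plane).
Local Notation side i j z := (orientation (pt i) (pt j) z).
Local Notation H := (chord c E).

(** The witness nearest to [pq] is the one that [triangle_cell] places in a common cell with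
    [pq]. *)
Lemma incl_closest a p q : cyc a p q -> incl H a p q ->
  exists z, [/\ cyc q z a, H p z & forall y, H p y -> ~~ cyc q y z].
Proof.
move=> apq /existsP[z0 Pz0]; have := @arg_minnP _ z0 (fun z => cyc q z a && H p z) (pos q) Pz0.
case=> z /andP[h1 h2] hmin; exists z; split=> // y Hy; apply/negP => h.
have qy : cyc q y a by move: h1 h apq; cyco.
by have := hmin y; rewrite Hy qy /= => /(_ isT); rewrite leqNgt (pos_cyc h).
Qed.

Lemma incr_closest a p q : cyc a p q -> incr H a p q ->
  exists z, [/\ cyc a z p, H q z & forall y, H q y -> ~~ cyc z y p].
Proof.
move=> apq /existsP[z0 Pz0]; have := @arg_maxnP _ z0 (fun z => cyc a z p && H q z) (pos a) Pz0.
case=> z /andP[h1 h2] hmax; exists z; split=> // y Hy; apply/negP => h.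
have ay : cyc a y p by move: h1 h apq; cyco.
have zy : cyc a z y by move: h1 h apq; cyco.
by have := hmax y; rewrite Hy ay /= => /(_ isT); rewrite leqNgt (pos_cyc zy).
Qed.

(** A cell stays on one side of [uv], so the cells reaching [x] and [y], on opposite sides, are
    distinct. *)
Lemma zigzagP a b u v x y C1 C2 : a != b -> H u v -> H u x -> H v y ->
  crs a b u x || crs a b x u -> crs a b v y || crs a b y v ->
  [set u; v]%SET \in E ->
  is_cell pt c E C1 -> is_cell pt c E C2 ->
  seg pt [set u; v]%SET `<=` C1 -> seg pt [set u; v]%SET `<=` C2 ->
  seg pt [set u; x]%SET `<=` C1 -> seg pt [set v; y]%SET `<=` C2 ->
  x != v -> y != u -> cyc u v x && cyc u y v || cyc u x v && cyc u v y ->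
  zigzag pt c E [set u; v]%SET [set a; b]%SET u v x.
Proof.
move=> nab Huv Hux Hvy cx cy Euv cell1 cell2 s1 s2 sx sy nxv nyu o.
exists C1, C2, y; split; split=> //.
- have Cx : C1 (pt x) by apply: sx; apply: seg_end_r.
  have Cy : C2 (pt y) by apply: sy; apply: seg_end_r.
  move=> e12; rewrite -e12 in Cy.
  case: (cell_side n2 hpt dH Euv cell1) => h; have := h _ Cx; have := h _ Cy;
    rewrite leNgt => /negP h1; rewrite leNgt => /negP h2; case/orP: o => /andP[w1 w2].
  + by apply: h1; apply: side_gt0.
  + by apply: h2; apply: side_gt0.
  + by apply: h2; apply: side_lt0.
  + by apply: h1; apply: side_lt0.
- by move=> z hz; split; [apply: s1|apply: s2].
- split.
  + exact: (diss_sym dH).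
  + by rewrite set2_eq; move: nxv (chord_neq dH Huv) (chord_neq dH Hux); cyco.
  + by rewrite finset.setUC.
  + apply/(crossesP n2 hpt nab); first by rewrite eq_sym (chord_neq dH Hux).
    by rewrite xcE; move: cx; cyco.
- split=> //.
  + by rewrite set2_eq; move: nyu (chord_neq dH Huv) (chord_neq dH Hvy); cyco.
  + apply/(crossesP n2 hpt nab); first by rewrite (chord_neq dH Hvy).
    by rewrite xcE; move: cy; cyco.
Qed.

(** If [x] and [y] were on the same side of [uv], [cell_unique] would identify the two cells. *)
Lemma zigzag_cyc a b u v x y C1 C2 : a != b -> [set u; v]%SET \in E ->
  is_cell pt c E C1 -> is_cell pt c E C2 -> C1 <> C2 ->
  seg pt [set u; v]%SET `<=` C1 `&` C2 ->
  crosses_in_cell pt c E [set u; v]%SET [set a; b]%SET C1 [set x; u]%SET ->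
  crosses_in_cell pt c E [set u; v]%SET [set a; b]%SET C2 [set v; y]%SET ->
  [/\ H u x, H v y, crs a b u x || crs a b x u, crs a b v y || crs a b y v &
      (0 < side u v (pt x) -> cyc u x v && cyc u v y) /\
      (side u v (pt x) < 0 -> cyc u v x && cyc u y v)].
Proof.
move=> nab Euv cell1 cell2 nC r12 [Hxu nxu sx crx] [Hvy nvy sy cry].
have Huv : H u v by apply: chord_in.
have Hux := diss_sym dH Hxu.
have nuv := chord_neq dH Huv; have nux := chord_neq dH Hux; have nvy' := chord_neq dH Hvy.
have nxv : x != v by apply: contraNneq nxu => ->; rewrite finset.setUC.
have nyu : y != u by apply: contraNneq nvy => ->; rewrite finset.setUC.
have Cx : C1 (pt x) by apply: sx; apply: seg_end_l.
have Cy : C2 (pt y) by apply: sy; apply: seg_end_r.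
have r1 : seg pt [set u; v]%SET `<=` C1 by move=> z /r12[].
have r2 : seg pt [set u; v]%SET `<=` C2 by move=> z /r12[].
have cases_x : cyc u v x || cyc u x v by move: nuv nux nxv; cyco.
have cases_y : cyc u v y || cyc u y v by move: nuv nvy' nyu; cyco.
have notlt : ~~ (cyc u v x && cyc u v y).
  by apply/negP => /andP[w1 w2]; apply: nC; apply: (cell_unique n2 hpt sub dH Euv _ _ _ _ Cx Cy).
have Evu : [set v; u]%SET \in E by rewrite finset.setUC.
have notgt : ~~ (cyc u x v && cyc u y v).
  apply/negP => /andP[w1 w2]; apply: nC.
  by apply: (cell_unique n2 hpt sub dH Evu _ _ _ _ Cx Cy); rewrite // 1?finset.setUC //;
    [move: w1|move: w2]; cyco.
split=> //.
- move/(crossesP n2 hpt nab (chord_neq dH Hxu)): crx; rewrite xcE; cyco.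
- move/(crossesP n2 hpt nab (chord_neq dH Hvy)): cry; rewrite xcE; cyco.
split=> s.
  have : ~~ cyc u v x by apply/negP => /(side_lt0 hpt) /(lt_trans s); rewrite ltxx.
  by move: cases_x cases_y notlt notgt; cyco.
have : ~~ cyc u x v by apply/negP => /(side_gt0 hpt) /lt_trans /(_ s); rewrite ltxx.
by move: cases_x cases_y notlt notgt; cyco.
Qed.

Lemma is_ZP a b p q : crs a b p q -> [set p; q]%SET \in E ->
  is_Z pt c E [set p; q]%SET [set a; b]%SET <-> incl H a p q && incl H b q p.
Proof.
move=> cr Epq; have nab : a != b by move: cr; cyco.
have Hpq : H p q by apply: chord_in.
have npq := chord_neq dH Hpq.
split=> [[u [v [x [[C1 [C2 [y [[cell1 cell2 nC r12] [er cx cy]]]]] s]]]]|].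
  have Euv : [set u; v]%SET \in E by rewrite -er.
  rewrite er in r12 cx cy.
  have [Hux Hvy crx cry [_ /(_ s) o]] := zigzag_cyc nab Euv cell1 cell2 nC r12 cx cy.
  move/eqP/set2_eqP: er => [[ep eq]|[ep eq]]; rewrite ep eq in cr *;
    apply/andP; split; apply/existsP; [exists x|exists y|exists y|exists x];
    rewrite ?Hux ?Hvy andbT; move: o crx cry cr; cyco.
have apq : cyc a p q by move: cr; cyco.
have bqp : cyc b q p by move: cr; cyco.
move=> /andP[/(incl_closest apq)[x [hox Hpx mx]] /(incl_closest bqp)[y [hoy Hqy my]]].
have Hqp := diss_sym dH Hpq.
have [||C1 [cell1 r1 s1]] := triangle_cell n2 hpt sub dH Hpq Hpx.
- by move: hox; cyco.
- by move=> z Hz; move: (mx z Hz) hox apq; cyco.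
have [||C2 [cell2 r2 s2]] := triangle_cell n2 hpt sub dH Hqp Hqy.
- by move: hoy; cyco.
- by move=> z Hz; move: (my z Hz) hoy bqp; cyco.
exists p, q, x; split; last by apply: side_lt0 => //; move: hox apq; cyco.
by apply: (@zigzagP a b p q x y C1 C2) => //;
  rewrite 1?finset.setUC //; move: hox hoy cr; cyco.
Qed.

Lemma is_SP a b p q : crs a b p q -> [set p; q]%SET \in E ->
  is_S pt c E [set p; q]%SET [set a; b]%SET <-> incr H a p q && incr H b q p.
Proof.
move=> cr Epq; have nab : a != b by move: cr; cyco.
have Hpq : H p q by apply: chord_in.
have npq := chord_neq dH Hpq.
split=> [[u [v [x [[C1 [C2 [y [[cell1 cell2 nC r12] [er cx cy]]]]] s]]]]|].
  have Euv : [set u; v]%SET \in E by rewrite -er.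
  rewrite er in r12 cx cy.
  have [Hux Hvy crx cry [/(_ s) o _]] := zigzag_cyc nab Euv cell1 cell2 nC r12 cx cy.
  move/eqP/set2_eqP: er => [[ep eq]|[ep eq]]; rewrite ep eq in cr *;
    apply/andP; split; apply/existsP; [exists y|exists x|exists x|exists y];
    rewrite ?Hux ?Hvy andbT; move: o crx cry cr; cyco.
have apq : cyc a p q by move: cr; cyco.
have bqp : cyc b q p by move: cr; cyco.
move=> /andP[/(incr_closest apq)[x [hox Hqx mx]] /(incr_closest bqp)[y [hoy Hpy my]]].
have Hqp := diss_sym dH Hpq.
have [||C1 [cell1 r1 s1]] := triangle_cell n2 hpt sub dH Hqp Hqx.
- by move: hox; cyco.
- by move=> z Hz; move: (mx z Hz) hox apq; cyco.
have [||C2 [cell2 r2 s2]] := triangle_cell n2 hpt sub dH Hpq Hpy.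
- by move: hoy; cyco.
- by move=> z Hz; move: (my z Hz) hoy bqp; cyco.
exists q, p, x; split; last by apply: side_gt0 => //; move: hox apq; cyco.
rewrite finset.setUC; apply: (@zigzagP a b q p x y C1 C2) => //;
  rewrite 1?finset.setUC //; move: hox hoy cr; cyco.
Qed.

(** [zeta] tests for a Z first; by [inc_excl] a crossing is never both a Z and an S, so the order of
    the tests does not matter. *)
Lemma zetaE (r e : segment n) : r \in E -> e \in diagonals n (~~ c) -> zeta pt c E r e = sgn R H r e.
Proof.
move=> Er /diagonalsP[a [b [-> nab oa ob]]].
have [|p [q [er Hpq]]] := @with_edgesP _ c E r sub; first by rewrite inE Er.
rewrite er in Er *.
have npq := chord_neq dH Hpq.
have crE := crossesP n2 hpt nab npq.
have xcC : xc [set a; b] [set p; q] = xc [set p; q] [set a; b].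
  by rewrite !xcE; apply/idP/idP; cyco.
have [hx|nx] := boolP (xc [set p; q] [set a; b]); last first.
  rewrite sgn_xc // /zeta; case: asboolP => [[/crE]|_]; first by rewrite xcC (negPf nx).
  by case: asboolP => [[/crE]|//]; rewrite xcC (negPf nx).
wlog cr : p q er Er hx Hpq npq crE xcC / crs a b p q => [th|].
  move: (hx); rewrite xcE => /orP[cr|cr]; first exact: th.
  have es : [set p; q]%SET = [set q; p]%SET by rewrite finset.setUC.
  rewrite es in Er er hx crE xcC *.
  by apply: th => //; [apply: (diss_sym dH)|rewrite eq_sym].
have crs1 : crosses pt [set a; b]%SET [set p; q]%SET by apply/crE; rewrite xcC.
have apq : cyc a p q by move: cr; cyco.
have ex := inc_excl dH apq.
rewrite /zeta sgnE //.
have -> : `[< crosses pt [set a; b]%SET [set p; q]%SET /\ is_Z pt c E [set p; q]%SET [set a; b]%SET >]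
    = incl H a p q && incl H b q p.
  by apply/asboolP/idP => [[_ /(is_ZP cr Er)]|/(is_ZP cr Er)].
have -> : `[< crosses pt [set a; b]%SET [set p; q]%SET /\ is_S pt c E [set p; q]%SET [set a; b]%SET >]
    = incr H a p q && incr H b q p.
  by apply/asboolP/idP => [[_ /(is_SP cr Er)]|/(is_SP cr Er)].
move: ex; case: (incl H a p q) => /=; case: (incr H a p q) => //= _;
  by [rewrite subr0; case: incl|rewrite sub0r; case: incr; rewrite ?oppr0|rewrite subrr].
Qed.

End Zeta.

(** * Polygon edges as ears, and the chord that fills a gap *)

Section Edges.
Variable n : nat.
Hypothesis n2 : (2 <= n)%N.
Implicit Types (p q x y a b t : 'I_(n.*2)) (e f : segment n).

Lemma xc_sym : symmetric (@xc n.*2).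
Proof.
suff imp e f : xc e f -> xc f e by move=> e f; apply/idP/idP; apply: imp.
case/existsP=> p /existsP[q /existsP[a /existsP[b /and3P[/eqP-> /eqP-> cr]]]].
by rewrite xcE; move: cr; cyco.
Qed.

Lemma xc_irr : irreflexive (@xc n.*2).
Proof.
move=> e; apply/negbTE/negP.
case/existsP=> p /existsP[q /existsP[a /existsP[b /and3P[/eqP-> e2 cr]]]].
by move: e2 cr; rewrite set2_eq; cyco.
Qed.

Lemma edge_is_ear p q c : [set p; q]%SET \in edges n c -> exists t, ear t p q || ear t q p.
Proof.
rewrite edgesE // => /andP[_].
suff mid x y : (y == x + 2 %[mod n.*2])%N -> exists t, ear t y x.
  by case/orP => /mid[t e]; exists t; rewrite e ?orbT.
rewrite mod_add2 // => e; have [t ht] := next_label n2 x; exists t.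
have hy : (y == t.+1 :> nat) || (t.+1 == n.*2) && (y == 0%N :> nat).
  have := ltn_ord x; have := ltn_ord y; have := ltn_ord t.
  by move: e ht; clear; lia.
have hx : (x.+1 == t) || (t == 0%N :> nat) && (x.+1 == n.*2).
  by move: ht; clear; lia.
apply/forallP => i; apply/implyP => ni.
by rewrite (next_cycw n2 hy ni) (prev_cycw n2 hx ni).
Qed.

Lemma ear_acc C (H : rel 'I_(n.*2)) t p q : diss C H -> ear t p q -> acc H p q.
Proof.
move=> dH E i j x y _ _ c1 c2 h1 h2.
have nt (k : 'I_(n.*2)) : cyc q k p -> k = t.
  by move=> h; apply/eqP/negPn/negP => nk; move: (earP E nk) h; cyco.
have jt : j = t by apply: nt; move: c1; cyco.
have yt : y = t by apply: nt; move: c2; cyco.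
by exfalso; move: h2; rewrite jt yt; cyco.
Qed.

Lemma edge_acc C (H : rel 'I_(n.*2)) p q c : diss C H ->
  [set p; q]%SET \in edges n c -> acc H p q.
Proof.
by move=> dH /edge_is_ear[t /orP[|] /(ear_acc dH) // /(acc_sym dH)].
Qed.

Lemma sgn_edge (R : comNzRingType) C (H : rel 'I_(n.*2)) x y p q c : diss C H -> H x y ->
  [set p; q]%SET \in edges n c -> sgn R H [set x; y]%SET [set p; q]%SET = 0.
Proof.
move=> dH Hxy /edge_is_ear[t /orP[|] e]; last exact: (sgn_fan R dH Hxy e).
by rewrite (finset.setUC [set p]%SET); apply: (sgn_fan R dH Hxy e).
Qed.

Lemma shift_edge p q a b c c' :
  (a == p.+1 :> nat) || (p.+1 == n.*2) && (a == 0%N :> nat) ->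
  (b == q.+1 :> nat) || (q.+1 == n.*2) && (b == 0%N :> nat) ->
  [set p; q]%SET \in diagonals n c -> [set a; b]%SET \in diagonals n c' ->
  ([set p; q]%SET \in edges n c) = ([set a; b]%SET \in edges n c').
Proof.
move=> ha hb d1 d2; rewrite !edgesE // d1 d2 /= !mod_add2 //.
have := ltn_ord p; have := ltn_ord q; have := ltn_ord a; have := ltn_ord b.
by move: ha hb n2; clear; lia.
Qed.

Lemma next_odd p a : (a == p.+1 :> nat) || (p.+1 == n.*2) && (a == 0%N :> nat) ->
  odd a = ~~ odd p.
Proof. by have := ltn_ord p; move: n2; clear; lia. Qed.

(* The chord [py] of the proof of maximality: when consecutive chords [pq] and
   [xy] of [H2] crossed by [uv] are disjoint, [py] can be added to [H2]. *)
Lemma gap_chord C (H1 H2 : rel 'I_(n.*2)) u v p q x y : diss C H1 -> diss (predC C) H2 ->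
  H1 u v -> H2 p q -> H2 x y -> acc H1 p q -> acc H1 x y ->
  crs u v p q -> crs u v x y -> cyc u p x -> cyc u y q ->
  acc H1 p y /\ forall r s, H2 r s -> xc [set p; y]%SET [set r; s]%SET ->
    exists r s, H2 r s /\ btw u p q x y r s.
Proof.
move=> d1 d2 Huv Hpq Hxy A1 A2 c1 c2 h1 h2; split.
  apply: (@acc_cross _ C H1 p q x y v u d1 (diss_sym d1 Huv)) => //.
    by move: c1; cyco.
  by move: c2; cyco.
have cross r s : H2 r s -> cyc p r y -> cyc y s p -> exists r s, H2 r s /\ btw u p q x y r s.
  move=> Hrs k1 k2; exists r, s; split=> //.
  move: (diss_nc d2 Hpq Hrs) (diss_nc d2 Hpq (diss_sym d2 Hrs)).
  move: (diss_nc d2 Hxy Hrs) (diss_nc d2 Hxy (diss_sym d2 Hrs)).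
  have /and3P[_ _ npq] := diss_col d2 Hpq; have /and3P[_ _ nxy] := diss_col d2 Hxy.
  have ne (k l : 'I_(n.*2)) : C k -> (predC C) l -> k != l by move=> Ck; apply: contraNneq => <-.
  have /and3P[Cu Cv _] := diss_col d1 Huv; have /and3P[Cr Cs _] := diss_col d2 Hrs.
  move: (ne _ _ Cu Cr) (ne _ _ Cu Cs) (ne _ _ Cv Cr) (ne _ _ Cv Cs).
  by move: c1 h1 h2 c2 k1 k2; cyco.
move=> r s Hrs; rewrite xcE => hx.
have /orP[/andP[k1 k2]|/andP[k1 k2]] : (cyc p r y && cyc y s p) || (cyc p s y && cyc y r p).
    by move: hx; cyco.
  exact: cross Hrs k1 k2.
exact: cross (diss_sym d2 Hrs) k1 k2.
Qed.

End Edges.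

Lemma diagonals_crosses (R : realType) (n : nat) (pt : 'I_(n.*2) -> (R^o * R^o)%type) :
  (2 <= n)%N -> clockwise_on_circle pt -> forall c c' (d e : segment n),
  d \in diagonals n c -> e \in diagonals n c' -> crosses pt d e <-> xc d e.
Proof.
move=> n2 hpt c c' d e /diagonalsP[p [q [-> npq _ _]]] /diagonalsP[x [y [-> nxy _ _]]].
exact: crossesP.
Qed.

(** * The accordiohedron *)

Section Accordiohedron.
Context {R : realType} {n : nat}.
Local Notation plane := (R^o * R^o)%type.
Variable pt : 'I_(n.*2) -> plane.
Hypothesis n2 : (2 <= n)%N.
Hypothesis hpt : clockwise_on_circle pt.
Variable D : {set segment n}.
Hypothesis hD : dissection pt hollow D.
Implicit Types (i j p q r s u v x y a b t : 'I_(n.*2)) (d e : segment n) (E F : {set segment n}).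
Local Notation A := (internal_accordion_diagonals pt D).
Local Notation g := (@g_vector R n pt D).
Local Notation c := (@c_vector R n pt D).
Local Notation H := (chord hollow D).
Local Notation odds := (fun i : 'I_(n.*2) => odd i == hollow).

Lemma subD : D \subset internal_diagonals n hollow. Proof. by case: hD. Qed.

Lemma internal_diag k d : d \in internal_diagonals n k -> d \in diagonals n k.
Proof. by rewrite inE => /andP[]. Qed.

Lemma dissectionE k E : dissection pt k E <->
  E \subset internal_diagonals n k /\ {in E &, forall d e, ~~ xc d e}.
Proof.
split=> -[sub nc]; split=> // d e Ed Ee;
  have [Dd De] := (internal_diag (fintype.subsetP sub _ Ed), internal_diag (fintype.subsetP sub _ Ee)).
  by apply/negP => /(diagonals_crosses n2 hpt Dd De); apply: nc.
by move=> /(diagonals_crosses n2 hpt Dd De); apply/negP; apply: nc.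
Qed.

Lemma dissH : diss odds H.
Proof. by have /dissectionE[_ nc] := hD; apply: diss_chord subD nc. Qed.

Lemma solid_diag a b : [set a; b]%SET \in diagonals n solid =
  [&& a != b, ~~ odds a & ~~ odds b].
Proof. by rewrite diagonalsE; case: (odd a); case: (odd b). Qed.

Lemma accordionE a b : [set a; b]%SET \in diagonals n solid ->
  accordion_diagonal pt hollow D [set a; b]%SET <-> acc H a b.
Proof.
move=> Dab; have := Dab; rewrite solid_diag => /and3P[nab na nb].
rewrite /accordion_diagonal; split=> [[_]|h]; last split=> //.
  exact: (accordionP n2 hpt subD dissH nab na nb).1.
exact: (accordionP n2 hpt subD dissH nab na nb).2.
Qed.

Lemma AE a b : ([set a; b]%SET \in A) = ([set a; b]%SET \in internal_diagonals n solid) &&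
  `[< acc H a b >].
Proof.
rewrite [LHS]inE; apply: andb_id2l => /internal_diag Dab.
by apply/asboolP/asboolP => /(accordionE Dab).
Qed.

Lemma A_P d : d \in A -> exists a b, [/\ d = [set a; b]%SET,
  [set a; b]%SET \in internal_diagonals n solid, a != b, ~~ odds a & ~~ odds b /\ acc H a b].
Proof.
move=> Ad; have /diagonalsP[a [b [e _ _ _]]] : d \in diagonals n solid.
  by apply: internal_diag; move: Ad; rewrite inE => /andP[].
exists a, b; move: Ad; rewrite e AE => /andP[Iab /asboolP h].
have := internal_diag Iab; rewrite solid_diag => /and3P[? ? ?].
by split=> //; split.
Qed.

Lemma A_diag d : d \in A -> d \in diagonals n solid.
Proof. by rewrite inE => /andP[/internal_diag]. Qed.

Lemma D_P d : d \in D -> exists u v, d = [set u; v]%SET /\ H u v.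
Proof. by move=> Dd; apply: (with_edgesP subD); rewrite inE Dd. Qed.

Lemma heightE d : d \in A -> height pt D d = cx_height A (@xc n.*2) d.
Proof.
move=> Ad; apply: eq_card => e; rewrite [LHS]inE [RHS]inE; apply: andb_id2l => Ae.
have := diagonals_crosses n2 hpt (A_diag Ae) (A_diag Ad).
by move=> [h1 h2]; apply/asboolP/idP.
Qed.

Lemma accordion_dissectionE E : accordion_dissection pt D E <-> compat A (@xc n.*2) E.
Proof.
split=> [[/dissectionE[sub nc] ac]|[sub nc]].
  split=> //; apply/fintype.subsetP => d Ed; rewrite inE (fintype.subsetP sub) //.
  by apply/asboolP/ac.
have sub' : E \subset internal_diagonals n solid.
  by apply/fintype.subsetP => d /(fintype.subsetP sub); rewrite inE => /andP[].
split; first exact/dissectionE.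
by move=> d /(fintype.subsetP sub); rewrite inE => /andP[_ /asboolP].
Qed.

Lemma maximalE E : maximal_accordion_dissection pt D E <-> maximal_compat A (@xc n.*2) E.
Proof.
split=> -[h m]; split=> [|F /accordion_dissectionE hF]; try exact/accordion_dissectionE;
  exact: m.
Qed.

Lemma g_vectorE d (x : {d : segment n | d \in D}) : d \in diagonals n solid ->
  g d x = sgn R H (val x) d.
Proof. by move=> Dd; rewrite ffunE (zetaE n2 hpt subD dissH) // (valP x). Qed.

Lemma g_vector_edge a b : [set a; b]%SET \in edges n solid -> g [set a; b]%SET = 0.
Proof.
move=> Eab; apply/ffunP => x; rewrite g_vectorE; last by move: Eab; rewrite inE => /andP[].
have [u [v [-> Huv]]] := D_P (valP x).
by rewrite (@sgn_edge _ n2 R _ _ _ _ _ _ _ dissH Huv Eab) ffunE.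
Qed.

(** An edge cuts off one label, which would be an end of both diagonals; but crossing diagonals have
    no common end. *)
Lemma shared_chord_internal a b a' b' i j : H i j -> crs a b i j ->
  crs a' b' i j -> crs a b a' b' || crs a b b' a' -> [set i; j]%SET \in D.
Proof.
move=> Hij c1 c2 cr; move: (Hij); rewrite /chord inE => /orP[//|].
move=> /(edge_is_ear n2)[t et]; exfalso.
have tE : ear t i j -> (a == t) && (a' == t).
  move=> E; apply/andP; split; apply/negPn/negP => /(earP E).
    by move: c1; cyco.
  by move: c2; cyco.
have tE' : ear t j i -> (b == t) && (b' == t).
  move=> E; apply/andP; split; apply/negPn/negP => /(earP E).
    by move: c1; cyco.
  by move: c2; cyco.
by case/orP: et => [/tE|/tE'] /andP[/eqP e1 /eqP e2]; move: c1 c2 cr; rewrite e1 e2; cyco.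
Qed.

Lemma g_resolve d e : d \in A -> e \in A -> xc d e -> exists f1 f2,
  [/\ f1 \in A \/ g f1 = 0, f2 \in A \/ g f2 = 0, g d + g e = g f1 + g f2,
      forall f, f \in A -> (xc f f1 + xc f f2 <= xc f d + xc f e)%N &
      [&& ~~ xc d f1, ~~ xc d f2, ~~ xc e f1 & ~~ xc e f2]].
Proof.
move=> /A_P[a [b [-> Iab nab na [nb Aab]]]] /A_P[a' [b' [-> Iab' nab' na' [nb' Aab']]]] hx.
have cr : crs a b a' b' || crs a b b' a' by move: hx; rewrite xcE; cyco.
have [i [j [Hij c1 c2]]] : exists i j, [/\ H i j, crs a b i j & crs a' b' i j || crs b' a' i j].
  case/orP: cr => cr.
    have [i [j [Hij c1 c2]]] := common_chord dissH na nb na' nb' Aab cr.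
    by exists i, j; split=> //; apply/orP.
  have [i [j [Hij c1 c2]]] := common_chord dissH na nb nb' na' Aab cr.
  by exists i, j; split=> //; rewrite orbC; apply/orP.
(* The chord [ij] decides how the ends are paired: [a'] has to be on the side of [a], if necessary
   by reversing [a'b']. *)
wlog c3 : a' b' Iab' nab' na' nb' Aab' hx cr c2 / crs a' b' i j => [th|].
  case/orP: c2 => c2; first by apply: th => //; rewrite c2.
  have es : [set a'; b']%SET = [set b'; a']%SET by rewrite finset.setUC.
  rewrite es in Iab' hx *; apply: th => //.
  - by rewrite eq_sym.
  - exact: acc_sym dissH Aab'.
  - by rewrite orbC.
  - by rewrite c2.
have Dij := shared_chord_internal Hij c1 c3 cr.
have Iij := fintype.subsetP subD _ Dij.
have ne1 t := internal_not_ear n2 t Iij.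
have ne2 t : ~~ ear t j i by apply: (internal_not_ear n2 (c := hollow)); rewrite finset.setUC.
have ends k l : ~~ odds k -> ~~ odds l -> k != l -> acc H k l ->
    [set k; l]%SET \in A \/ g [set k; l]%SET = 0.
  move=> nk nl nkl Akl; have Dkl : [set k; l]%SET \in diagonals n solid.
    by rewrite solid_diag nkl nk.
  have [Ekl|nEkl] := boolP ([set k; l]%SET \in edges n solid).
    by right; apply: g_vector_edge.
  by left; rewrite AE [in X in X && _]inE nEkl Dkl; apply/asboolP.
exists [set a; b']%SET, [set a'; b]%SET; split.
- apply: ends => //; first by move: c1 c3; cyco.
  exact: acc_cross dissH Hij c1 c3 Aab Aab'.
- apply: ends => //; first by move: c1 c3; cyco.
  exact: acc_cross dissH Hij c3 c1 Aab' Aab.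
- have [n1 n3] : a != b' /\ a' != b by split; move: c1 c3; cyco.
  have Ds k l : k != l -> ~~ odds k -> ~~ odds l -> [set k; l]%SET \in diagonals n solid.
    by move=> nkl nk nl; rewrite solid_diag nkl nk.
  apply/ffunP => x; rewrite [LHS]ffunE [RHS]ffunE !g_vectorE; try exact: Ds.
  have [u [v [ex Huv]]] := D_P (valP x).
  rewrite ex; exact: (sgn_resolve R dissH na nb na' nb' Hij c1 c3 Aab Aab' ne1 ne2 Huv).
- move=> f /A_P[s [t [-> _ _ _ _]]]; exact: (xc_resolve _ _ cr c1 c3).
- by rewrite !xcE; move: c1 c3; cyco.
Qed.

(** Rotating the diagonal [uv] by one label clockwise gives [ab], with the negative basis vector,
    and counterclockwise [c'd'], with the positive one. Rotation maps edges to edges and internal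
    diagonals to internal ones. *)
Lemma g_span (x : {d : segment n | d \in D}) (k : bool) : exists2 d, d \in A &
  g d = [ffun y => (-1) ^+ k * (y == x)%:R].
Proof.
have [u [v [e Huv]]] := D_P (valP x).
have Iuv : [set u; v]%SET \in internal_diagonals n hollow.
  by rewrite -e; apply: (fintype.subsetP subD); apply: valP.
have Ivu : [set v; u]%SET \in internal_diagonals n hollow by rewrite finset.setUC.
have e1 t := internal_not_ear n2 t Iuv; have e2 t := internal_not_ear n2 t Ivu.
have /and3P[Cu Cv nuv] := diss_col dissH Huv.
have [a ha] := next_label n2 u; have [b hb] := next_label n2 v.
have [c' hc] := prev_label n2 v; have [d' hd] := prev_label n2 u.
have swp p q : (p.+1 == q) || (q == 0%N :> nat) && (p.+1 == n.*2) ->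
    (q == p.+1 :> nat) || (p.+1 == n.*2) && (q == 0%N :> nat).
  by clear; lia.
have swp' p q : (q == p.+1 :> nat) || (p.+1 == n.*2) && (q == 0%N :> nat) ->
    (p.+1 == q) || (q == 0%N :> nat) && (p.+1 == n.*2).
  by clear; lia.
have nxt p q (h : (q == p.+1 :> nat) || (p.+1 == n.*2) && (q == 0%N :> nat)) :
    odds p = ~~ odds q.
  by rewrite (next_odd n2 h) /hollow; case: (odd p).
have na : ~~ odds a by rewrite -(nxt _ _ ha).
have nb : ~~ odds b by rewrite -(nxt _ _ hb).
have nc : ~~ odds c' by rewrite (nxt _ _ (swp _ _ hc)) negbK.
have nd : ~~ odds d' by rewrite (nxt _ _ (swp _ _ hd)) negbK.
have HA p q := @sgn_before _ R _ _ u v a b p q dissH na nb Huv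
  (fun i => prev_cycw n2 (swp' _ _ ha)) (fun i => prev_cycw n2 (swp' _ _ hb)) (e2 a) (e1 b).
have HB p q := @sgn_after _ R _ _ u v a b c' d' p q dissH na nb nc nd Huv
  (fun i => prev_cycw n2 (swp' _ _ ha)) (fun i => prev_cycw n2 (swp' _ _ hb))
  (fun i => next_cycw n2 (swp _ _ hc)) (fun i => next_cycw n2 (swp _ _ hd)) e1 e2.
have nE p q : [set p; q]%SET \in internal_diagonals n hollow ->
    [set p; q]%SET \in edges n hollow = false.
  by rewrite inE => /andP[/negbTE].
have [cab Aab _] := HA _ _ Huv; have [cdc Adc _] := HB _ _ Huv.
have Dab : [set a; b]%SET \in diagonals n solid.
  by rewrite solid_diag na nb; move: cab; cyco.
have Dcd : [set c'; d']%SET \in diagonals n solid.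
  by rewrite solid_diag nc nd; move: cdc; cyco.
have xE (y : {d : segment n | d \in D}) : (y == x) = (val y == [set u; v]%SET).
  by rewrite -e val_eqE.
case: k.
  exists [set a; b]%SET.
    rewrite AE inE Dab -(shift_edge n2 ha hb (internal_diag Iuv) Dab) (nE _ _ Iuv) /=.
    exact/asboolP.
  apply/ffunP => y; rewrite g_vectorE // [RHS]ffunE xE expr1 mulN1r.
  by have [p [q [ey Hpq]]] := D_P (valP y); rewrite ey; have [_ _ ->] := HA _ _ Hpq.
exists [set c'; d']%SET.
  rewrite AE inE Dcd (shift_edge n2 (swp _ _ hc) (swp _ _ hd) Dcd (internal_diag Ivu)) (nE _ _ Ivu) /=.
  exact/asboolP/(acc_sym dissH).
apply/ffunP => y; rewrite g_vectorE // [RHS]ffunE xE expr0 mul1r.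
by have [p [q [ey Hpq]]] := D_P (valP y); rewrite ey; have [_ _ ->] := HB _ _ Hpq.
Qed.

Lemma compat_internal E : compat A (@xc n.*2) E -> E \subset internal_diagonals n solid.
Proof.
move=> [sub _]; apply/fintype.subsetP => d /(fintype.subsetP sub).
by rewrite [d \in A]inE => /andP[].
Qed.

Lemma diss_compat E : compat A (@xc n.*2) E -> diss (predC odds) (chord solid E).
Proof.
move=> cE; have := diss_chord n2 (compat_internal cE) cE.2.
suff -> : (fun i : 'I_(n.*2) => odd i == solid) = predC odds by [].
by apply/funext => i /=; case: (odd i).
Qed.

Lemma compat_acc E x y : compat A (@xc n.*2) E -> chord solid E x y -> acc H x y.
Proof.
move=> [sub _]; rewrite /chord inE => /orP[/(fintype.subsetP sub)|]; last exact: (edge_acc n2 dissH).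
by rewrite AE => /andP[_ /asboolP].
Qed.

(** If no chord of [E] lay between [pq] and [xy], then [py] would be an accordion diagonal crossed
    by none of [E]; by maximality it belongs to [E], and it fills the gap itself. *)
Lemma maximal_acc E u v : maximal_compat A (@xc n.*2) E -> H u v -> acc (chord solid E) u v.
Proof.
move=> [cE mE] Huv p q x y Hpq Hxy c1 c2 h1 h2.
have dE := diss_compat cE.
have [Apy cross] := gap_chord dissH dE Huv Hpq Hxy (compat_acc cE Hpq) (compat_acc cE Hxy) c1 c2 h1 h2.
have [/existsP[f /andP[Ef hf]]|nx] := boolP [exists f in E, xc [set p; y]%SET f].
  have [r [s [ef Hrs]]] := with_edgesP (c := solid) (compat_internal cE)
    (d := f) (fintype.subsetP (finset.subsetUl _ _) _ Ef).
  by apply: cross Hrs _; rewrite -ef.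
have {nx}nx f : f \in E -> ~~ xc [set p; y]%SET f.
  by move=> Ef; apply: contra nx => hf; apply/existsP; exists f; rewrite Ef.
have /and3P[Cp _ _] := diss_col dE Hpq; have /and3P[_ Cy _] := diss_col dE Hxy.
have Dpy : [set p; y]%SET \in diagonals n solid.
  by rewrite solid_diag; apply/and3P; split=> //; move: c1 c2; cyco.
(* Each side of [py] contains two labels, [q] and [u] on one and [x] and [v] on the other, while an
   edge cuts off only one. *)
have npy : [set p; y]%SET \notin edges n solid.
  apply/negP => /(edge_is_ear n2)[t] /orP[] et.
    have [/(earP et) k1|/negPn/eqP k1] := boolP (u != t).
      by move: k1 c1 c2; cyco.
    have [/(earP et) k2|/negPn/eqP k2] := boolP (q != t).
      by move: k2 c1 c2 h2; cyco.
    by move: c1 c2; rewrite k1 k2; cyco.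
  have [/(earP et) k1|/negPn/eqP k1] := boolP (x != t).
    by move: k1 c1 c2 h1; cyco.
  have [/(earP et) k2|/negPn/eqP k2] := boolP (v != t).
    by move: k2 c1 c2 h2; cyco.
  by move: c1 c2; rewrite k1 k2; cyco.
have Ipy : [set p; y]%SET \in A by rewrite AE inE npy Dpy; apply/asboolP.
have cF : compat A (@xc n.*2) ([set p; y]%SET |: E).
  split; first by rewrite finset.subUset finset.sub1set Ipy cE.1.
  move=> d f /finset.setU1P[->|Ed] /finset.setU1P[->|Ef].
  - by rewrite xc_irr.
  - exact: nx.
  - by rewrite xc_sym nx.
  - exact: cE.2.
have Epy : [set p; y]%SET \in E by rewrite -(mE _ cF (finset.subsetUr _ _)) finset.setU11.
exists p, y; split; first by rewrite /chord inE Epy.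
by move: c1 c2 h1 h2; cyco.
Qed.

Lemma g_dual E d e : maximal_compat A (@xc n.*2) E -> d \in E -> e \in E ->
  dot (g d) (c E e) = (d == e)%:R.
Proof.
move=> mE Ed Ee; have cE := mE.1; have dE := diss_compat cE.
have Id f : f \in E -> f \in internal_diagonals n solid by move/(fintype.subsetP (compat_internal cE)).
have dE' := diss_chord n2 (compat_internal cE) cE.2.
have zE f : f \in D -> zeta pt solid E e f = sgn R (chord solid E) e f.
  move=> Dx; apply: (zetaE n2 hpt (compat_internal cE) dE') => //.
  exact: internal_diag (fintype.subsetP subD _ Dx).
have chordE f : f \in E -> exists a b, f = [set a; b]%SET /\ chord solid E a b.
  by move=> Ex; apply: (with_edgesP (compat_internal cE)); rewrite inE Ex.
have [a [b [ed Hab]]] := chordE _ Ed; have [a' [b' [ee Hab']]] := chordE _ Ee.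
pose F f := sgn R H f d * sgn R (chord solid E) e f.
have -> : dot (g d) (c E e) = - \sum_(f in D) F f.
  rewrite -sumrN big_sub; apply: eq_bigr => x _.
  rewrite g_vectorE ?[c E e x]ffunE; last exact: internal_diag (Id _ Ed).
  by rewrite (zE _ (valP x)) mulrN.
(* [sgn_dual] sums over the polygon edges too, since its fans include them; the sign of [e] on an
   edge is zero. *)
have -> : \sum_(f in D) F f = \sum_(f in with_edges hollow D) F f.
  rewrite [RHS](bigID (mem D)) /= [X in _ + X]big1 ?addr0.
    by apply: eq_bigl => y; rewrite inE; case: (y \in D); rewrite ?andbF.
  move=> y /andP[]; rewrite inE => /orP[->//|Ey] _.
  have /diagonalsP[p [q [ey _ _ _]]] : y \in diagonals n hollow.
    by move: Ey; rewrite inE => /andP[].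
  by rewrite ey in Ey; rewrite /F ee ey (sgn_edge n2 R dE Hab' Ey) mulr0.
have Iab : [set a; b]%SET \in internal_diagonals n solid by rewrite -ed Id.
rewrite /F ed ee (sgn_dual R _ _ dissH dE) ?opprK //.
- by rewrite eq_sym.
- by move=> f /(with_edgesP subD)[p [q [-> _]]]; exists p, q.
- by move=> x y; apply: compat_acc.
- by move=> x y; apply: maximal_acc.
- by move=> t; apply: (internal_not_ear n2 t Iab).
- by move=> t; apply: (internal_not_ear n2 (c := solid)); rewrite finset.setUC.
Qed.

End Accordiohedron.

Theorem theorem2p20 (R : realType) (n : nat) (hn : (2 <= n)%N)
    (pt : 'I_(n.*2) -> (R^o * R^o)%type) (hpt : clockwise_on_circle pt)
    (D : {set {set 'I_(n.*2)}}) (hD : dissection pt hollow D) :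
  accordiohedron pt D = halfspace_intersection pt D /\
  normal_fan (accordiohedron pt D) = g_vector_fan pt D.
Proof.
pose A := internal_accordion_diagonals pt D.
have vE : accordiohedron pt D =
    conv_hull [set vertex A (@xc n.*2) (c_vector pt D) E | E in maximal_compat A (@xc n.*2)].
  rewrite /accordiohedron; congr conv_hull; apply/seteqP.
  have e E : maximal_compat A (@xc n.*2) E ->
      p_point pt D E = vertex A (@xc n.*2) (c_vector pt D) E.
    move=> [[sub _] _]; apply: eq_bigr => d Ed.
    by rewrite (heightE hn hpt) // (fintype.subsetP sub).
  split=> _ [E mE <-]; exists E; try exact/(maximalE hn hpt).
    by rewrite e //; apply/(maximalE hn hpt).
  by rewrite e.
have fE : halfspace_intersection pt D = facets A (@xc n.*2) (g_vector pt D).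
  apply: eq_bigcapr => d Ad; rewrite (heightE hn hpt) //.
have sp := g_span hn hpt hD; have rs := g_resolve hn hpt hD; have du := g_dual hn hpt hD.
rewrite vE (hull_facets (@xc_sym n) (@xc_irr n) sp rs du); split; first by rewrite fE.
rewrite (normal_fan_facets (@xc_sym n) (@xc_irr n) sp rs du).
apply/seteqP; split=> _ [E hE <-]; exists E => //; exact/(accordion_dissectionE hn hpt).
Qed.
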